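(* Let $E\subset H$ be a positively invariant set for the Leray-Hopf weak solutions of the three-dimensional incompressible Navier-Stokes equations. Let $B_R$ be a sufficiently large closed ball in $H$ that absorbs all the Leray-Hopf weak solutions. Let $\phi\in\mathcal{C}_b(E)$. Then $$\sup_{u\in\mathcal{U}(E)}\ \limsup_{T\to\infty}\frac1T\int_0^T\phi(u(t))\,dt\ \le\ \inf_{\Psi\in\mathcal{T}^{\mathrm{cyl}}(W')}\ \sup_{u\in E\cap B_R}\left\{\phi(u)+\langle F(u),\Psi'(u)\rangle_{W',W}\right\}.$$
   Context: Let $\Omega\subset\mathbb{R}^3$ be a bounded domain with smooth boundary and $\nu>0$. The Navier-Stokes equations are $\partial_t u-\nu\Delta u+(u\cdot\nabla)u+\nabla p=f$, $\nabla\cdot u=0$ in $\Omega$, with $u=0$ on $\partial\Omega$ and time-independent $f$. $H$ is the space of square-integrable divergence-free vector fields on $\Omega$ with vanishing normal component on $\partial\Omega$, with the $L^2(\Omega)^3$ inner product and norm $\|\cdot\|$; $V=H\cap H^1_0(\Omega)^3$, with the $H_0^1$ inner product $\langle\nabla u,\nabla v\rangle_{L^2}$; $H$ is identified with its dual, so $V\subset H\subset V'$; $f\in V'$. The Stokes operator $A:V\to V'$ is given by $\langle Au,v\rangle_{V',V}=\langle\nabla u,\nabla v\rangle_{L^2}$, and $D(A)=\{u\in V:\ Au\in H\}$. $B(\cdot,\cdot):V\times V\to V'$ is given by $\langle B(u,v),w\rangle_{V',V}=\int_\Omega((u\cdot\nabla)v)\cdot w\,dx$, and $F(u)=f-\nu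 Au-B(u,u)$ maps $V$ continuously into $V'$. $W=D(A)\cap W^{1,\infty}(\Omega)^3$, with its natural Banach norm, and $H\subset W'$ through the $L^2$ inner product. $F$ extends to a continuous map $F:H\to W'$, given by $\langle F(u),w\rangle_{W',W}=\langle f,w\rangle_{V',V}-\nu\langle u,Aw\rangle_{L^2}+\int_\Omega((u\cdot\nabla)w)\cdot u\,dx$. A Leray-Hopf weak solution (in the standard sense) is a function $u:[0,\infty)\to H$, weakly continuous in $H$, with $u\in L^\infty(0,T;H)\cap L^2(0,T;V)$ for all $T>0$, satisfying $\frac{d}{dt}\langle u,w\rangle_{L^2}=\langle F(u),w\rangle_{V',V}$ in the distribution sense on $(0,\infty)$ for all $w\in V$, and the energy inequality $\frac12\|u(t)\|^2+\nu\int_s^t\|\nabla u(r)\|^2dr\le\frac12\|u(s)\|^2+\int_s^t\langle f,u(r)\rangle_{V',V}dr$ for almost every $s\ge0$, including $s=0$, and all $t\ge s$. $E$ is positively invariant for the Leray-Hopf weak solutions if, for every $u_0\in E$, any such solution $u$ with $u(0)=u_0$ satisfies $u(t)\in E$ for all $t\ge0$. $\mathcal{U}(E)$ is the set of all Leray-Hopf weak solutions on $[0,\infty)$ with values in $E$. $B_R$ absorbs all the Leray-Hopf weak solutions if for each such solution $u$ there is $T\ge0$ with $u(t)\in B_R$ for all $t\ge T$; a sufficiently large ball has this property. $\mathcal{C}_b(E)$ is the space of bounded continuous real-valued functions on $E$ (norm topology of $H$). $\mathcal{T}^{\mathrm{cyl}}(W')$ is the set of functions $\Psi:W'\to\mathbb{R}$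 of the form $\Psi(u)=\psi(\langle u,w_1\rangle_{W',W},\ldots,\langle u,w_m\rangle_{W',W})$, with $m\in\mathbb{N}$, $w_j\in W$, $\psi\in\mathcal{C}^1_c(\mathbb{R}^m)$; its derivative is $\Psi'(u)=\sum_{j=1}^m\partial_j\psi(\langle u,w_1\rangle_{W',W},\ldots,\langle u,w_m\rangle_{W',W})\,w_j\in W$. *)

(* Defs.v *)
From HB Require Import structures.
From mathcomp Require Import all_boot all_order all_algebra.
From mathcomp Require Import all_classical all_reals all_analysis.

Set Implicit Arguments.
Unset Strict Implicit.
Unset Printing Implicit Defensive.

Import Order.TTheory GRing.Theory Num.Theory.
Import numFieldNormedType.Exports.

Local Open Scope classical_set_scope.
Local Open Scope ring_scope.

(* R^3 is R * R * R, which carries both the product topology and the product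
   Borel sigma-algebra.  Its library norm is the sup norm; it only serves to
   define topological notions.

   Elements of function spaces over Omega are represented by everywhere-defined
   functions on R^3 whose values outside Omega are irrelevant.  Equality of
   elements is almost everywhere equality on Omega ([feq] below). *)
Notation space3 R := (R * R * R)%type.
Notation vfield R := (space3 R -> 'rV[R]_3).

Section Calculus.
Context {R : realType}.
Implicit Types (g : space3 R -> R) (x : space3 R) (i : 'I_3).

Definition vol :=
  ((@lebesgue_measure R \x @lebesgue_measure R) \x @lebesgue_measure R)%E.

Definition coord3 i x : R :=
  match val i with 0 => x.1.1 | 1 => x.1.2 | _ => x.2 end%N.

Definition evec i : space3 R :=
  ((val i == 0%N)%:R, (val i == 1%N)%:R, (val i == 2%N)%:R).

Definition partial i g : space3 R -> R := fun x => 'D_(evec i) g x.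

Definition partials (s : seq 'I_3) g : space3 R -> R := foldr partial g s.

Definition smooth g : Prop := forall s : seq 'I_3,
  continuous (partials s g) /\
  forall i x, derivable (partials s g) x (evec i).

Definition test_function (Omega : set (space3 R)) g : Prop :=
  smooth g /\
  exists K : set (space3 R), [/\ compact K, K `<=` Omega & forall x, ~ K x -> g x = 0].

(* Compactly supported smooth functions on (0, oo). *)
Definition time_test_function (eta : R -> R) : Prop :=
  (forall n t, derivable (derive1n n eta) t 1) /\
  exists K : set R, [/\ compact K, K `<=` `]0, +oo[ & forall t, ~ K t -> eta t = 0].

Definition C1c m (psi : 'rV[R]_m -> R) : Prop :=
  [/\ continuous psi,
      (forall j, (forall y, derivable psi y (delta_mx 0 j)) /\
                 continuous (fun y => 'D_(delta_mx 0 j) psi y)) &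
      exists K : set 'rV[R]_m, compact K /\ forall y, ~ K y -> psi y = 0].

(* Near each boundary point, up to the choice and the orientation (b) of an
   axis i, Omega is the region above the graph of a smooth function gam of the
   two other coordinates. *)
Definition smooth_boundary (Omega : set (space3 R)) : Prop :=
  forall x0, (closure Omega `\` Omega) x0 ->
  exists (r : R) (i : 'I_3) (b : bool) (gam : space3 R -> R),
    [/\ 0 < r, smooth gam,
        (forall x (h : R), gam (x + h *: evec i) = gam x) &
        forall x, ball x0 r x -> (Omega x <-> gam x < (-1) ^+ b * coord3 i x)].

Definition bounded_smooth_domain (Omega : set (space3 R)) : Prop :=
  [/\ Omega !=set0, open Omega, connected Omega, bounded_set Omega &
      smooth_boundary Omega].

End Calculus.

Section FunctionSpaces.
Context {R : realType} (Omega : set (space3 R)).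
Implicit Types (g : space3 R -> R) (u v w h : vfield R) (i j : 'I_3).

Definition in_L2 g : Prop :=
  measurable_fun Omega g /\ vol.-integrable Omega (fun x => (g x ^+ 2)%:E).

Definition is_weak_partial i g (dg : space3 R -> R) : Prop :=
  in_L2 dg /\ forall psi, test_function Omega psi ->
    \int[vol]_(x in Omega) (g x * partial i psi x) =
    - (\int[vol]_(x in Omega) (dg x * psi x)).

Definition in_H1 g : Prop :=
  in_L2 g /\ forall i, exists dg, is_weak_partial i g dg.

(* The L2 weak partial derivative, unique up to a null set when it exists; the
   zero function otherwise. *)
Definition wpartial i g : space3 R -> R := xget (cst 0) (is_weak_partial i g).

(* Closure of the test functions in the H1 norm. *)
Definition in_H10 g : Prop :=
  in_H1 g /\ forall eps : R, 0 < eps -> exists psi, test_function Omega psi /\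
    \int[vol]_(x in Omega) ((g x - psi x) ^+ 2 +
       \sum_i (wpartial i g x - partial i psi x) ^+ 2) < eps.

Definition Linfnorm g : \bar R := 'N[vol]_+oo [EFin \o (g \_ Omega)].

Definition in_Linf g : Prop := measurable_fun Omega g /\ (Linfnorm g < +oo)%E.

Definition component i u : space3 R -> R := fun x => u x 0 i.

Definition feq u v : Prop := {ae vol, forall x, Omega x -> u x = v x}.

Definition ip u v : R := \int[vol]_(x in Omega) \sum_i (u x 0 i * v x 0 i).

Definition l2norm u : R := Num.sqrt (ip u u).

Definition divergence_free u : Prop :=
  forall psi, test_function Omega psi ->
    \int[vol]_(x in Omega) \sum_i (u x 0 i * partial i psi x) = 0.

(* The normal trace of an L2 field u with div u in L2 is the element of
   H^{-1/2}(dOmega) given by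
     <u.n, g> = int_Omega u . grad g + int_Omega (div u) g,   g in H1(Omega);
   here it is only applied to fields with div u = 0. *)
Definition zero_normal_trace u : Prop :=
  forall g, in_H1 g ->
    \int[vol]_(x in Omega) \sum_i (u x 0 i * wpartial i g x) = 0.

Definition Hspace : set (vfield R) := [set u |
  [/\ forall i, in_L2 (component i u), divergence_free u & zero_normal_trace u]].

Definition Vspace : set (vfield R) := [set u | Hspace u /\ forall i, in_H10 (component i u)].

(* < grad u, grad v >_{L2} *)
Definition gradip u v : R :=
  \int[vol]_(x in Omega)
    \sum_i \sum_j (wpartial j (component i u) x * wpartial j (component i v) x).

(* int_Omega ((u . grad) v) . w *)
Definition trilin u v w : R :=
  \int[vol]_(x in Omega)
    \sum_i \sum_j (u x 0 j * wpartial j (component i v) x * w x 0 i).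

Definition linear_on (S : set (vfield R)) (L : vfield R -> R) : Prop :=
  forall (a : R) v w, S v -> S w -> L (a *: v + w) = a * L v + L w.

Definition Vdual : set (vfield R -> R) := [set L | linear_on Vspace L /\
  exists C : R, forall v, Vspace v -> `|L v| <= C * Num.sqrt (gradip v v)].

(* Stokes operator V -> V' *)
Definition stokes u : vfield R -> R := fun v => gradip u v.

(* h in H represents A u in V' *)
Definition is_stokesH u h : Prop := Hspace h /\ forall v, Vspace v -> stokes u v = ip h v.

Definition domA : set (vfield R) := [set u | Vspace u /\ exists h, is_stokesH u h].

(* A u as an element of H, for u in D(A) *)
Definition stokesH u : vfield R := xget (cst 0) (is_stokesH u).

Definition Wspace : set (vfield R) := [set w | domA w /\
  forall i, in_Linf (component i w) /\ forall j, in_Linf (wpartial j (component i w))].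

Definition Wnorm w : R :=
  l2norm (stokesH w) +
  \sum_i (fine (Linfnorm (component i w)) +
          \sum_j fine (Linfnorm (wpartial j (component i w)))).

Definition Wdual : set (vfield R -> R) := [set L | linear_on Wspace L /\
  exists C : R, forall w, Wspace w -> `|L w| <= C * Wnorm w].

Definition H_to_Wdual u : vfield R -> R := fun w => ip u w.

(* Psi belongs to T^cyl(W') and dPsi is its derivative. *)
Definition Tcyl (Psi : (vfield R -> R) -> R) (dPsi : (vfield R -> R) -> vfield R)
    : Prop :=
  exists (m : nat) (w : 'I_m -> vfield R) (psi : 'rV[R]_m -> R),
    [/\ forall k, Wspace (w k), C1c psi &
        forall L, Wdual L ->
          Psi L = psi (\row_k L (w k)) /\
          dPsi L = \sum_(l < m) ('D_(delta_mx 0 l) psi (\row_k L (w k))) *: w l].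

(* A subset of H: a set of representatives saturated for a.e. equality. *)
Definition subset_of_H (E : set (vfield R)) : Prop :=
  E `<=` Hspace /\ forall u v, E u -> Hspace v -> feq u v -> E v.

Definition Hball (rho : R) : set (vfield R) := [set u | Hspace u /\ l2norm u <= rho].

Definition Cb (E : set (vfield R)) (phi : vfield R -> R) : Prop :=
  (exists M : R, forall u, E u -> `|phi u| <= M) /\
  forall u, E u -> forall eps : R, 0 < eps -> exists2 delta : R, 0 < delta &
    forall v, E v -> l2norm (v - u) < delta -> `|phi v - phi u| < eps.

End FunctionSpaces.

Section NavierStokes.
Context {R : realType} (Omega : set (space3 R)) (nu : R) (f : vfield R -> R).
Implicit Types (w : vfield R) (u : R -> vfield R) (T s t : R).

(* F : V -> V' *)
Definition FV (v : vfield R) : vfield R -> R := fun w =>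
  f w - nu * stokes Omega v w - trilin Omega v v w.

(* F : H -> W' *)
Definition FW (v : vfield R) : vfield R -> R := fun w =>
  f w - nu * ip Omega v (stokesH Omega w) + trilin Omega v w v.

(* Strong measurability of u : ]0, T[ -> S for a separable Hilbert space S with
   inner product pair, in the form given by Pettis' theorem: u is a.e. S-valued
   and weakly measurable. *)
Definition bochner_measurable (S : set (vfield R))
    (pair : vfield R -> vfield R -> R) T u : Prop :=
  exists N : set R,
    [/\ measurable N, lebesgue_measure N = 0%E,
        forall t, (`]0, T[ `\` N) t -> S (u t) &
        forall v, S v -> measurable_fun (`]0, T[ `\` N) (fun t => pair (u t) v)].

Definition Linfty_Hspace T u : Prop :=
  bochner_measurable (Hspace Omega) (ip Omega) T u /\
  exists M : R, {ae @lebesgue_measure R,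
    forall t, 0 < t < T -> l2norm Omega (u t) <= M}.

Definition L2_Vspace T u : Prop :=
  bochner_measurable (Vspace Omega) (gradip Omega) T u /\
  (\int[@lebesgue_measure R]_(t in `]0%R, T[) (gradip Omega (u t) (u t))%:E
     < +oo)%E.

Definition weakly_continuous u : Prop :=
  forall h, Hspace Omega h -> {within `[0, +oo[, continuous (fun t => ip Omega (u t) h)}.

Definition weak_equation u : Prop :=
  forall w, Vspace Omega w -> forall eta, time_test_function eta ->
    - (\int[@lebesgue_measure R]_(t in `]0, +oo[)
         (derive1 eta t * ip Omega (u t) w)) =
    \int[@lebesgue_measure R]_(t in `]0, +oo[) (eta t * FV (u t) w).

Definition energy_inequality_from u s : Prop :=
  forall t, s <= t ->
    2^-1 * l2norm Omega (u t) ^+ 2 +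
      nu * (\int[@lebesgue_measure R]_(r in `[s, t]) gradip Omega (u r) (u r))
    <= 2^-1 * l2norm Omega (u s) ^+ 2 +
      (\int[@lebesgue_measure R]_(r in `[s, t]) f (u r)).

(* Only the restriction of u to [0, oo) matters. *)
Definition leray_hopf : set (R -> vfield R) := [set u |
  [/\ forall t, 0 <= t -> Hspace Omega (u t),
      weakly_continuous u,
      forall T, 0 < T -> Linfty_Hspace T u /\ L2_Vspace T u,
      weak_equation u &
      energy_inequality_from u 0 /\
      {ae @lebesgue_measure R, forall s, 0 <= s -> energy_inequality_from u s}]].

Definition positively_invariant (E : set (vfield R)) : Prop :=
  forall (u0 : vfield R) u, E u0 -> leray_hopf u -> feq Omega (u 0) u0 ->
    forall t, 0 <= t -> E (u t).

(* U(E) *)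
Definition solutions_in (E : set (vfield R)) : set (R -> vfield R) :=
  [set u | leray_hopf u /\ forall t, 0 <= t -> E (u t)].

Definition absorbs_all_solutions (B : set (vfield R)) : Prop :=
  forall u, leray_hopf u ->
    exists T, 0 <= T /\ forall t, T <= t -> B (u t).

End NavierStokes.

(* Main.v *)
(* Let u be a Leray-Hopf solution and Psi = psi(<., w_1>, ..., <., w_m>) a
   cylindrical functional.  Once u has entered the absorbing ball, each <u, w_k>
   is Lipschitz in time with derivative <F(u), w_k>, so Psi(u) is a primitive of
   <F(u), Psi'(u)>.  As Psi is bounded, the time average of <F(u), Psi'(u)> over
   [0, T] is O(1/T), and adding it to phi(u) does not change the limsup, which is
   therefore at most the supremum of phi + <F, Psi'> on the part of E in the ball.

   The quadratic term of <F(u), w_k> is norm continuous on H, and u is only weakly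
   continuous; it is measurable in t because u takes its values in the closure of
   the rational combinations of its values at rational times.  The function
   phi(u) is never required to be measurable: its integral is only bounded from
   above by that of a measurable function which dominates it almost everywhere. *)
Require Import Defs.
From HB Require Import structures.
From mathcomp Require Import all_boot all_order all_algebra.
From mathcomp Require Import all_classical all_reals all_analysis.
From mathcomp Require Import measurable_realfun ring lra.

Set Implicit Arguments.
Unset Strict Implicit.
Unset Printing Implicit Defensive.

Import Order.TTheory GRing.Theory Num.Theory.
Import numFieldNormedType.Exports.

Local Open Scope classical_set_scope.
Local Open Scope ring_scope.

(** * Smooth bump functions *)

(** Elements of H, V and W are functions modulo null sets, and [wpartial] and [stokesH] are chosen
    representatives. Hilbert space arguments are therefore made for a possibly degenerate form on a
    subset of a vector space, and identities between weak derivatives hold almost everywhere, by the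
    fundamental lemma of the calculus of variations; this is what calls for explicit smooth bumps.

    The weak equation is written with [FV], the conclusion with [FW]. They agree on V against W,
    because a field of H is orthogonal to gradients of H1 functions, and u(t) is known to lie in V
    for almost every t only. Hence the null sets of times that accompany the proof, with integrands
    about which nothing is known on them.

    The time derivative of <u, w_k> is just a bounded measurable function, so the chain rule for
    Psi(u) is not read off pointwise: the difference between Psi(u) and its expected primitive is
    shown to have derivative zero at every time, which needs no differentiation theorem for
    integrals. *)

Section SmoothStep.
Context {R : realType}.
Implicit Types f g h : R -> R.

Lemma is_derive_bound f (x l : R) :
  (forall e : R, 0 < e -> exists2 d : R, 0 < d &
     forall y, `|y| < d -> `|f (y + x) - f x - l * y| <= e * `|y|) ->
  is_derive x 1 f l.
Proof.
move=> fl.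
have cv : (h^-1 *: ((f \o shift x) (h *: (1 : R)) - f x)) @[h --> 0^'] --> l.
  apply/cvgrPdist_le => e e0; have [d d0 Hd] := fl e e0.
  near=> y.
  have y0 : y != 0 by near: y; exact: nbhs_dnbhs_neq.
  have yd : `|y| < d by near: y; exact: dnbhs0_lt.
  rewrite /= /GRing.scale /= mulr1 distrC.
  have -> : y^-1 * (f (y + x) - f x) - l = y^-1 * (f (y + x) - f x - l * y).
    by rewrite [RHS]mulrBr mulrCA mulVf// mulr1.
  rewrite normrM normfV ler_pdivrMl ?normr_gt0// [leRHS]mulrC.
  exact: Hd.
apply: DeriveDef; first by apply/cvg_ex; exists l.
exact: cvg_lim cv.
Unshelve. all: by end_near. Qed.

Definition smooth1 f := forall n t, derivable (derive1n n f) t 1.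

(** With this coinduction principle, each closure property below needs only a class stable under
    derivation and one first-order computation, never a formula for the n-th derivative. *)
Lemma smooth1_coind (S : set (R -> R)) :
  (forall f, S f -> (forall t, derivable f t 1) /\ S (derive1 f)) ->
  forall f, S f -> smooth1 f.
Proof.
move=> SP f Sf n; elim: n f Sf => [|n IH] f Sf t.
  by have [+ _] := SP _ Sf; apply.
by rewrite derive1Sn; apply: IH; have [] := SP _ Sf.
Qed.

Lemma smooth1_derivable f : smooth1 f -> forall t, derivable f t 1.
Proof. by move=> sf t; exact: (sf 0%N t). Qed.

Lemma smooth1_derive f : smooth1 f -> smooth1 (derive1 f).
Proof. by move=> sf n t; rewrite -derive1Sn; exact: sf. Qed.

Lemma smooth1_cst (c : R) : smooth1 (cst c).
Proof.
apply: (@smooth1_coind [set f | exists c, f = cst c]); last by exists c.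
move=> _ [d ->]; split=> [t|]; first exact: derivable_cst.
by exists 0; apply/funext => t; rewrite derive1_cst.
Qed.

Lemma smooth1D f g : smooth1 f -> smooth1 g -> smooth1 (f + g).
Proof.
move=> sf sg.
apply: (@smooth1_coind [set h | exists f g, [/\ smooth1 f, smooth1 g & h = f + g]]);
  last by exists f, g.
move=> _ [u [v [su sv ->]]]; split=> [t|].
  by apply: derivableD; apply: smooth1_derivable.
exists (derive1 u), (derive1 v); split; [exact: smooth1_derive..|].
by apply/funext => t; rewrite derive1E deriveD -?derive1E//; apply: smooth1_derivable.
Qed.

(** The derivative of a product is a sum of two products, so products alone are not a stable class;
    their finite sums are. *)
Inductive product_span : (R -> R) -> Prop :=
| product_span_mul f g : smooth1 f -> smooth1 g -> product_span (f * g)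
| product_span_add f g : product_span f -> product_span g -> product_span (f + g).

Lemma smooth1M f g : smooth1 f -> smooth1 g -> smooth1 (f * g).
Proof.
move=> sf sg; apply: (@smooth1_coind product_span); last exact: product_span_mul.
move=> h; elim=> {h} [u v su sv|u v pu [du pdu] pv [dv pdv]].
  split=> [t|]; first by apply: derivableM; apply: smooth1_derivable.
  have -> : derive1 (u * v) = u * derive1 v + v * derive1 u.
    apply/funext => t; rewrite derive1E deriveM; try exact: smooth1_derivable.
    by rewrite -!derive1E.
  exact: (product_span_add (product_span_mul su (smooth1_derive sv))
                            (product_span_mul sv (smooth1_derive su))).
split=> [t|]; first exact: derivableD.
have -> : derive1 (u + v) = derive1 u + derive1 v.
  by apply/funext => t; rewrite derive1E deriveD// -!derive1E.
exact: product_span_add.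
Qed.

Lemma smooth1_affine (a b : R) f : smooth1 f -> smooth1 (fun x => f (a * x + b)).
Proof.
move=> sf; apply: (@smooth1_coind
  [set h | exists c f, smooth1 f /\ h = fun x => c * f (a * x + b)]); last first.
  by exists 1, f; split=> //; apply/funext => x; rewrite mul1r.
move=> _ [c [g [sg ->]]].
have dg (t : R) : is_derive t 1 (fun x => c * g (a * x + b)) (c * a * (derive1 g) (a * t + b)).
  have dga := derivableP (@smooth1_derivable _ sg (a * t + b)).
  have h1 : is_derive t 1 (fun x : R => a * x + b) a.
    by apply: is_derive_eq; rewrite /GRing.scale /= ?scaler0; ring.
  have h2 := @is_derive1_comp R g (fun x => a * x + b) t _ _ dga h1.
  apply: (is_derive_eq (is_deriveZ c h2)).
  by rewrite derive1E /GRing.scale /=; ring.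
split=> [t|]; first by case: (dg t).
exists (c * a), (derive1 g); split; first exact: smooth1_derive.
by apply/funext => t; rewrite derive1E; case: (dg t).
Qed.

(** The quotients g / f^n with g smooth form a stable class: the derivative has numerator g' f - n g
    f' over f^(n+1). *)
Lemma smooth1V f : smooth1 f -> (forall x, f x != 0) -> smooth1 (fun x => (f x)^-1).
Proof.
move=> sf f0; apply: (@smooth1_coind
  [set h | exists n g, smooth1 g /\ h = fun x => g x * (f x)^-1 ^+ n]); last first.
  exists 1%N, (cst 1); split; first exact: smooth1_cst.
  by apply/funext => x; rewrite mul1r.
move=> _ [n [g [sg ->]]].
have dh (t : R) : is_derive t 1 (fun x => g x * (f x)^-1 ^+ n)
    (((derive1 g) t * f t - n%:R * g t * (derive1 f) t) * (f t)^-1 ^+ n.+1).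
  have dg := derivableP (@smooth1_derivable _ sg t).
  have df := derivableP (@smooth1_derivable _ sf t).
  have -> : (fun x => g x * (f x)^-1 ^+ n) = g * (fun x => (f x)^-1) ^+ n.
    by apply/funext => x; rewrite /= mulrfctE exprfctE.
  apply: (is_derive_eq (is_deriveM dg (is_deriveX n (is_deriveV (f0 t) df)))).
  rewrite !derive1E /GRing.scale /=.
  case: n => [|n] /=.
    by rewrite !fctE expr0 expr1 !mul0r mulr0 subr0 mul1r add0r mulfK.
  rewrite !fctE !exprS; have := f0 t; move: (f t) => y y0.
  by field.
split=> [t|]; first by case: (dh t).
have s1 := smooth1_derive sg; have s2 := smooth1_derive sf.
have s3 := smooth1D (smooth1M s1 sf) (smooth1M (smooth1M (@smooth1_cst (- n%:R)) sg) s2).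
exists n.+1; eexists; split; first exact: s3.
apply/funext => t; rewrite derive1E; case: (dh t) => _ ->.
by rewrite !fctE; ring.
Qed.

(** The flat function exp(-1/x) with a polynomial factor in 1/x: this factor makes the family stable
    under derivation, p becoming X^2 (p - p'). *)
Definition exp_cutoff (p : {poly R}) (x : R) : R :=
  if 0 < x then p.[x^-1] * expR (- x^-1) else 0.

Lemma exp_cutoff_le0 p x : x <= 0 -> exp_cutoff p x = 0.
Proof. by move=> x0; rewrite /exp_cutoff ltNge x0. Qed.

Lemma exp_cutoff_gt0 p x : 0 < x -> exp_cutoff p x = p.[x^-1] * expR (- x^-1).
Proof. by move=> x0; rewrite /exp_cutoff x0. Qed.

(** A monomial y^n, n > 0, is controlled by writing e^y as the n-th power of e^(y/n) and using y/n
    <= e^(y/n); polynomials follow by linearity. *)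
Lemma horner_exp_bounded (p : {poly R}) :
  exists C : R, forall y, 0 <= y -> `|p.[y] * expR (- y)| <= C.
Proof.
have mono n : exists C : R, forall y, 0 <= y -> `|y ^+ n * expR (- y)| <= C.
  exists (n.+1%:R ^+ n) => y y0.
  rewrite ger0_norm ?mulr_ge0 ?exprn_ge0 ?expR_ge0// expRN ler_pdivrMr ?expR_gt0//.
  case: n => [|n]; first by rewrite !expr0 mul1r -[leLHS]expR0 ler_expR.
  have -> : expR y = expR (y / n.+1%:R) ^+ n.+1.
    by rewrite -expRM_natl mulrCA mulfV ?pnatr_eq0// mulr1.
  rewrite -exprMn lerXn2r ?nnegrE// ?mulr_ge0// ?expR_ge0//.
  have := expR_ge1Dx (y / n.+1%:R).
  have n0 : 0 < (n.+1%:R : R) by rewrite ltr0n.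
  move=> h; apply: (@le_trans _ _ (n.+1%:R * expR (y / n.+1%:R))); last first.
    by rewrite ler_wpM2r ?expR_ge0// ler_nat.
  by rewrite mulrC -ler_pdivrMr//; apply: le_trans h; rewrite lerDr.
elim/poly_ind: p => [|p c [C HC]].
  by exists 0 => y _; rewrite horner0 mul0r normr0.
have [K HK] : exists C : R, forall y, 0 <= y -> `|(p * 'X).[y] * expR (- y)| <= C.
  rewrite -[p]coefK poly_def mulr_suml.
  elim/big_ind: _ => [|q r [A HA] [B HB]|i _].
  - by exists 0 => y _; rewrite horner0 mul0r normr0.
  - exists (A + B) => y y0; rewrite hornerD mulrDl.
    by apply: (le_trans (ler_normD _ _)); apply: lerD; [exact: HA|exact: HB].
  - have [A HA] := mono i.+1; exists (`|p`_i| * A) => y y0.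
    rewrite -scalerAl -exprSr hornerZ hornerXn -mulrA normrM.
    by rewrite ler_wpM2l// HA.
have [A HA] := mono 0%N.
exists (K + `|c| * A) => y y0; rewrite hornerD hornerC mulrDl.
apply: (le_trans (ler_normD _ _)); apply: lerD; first exact: HK.
by rewrite normrM ler_wpM2l//; have := HA y y0; rewrite expr0 mul1r.
Qed.

Lemma is_derive_exp_cutoff (p : {poly R}) (x : R) :
  is_derive x 1 (exp_cutoff p) (exp_cutoff ('X^2 * (p - p^`())) x).
Proof.
have [x0|x0|->] := ltgtP x 0.
- rewrite (exp_cutoff_le0 _ (ltW x0)).
  apply: (@near_eq_is_derive _ _ _ (cst 0)).
    near=> y; rewrite exp_cutoff_le0//.
    by apply: ltW; near: y; exact: lt_nbhsl.
- rewrite (exp_cutoff_gt0 _ x0).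
  apply: (@near_eq_is_derive R R R (fun y : R => p.[y^-1] * expR (- y^-1))).
    near=> y; rewrite exp_cutoff_gt0//.
    by near: y; exact: lt_nbhsr.
  have dV : is_derive x 1 (fun y : R => y^-1) (- x ^- 2).
    have := @is_deriveV R id x 1 1 (lt0r_neq0 x0) (is_derive_id _ _).
    by rewrite /GRing.scale /= mulr1.
  have d1 := @is_derive1_comp R (horner p) (fun y => y^-1) x _ _ (is_derive_poly p x^-1) dV.
  have dN : is_derive x 1 (fun y : R => - y^-1) (x ^- 2).
    by have := is_deriveN dV; rewrite opprK.
  have d2 := @is_derive1_comp R expR (fun y => - y^-1) x _ _ (is_derive_expR (- x^-1)) dN.
  apply: (is_derive_eq (is_deriveM d1 d2)).
  rewrite /GRing.scale /= hornerM hornerXn hornerD hornerN.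
  rewrite exprVn. ring.
rewrite exp_cutoff_le0//.
apply: is_derive_bound => e e0.
(* Boundedness of p X^2 against e^(-y) gives [exp_cutoff p y] = O(y^2) at 0, hence the derivative 0
   there. *)
have [C HC] := horner_exp_bounded (p * 'X^2).
have C0 : 0 <= C by apply: le_trans (HC 0 _).
exists (e / (C + 1)) => [|y yd]; first by rewrite divr_gt0// ltr_wpDl.
rewrite mul0r subr0 addr0 /exp_cutoff ltxx subr0.
case: ifPn => [y0|_]; last by rewrite normr0 mulr_ge0// ltW.
have := HC y^-1; rewrite invr_ge0 => /(_ (ltW y0)).
rewrite hornerM hornerXn -mulrA mulrC -mulrA normrM normrX normfV.
rewrite (gtr0_norm y0) => H.
have -> : p.[y^-1] * expR (- y^-1) = expR (- y^-1) * p.[y^-1] by rewrite mulrC.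
rewrite gtr0_norm// in yd.
move: H; rewrite exprVn ler_pdivrMl ?exprn_gt0// => H.
apply: (le_trans H); rewrite expr2 -mulrA mulrC ler_wpM2r ?(ltW y0)//.
move: yd; rewrite ltr_pdivlMr ?ltr_wpDl// => yd.
by apply: le_trans (ltW yd); rewrite ler_wpM2l ?(ltW y0)// lerDl.
Unshelve. all: by end_near. Qed.

Lemma smooth1_exp_cutoff p : smooth1 (exp_cutoff p).
Proof.
apply: (@smooth1_coind [set f | exists p, f = exp_cutoff p]); last by exists p.
move=> _ [q ->]; split=> [t|]; first by case: (is_derive_exp_cutoff q t).
exists ('X^2 * (q - q^`())); apply/funext => t; rewrite derive1E.
by case: (is_derive_exp_cutoff q t).
Qed.

(** The classical transition function h(x) / (h(x) + h(1 - x)) with h = exp(-1/x); the argument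
    [- 1 * x + 1] has the shape handled by [smooth1_affine]. *)
Definition smooth_step (x : R) : R :=
  exp_cutoff 1 x / (exp_cutoff 1 x + exp_cutoff 1 (- 1 * x + 1)).

Lemma exp_cutoff1_ge0 x : 0 <= exp_cutoff 1 x.
Proof. by rewrite /exp_cutoff; case: ifP => // _; rewrite hornerE mul1r expR_ge0. Qed.

Lemma exp_cutoff1_gt0 x : 0 < x -> 0 < exp_cutoff 1 x.
Proof. by rewrite /exp_cutoff => ->; rewrite hornerE mul1r expR_gt0. Qed.

Lemma smooth_step_den_gt0 (x : R) : 0 < exp_cutoff 1 x + exp_cutoff 1 (- 1 * x + 1).
Proof.
have [x0|x0] := ltP 0 x; first by rewrite ltr_wpDr ?exp_cutoff1_ge0 ?exp_cutoff1_gt0.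
by rewrite ltr_wpDl ?exp_cutoff1_ge0 ?exp_cutoff1_gt0//; lra.
Qed.

Lemma smooth1_step : smooth1 smooth_step.
Proof.
apply: smooth1M; first exact: smooth1_exp_cutoff.
apply: (smooth1V (f := fun x : R => exp_cutoff 1 x + exp_cutoff 1 (-1 * x + 1))); last first.
  by move=> x; rewrite gt_eqF// smooth_step_den_gt0.
apply: smooth1D; first exact: smooth1_exp_cutoff.
by apply: smooth1_affine; exact: smooth1_exp_cutoff.
Qed.

Lemma smooth_step_le0 x : x <= 0 -> smooth_step x = 0.
Proof. by move=> x0; rewrite /smooth_step {1}/exp_cutoff ltNge x0 /= mul0r. Qed.

Lemma smooth_step_ge1 x : 1 <= x -> smooth_step x = 1.
Proof.
move=> x1; rewrite /smooth_step.
have -> : exp_cutoff 1 (- 1 * x + 1) = 0 by rewrite /exp_cutoff ifF//; apply/negP; lra.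
rewrite addr0 divff// gt_eqF// exp_cutoff1_gt0//; lra.
Qed.

Lemma smooth_step_ge0 x : 0 <= smooth_step x.
Proof. by rewrite divr_ge0 ?exp_cutoff1_ge0// ltW// smooth_step_den_gt0. Qed.

Lemma smooth_step_le1 x : smooth_step x <= 1.
Proof. by rewrite ler_pdivrMr ?smooth_step_den_gt0// mul1r lerDl exp_cutoff1_ge0. Qed.

Lemma smooth1_continuous f : smooth1 f -> continuous f.
Proof.
move=> sf t; apply: differentiable_continuous; apply/derivable1_diffP.
exact: smooth1_derivable.
Qed.

End SmoothStep.

(** * Smooth bumps supported in boxes of R^3 *)

Section SmoothFields.
Context {R : realType}.
Implicit Types (g h : space3 R -> R) (x : space3 R).

(** Only increments along one line enter a directional derivative. This carries derivatives between
    R^3, or row vectors, and the real line. *)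
Lemma is_derive_transfer (V W : normedModType R) (f : V -> R) (g : W -> R)
    (x v : V) (y w : W) (l : R) :
  (forall t : R, f (t *: v + x) - f x = g (t *: w + y) - g y) ->
  is_derive y w g l -> is_derive x v f l.
Proof.
move=> fg dg.
have E : (fun t : R => t^-1 *: ((f \o shift x) (t *: v) - f x)) =
         (fun t : R => t^-1 *: ((g \o shift y) (t *: w) - g y)).
  by apply/funext => t; rewrite /= fg.
by case: dg => dg dgl; split; rewrite ?/derivable ?/derive E.
Qed.

Lemma partials_rcons (s : seq 'I_3) i g :
  partials (rcons s i) g = partials s (partial i g).
Proof. by rewrite /partials foldr_rcons. Qed.

Lemma smooth_coind (S : set (space3 R -> R)) :
  (forall g, S g -> [/\ continuous g, forall i x, derivable g x (evec i) &
     forall i, S (partial i g)]) ->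
  forall g, S g -> smooth g.
Proof.
(* [partials] takes the derivative of the last index first, and the class is stable under this
   innermost derivative. *)
move=> SP g Sg s; elim/last_ind: s g Sg => [|s i IH] g Sg.
  by have [cg dg _] := SP _ Sg.
by rewrite partials_rcons; apply: IH; have [_ _] := SP _ Sg.
Qed.

Lemma smooth_continuous g : smooth g -> continuous g.
Proof. by move=> /(_ [::]) []. Qed.

Lemma smooth_derivable g : smooth g -> forall i x, derivable g x (evec i).
Proof. by move=> /(_ [::]) []. Qed.

Lemma smooth_partial i g : smooth g -> smooth (partial i g).
Proof. by move=> sg s; rewrite -partials_rcons; exact: sg. Qed.

Lemma partialM g h : smooth g -> smooth h -> forall i,
  partial i (g * h) = g * partial i h + h * partial i g.
Proof.
move=> sg sh i; apply/funext => x; rewrite /partial deriveM//.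
- exact: smooth_derivable.
- exact: smooth_derivable.
Qed.

Inductive field_span : (space3 R -> R) -> Prop :=
| field_span_mul g h : smooth g -> smooth h -> field_span (g * h)
| field_span_add g h : field_span g -> field_span h -> field_span (g + h).

Lemma smoothM g h : smooth g -> smooth h -> smooth (g * h).
Proof.
move=> sg sh; apply: (@smooth_coind field_span); last exact: field_span_mul.
move=> k; elim=> {k} [u v su sv|u v pu [cu du pdu] pv [cv dv pdv]]; split.
- by move=> x; apply: cvgM; apply: smooth_continuous.
- by move=> i x; apply: derivableM; apply: smooth_derivable.
- move=> i; rewrite partialM//.
  exact: (field_span_add (field_span_mul su (smooth_partial i sv))
                         (field_span_mul sv (smooth_partial i su))).
- by move=> x; apply: cvgD; [exact: cu|exact: cv].
- by move=> i x; apply: derivableD; [exact: du|exact: dv].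
- move=> i.
  have -> : partial i (u + v) = partial i u + partial i v.
    by apply/funext => x; rewrite /partial deriveD.
  exact: (field_span_add (pdu i) (pdv i)).
Qed.

Lemma continuous_coord3 i : continuous (@coord3 R i).
Proof.
have cfst (U V : topologicalType) : continuous (fst : U * V -> U).
  by move=> [a b]; exact: cvg_fst.
have csnd (U V : topologicalType) : continuous (snd : U * V -> V).
  by move=> [a b]; exact: cvg_snd.
rewrite /coord3; case: i => -[|[|n]] ni /= x.
- by apply: (continuous_comp (f := fst) (g := fst)); exact: cfst.
- by apply: (continuous_comp (f := fst) (g := snd)); [exact: cfst|exact: csnd].
- exact: csnd.
Qed.

Lemma coord3_shift i j (t : R) x : coord3 i (t *: evec j + x) = t * (j == i)%:R + coord3 i x.
Proof.
case: i => -[|[|[|//]]] ni; case: j => -[|[|[|//]]] nj;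
  by rewrite /coord3 /evec /= /GRing.scale /= -?val_eqE /= ?mulr1 ?mulr0.
Qed.

Lemma is_derive_coord3 i j (f : R -> R) x : smooth1 f ->
  is_derive x (evec j) (f \o coord3 i) ((j == i)%:R * derive1 f (coord3 i x)).
Proof.
move=> sf; case: (eqVneq j i) => [->|ji].
  rewrite mul1r derive1E.
  apply: (@is_derive_transfer _ _ _ f _ _ (coord3 i x) 1); last first.
    by apply: derivableP; exact: smooth1_derivable.
  by move=> t; rewrite /= coord3_shift eqxx mulr1 /GRing.scale /= mulr1.
rewrite mul0r.
apply: (is_derive_transfer (W := R) _ (is_derive_cst (0 : R) (coord3 i x) 1)) => t.
by rewrite /= coord3_shift (negbTE ji) mulr0 add0r !subrr.
Qed.

Lemma smooth_coord3 i (f : R -> R) : smooth1 f -> smooth (f \o coord3 i).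
Proof.
move=> sf.
apply: (@smooth_coind [set g | exists f : R -> R, smooth1 f /\ g = f \o coord3 i]);
  last by exists f.
move=> _ [u [su ->]]; split.
- move=> x; apply: continuous_comp; first exact: continuous_coord3.
  exact: smooth1_continuous.
- by move=> j x; case: (is_derive_coord3 i j x su).
- move=> j; exists (cst ((j == i)%:R) * derive1 u); split.
    exact: (smooth1M (@smooth1_cst R _) (smooth1_derive su)).
  by apply/funext => x; case: (is_derive_coord3 i j x su).
Qed.

(** A rising step at a times a falling step at b, with transition layers of width 1/n turned
    inwards: the support stays in [[a, b]] for every n, and the values tend to 1 on the open
    interval. *)
Definition bump (n : nat) (a b x : R) : R :=
  smooth_step (n%:R * x + - (n%:R * a)) * smooth_step (- n%:R * x + n%:R * b).

Lemma smooth1_bump n a b : smooth1 (bump n a b).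
Proof.
have h (c d : R) := @smooth1_affine R c d _ (@smooth1_step R).
exact: (smooth1M (h _ _) (h _ _)).
Qed.

Lemma bump_ge0 n a b (x : R) : 0 <= bump n a b x.
Proof. by rewrite mulr_ge0 ?smooth_step_ge0. Qed.

Lemma bump_le1 n a b (x : R) : bump n a b x <= 1.
Proof. by rewrite mulr_ile1 ?smooth_step_ge0 ?smooth_step_le1. Qed.

Lemma bump_out n a b (x : R) : ~~ (a < x < b) -> bump n a b x = 0.
Proof.
rewrite negb_and -!leNgt => /orP[xa|bx]; rewrite /bump.
  by rewrite smooth_step_le0 ?mul0r// -mulrBr mulr_ge0_le0// subr_le0.
rewrite [X in _ * X]smooth_step_le0 ?mulr0//.
by rewrite mulNr addrC -mulrBr mulr_ge0_le0// subr_le0.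
Qed.

Lemma bump_in a b (x : R) : a < x < b -> \forall n \near \oo, bump n a b x = 1.
Proof.
move=> /andP[ax xb].
have h (n : nat) (c : R) : 0 < c -> c^-1 <= n%:R -> 1 <= n%:R * c.
  by move=> c0; rewrite -ler_pdivrMr// mul1r.
have large (c : R) : \forall n \near \oo, c <= n%:R by exact: nbhs_infty_ger.
near=> n.
rewrite /bump !smooth_step_ge1 ?mulr1//.
- rewrite mulNr addrC -mulrBr h ?subr_gt0//.
  by near: n; exact: large.
- rewrite -mulrBr h ?subr_gt0//.
  by near: n; exact: large.
Unshelve. all: by end_near. Qed.

Definition obox (a b : space3 R) : set (space3 R) :=
  (`]a.1.1, b.1.1[ `*` `]a.1.2, b.1.2[) `*` `]a.2, b.2[.

Definition cbox (a b : space3 R) : set (space3 R) :=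
  (`[a.1.1, b.1.1] `*` `[a.1.2, b.1.2]) `*` `[a.2, b.2].

Lemma compact_cbox a b : compact (cbox a b).
Proof.
by apply: compact_setX; [apply: compact_setX|]; exact: segment_compact.
Qed.

Lemma obox_cbox a b : obox a b `<=` cbox a b.
Proof.
by move=> [[x y] z] /= [[/=]]; rewrite !in_itv /= => /andP[? ?] /andP[? ?] /andP[? ?];
  split; [split|] => /=; rewrite in_itv /= !ltW.
Qed.

Definition box_bump (n : nat) (a b : space3 R) : space3 R -> R :=
  (bump n a.1.1 b.1.1 \o coord3 (@Ordinal 3 0 isT)) *
  (bump n a.1.2 b.1.2 \o coord3 (@Ordinal 3 1 isT)) *
  (bump n a.2 b.2 \o coord3 (@Ordinal 3 2 isT)).

Lemma box_bumpE n a b x : box_bump n a b x =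
  bump n a.1.1 b.1.1 x.1.1 * bump n a.1.2 b.1.2 x.1.2 * bump n a.2 b.2 x.2.
Proof. by []. Qed.

Lemma smooth_box_bump n a b : smooth (box_bump n a b).
Proof.
have h i (c d : R) := @smooth_coord3 i _ (@smooth1_bump n c d).
exact: (smoothM (smoothM (h _ _ _) (h _ _ _)) (h _ _ _)).
Qed.

Lemma box_bump_norm n a b x : `|box_bump n a b x| <= 1.
Proof.
have h (c d y : R) : `|bump n c d y| <= 1 by rewrite ger0_norm ?bump_ge0 ?bump_le1.
have le1 (p q : R) : `|p| <= 1 -> `|q| <= 1 -> `|p * q| <= 1.
  by move=> p1 q1; rewrite normrM; apply: mulr_ile1.
by rewrite box_bumpE; apply: (le1 _ _ (le1 _ _ (h _ _ _) (h _ _ _))).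
Qed.

Lemma box_bump_out n a b x : ~ obox a b x -> box_bump n a b x = 0.
Proof.
move=> nx; rewrite box_bumpE.
have [x1|] := boolP (a.1.1 < x.1.1 < b.1.1); last by move/bump_out => ->; rewrite !mul0r.
have [x2|] := boolP (a.1.2 < x.1.2 < b.1.2); last by move/bump_out => ->; rewrite mulr0 mul0r.
have [x3|] := boolP (a.2 < x.2 < b.2); last by move/bump_out => ->; rewrite mulr0.
by case: nx; split; [split|]; rewrite /= in_itv.
Qed.

Lemma test_function_box_bump (Omega : set (space3 R)) n a b :
  cbox a b `<=` Omega -> test_function Omega (box_bump n a b).
Proof.
move=> abO; split; first exact: smooth_box_bump.
exists (cbox a b); split => //; first exact: compact_cbox.
by move=> x nx; apply: box_bump_out => /obox_cbox.
Qed.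

Lemma cvg_box_bump a b x : box_bump n a b x @[n --> \oo] --> (\1_(obox a b) x : R).
Proof.
have [xab|nx] := pselect (obox a b x); last first.
  rewrite indicE memNset//.
  by apply: cvg_near_cst; near=> n; rewrite box_bump_out.
rewrite indicE mem_set//; apply: cvg_near_cst.
move: xab => -[[]]; rewrite /= !in_itv /= => x1 x2 x3.
near=> n; rewrite box_bumpE.
rewrite (_ : bump n a.1.1 b.1.1 x.1.1 = 1); last by near: n; exact: bump_in.
rewrite (_ : bump n a.1.2 b.1.2 x.1.2 = 1); last by near: n; exact: bump_in.
rewrite (_ : bump n a.2 b.2 x.2 = 1); last by near: n; exact: bump_in.
by rewrite !mul1r.
Unshelve. all: by end_near. Qed.

Lemma test_functionM (Omega : set (space3 R)) g h :
  test_function Omega g -> smooth h -> test_function Omega (g * h).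
Proof.
move=> [sg [K [cK KO gK]]] sh; split; first exact: smoothM.
by exists K; split => // x nx; rewrite mulrfctE gK// mul0r.
Qed.

Lemma smooth_cst (a : R) : smooth (cst a : space3 R -> R).
Proof. exact: (@smooth_coord3 (@Ordinal 3 0 isT) (cst a) (@smooth1_cst R a)). Qed.

Lemma smoothD g h : smooth g -> smooth h -> smooth (g + h).
Proof.
move=> sg sh; apply: (@smooth_coind
  [set k | exists g h, [/\ smooth g, smooth h & k = g + h]]); last by exists g, h.
move=> _ [u [v [su sv ->]]]; split.
- by move=> x; apply: cvgD; apply: smooth_continuous.
- by move=> i x; apply: derivableD; apply: smooth_derivable.
- move=> i; exists (partial i u), (partial i v); split; [exact: smooth_partial..|].
  by apply/funext => x; rewrite /partial deriveD//; exact: smooth_derivable.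
Qed.

Lemma partial_lin (a : R) g h i x : smooth g -> smooth h ->
  partial i (cst a * g + h) x = a * partial i g x + partial i h x.
Proof.
move=> sg sh; have dg := @smooth_derivable g sg i x; have dh := @smooth_derivable h sh i x.
have dc : derivable (cst a : space3 R -> R) x (evec i) by exact: derivable_cst.
by rewrite /partial (deriveD (derivableM dc dg) dh) (deriveM dc dg) derive_cst scaler0 addr0.
Qed.

Lemma test_function_lin (Omega : set (space3 R)) (a : R) g h :
  test_function Omega g -> test_function Omega h ->
  test_function Omega (cst a * g + h).
Proof.
move=> [sg [K [cK KO g0]]] [sh [K' [cK' KO' h0]]]; split.
  exact: (smoothD (smoothM (@smooth_cst a) sg) sh).
exists (K `|` K'); split; [exact: compactU|by move=> x [/KO|/KO']|].
move=> x /not_orP[nK nK'].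
by rewrite addrfctE mulrfctE g0// h0// mulr0 addr0.
Qed.

End SmoothFields.

(** * The fundamental lemma of the calculus of variations *)

(** A cylinder over a set A of [G1] need not be a rectangle of generators, since [G2] need not
    contain the whole space. It is the countable union of the rectangles with sides A and [F2 n];
    this is the purpose of the exhausting sequences. *)
Lemma prod_measurable_generated d1 d2 (T1 : measurableType d1) (T2 : measurableType d2)
    (G1 : set (set T1)) (G2 : set (set T2)) (F1 : (set T1)^nat) (F2 : (set T2)^nat) :
  d1.-measurable = <<s G1 >> -> d2.-measurable = <<s G2 >> ->
  (forall n, G1 (F1 n)) -> (forall n, G2 (F2 n)) ->
  \bigcup_n F1 n = setT -> \bigcup_n F2 n = setT ->
  (d1, d2).-prod.-measurable = <<s [set A `*` B | A in G1 & B in G2] >>.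
Proof.
move=> E1 E2 G1F G2F F1T F2T; rewrite eqEsubset; split; last first.
  apply: smallest_sub; first exact: sigma_algebra_measurable.
  move=> _ [A GA [B GB <-]]; apply: measurableX.
    by rewrite E1; exact: sub_sigma_algebra.
  by rewrite E2; exact: sub_sigma_algebra.
have SA := @smallest_sigma_algebra _ setT [set A `*` B | A in G1 & B in G2].
apply: smallest_sub => //; rewrite subUset; split.
- rewrite E1 -[X in X `<=` _](g_sigma_preimageE setT); apply: smallest_sub => //.
  move=> _ [A GA <-].
  rewrite (_ : _ `&` _ = \bigcup_n (A `*` F2 n)).
    case: SA => _ _; apply=> n; apply: sub_sigma_algebra.
    by exists A => //; exists (F2 n).
  rewrite setTI; apply/seteqP; split => [[x y]/= Ax|[x y] [n _ []]//].
  have : setT y by []. rewrite -F2T => -[n _ Fy]; by exists n.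
- rewrite E2 -[X in X `<=` _](g_sigma_preimageE setT); apply: smallest_sub => //.
  move=> _ [A GA <-].
  rewrite (_ : _ `&` _ = \bigcup_n (F1 n `*` A)).
    case: SA => _ _; apply=> n; apply: sub_sigma_algebra.
    by exists (F1 n) => //; exists A.
  rewrite setTI; apply/seteqP; split => [[x y]/= Ay|[x y] [n _ []]//].
  have : setT x by []. rewrite -F1T => -[n _ Fx]; by exists n.
Qed.

(** * Boxes, the Borel sigma-algebra of R^3 and the volume *)

Section Boxes.
Context {R : realType}.
Implicit Types (g h : space3 R -> R) (x : space3 R).
Local Notation vol := (@vol R).

Lemma measurable_obox (a b : space3 R) : measurable (obox a b).
Proof. by apply: measurableX => //; exact: measurableX. Qed.

Lemma bigcup_symmetric_itv : \bigcup_n `](- n%:R : R), n%:R[%classic = setT.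
Proof.
apply/seteqP; split => // x _; exists (Num.trunc `|x|).+1 => //=.
by rewrite in_itv /= -ltr_norml truncnS_gt.
Qed.

Lemma space3_measurable_generated :
  @measurable _ (space3 R) = <<s [set B | exists a b, B = obox a b] >>.
Proof.
have E := RGenOpens.measurableE R.
have I n : RGenOpens.G (`](- n%:R : R), n%:R[%classic).
  by eexists; eexists; reflexivity.
pose G2 := [set A `*` B | A in @RGenOpens.G R & B in @RGenOpens.G R].
have E2 := prod_measurable_generated E E I I bigcup_symmetric_itv bigcup_symmetric_itv.
pose F2 n := `](- n%:R : R), n%:R[%classic `*` `](- n%:R : R), n%:R[%classic.
have GF2 n : G2 (F2 n) by exists `](- n%:R : R), n%:R[%classic => //;
  exists `](- n%:R : R), n%:R[%classic.
have F2T : \bigcup_n F2 n = setT.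
  apply/seteqP; split => // -[x y] _; exists (Num.trunc (Num.max `|x| `|y|)).+1 => //=.
  by split => /=; rewrite in_itv /= -ltr_norml;
    apply: le_lt_trans (truncnS_gt _); rewrite le_max lexx ?orbT.
apply: (etrans (prod_measurable_generated E2 E GF2 I F2T bigcup_symmetric_itv)).
congr (<<s _ >>); apply/seteqP; split => [_ [_ [_ [a1 [b1 ->]] [_ [a2 [b2 ->]] <-]] [_ [a3 [b3 ->]] <-]]|_ [a [b ->]]].
  by exists (a1, a2, a3), (b1, b2, b3).
exists (`]a.1.1, b.1.1[%classic `*` `]a.1.2, b.1.2[%classic).
  by exists `]a.1.1, b.1.1[%classic; [eexists; eexists; reflexivity|];
     exists `]a.1.2, b.1.2[%classic => //; eexists; eexists; reflexivity.
by exists `]a.2, b.2[%classic => //; eexists; eexists; reflexivity.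
Qed.

Lemma oboxI (a b c d : space3 R) : obox a b `&` obox c d =
  obox (Num.max a.1.1 c.1.1, Num.max a.1.2 c.1.2, Num.max a.2 c.2)
       (Num.min b.1.1 d.1.1, Num.min b.1.2 d.1.2, Num.min b.2 d.2).
Proof.
apply/seteqP; split => -[[x y] z]; rewrite /obox /= !in_itv /= !gt_max !lt_min.
  by move=> [[[/andP[-> ->] /andP[-> ->]] /andP[-> ->]] [[/andP[-> ->] /andP[-> ->]] /andP[-> ->]]].
by move=> [[/andP[/andP[-> ->] /andP[-> ->]] /andP[/andP[-> ->] /andP[-> ->]]]
  /andP[/andP[-> ->] /andP[-> ->]]].
Qed.

Definition rat_point (q : rat * rat * rat) : space3 R :=
  (ratr q.1.1, ratr q.1.2, ratr q.2).

(** Rational corners make the boxes countable, and the closed box lies in O so that the bumps of the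
    box are test functions on O. *)
Lemma open_rat_box (O : set (space3 R)) x : open O -> O x ->
  exists p q, obox (rat_point p) (rat_point q) x /\
    cbox (rat_point p) (rat_point q) `<=` O.
Proof.
move=> oO Ox; have /nbhs_ballP[e /= e0 eO] := open_nbhs_nbhs (conj oO Ox).
have h (y : R) : exists p q : rat, y - e < ratr p < y /\ y < ratr q < y + e.
  have [p hp] := @rat_in_itvoo R (y - e) y ltac:(lra).
  have [q hq] := @rat_in_itvoo R y (y + e) ltac:(lra).
  by exists p, q; rewrite !in_itv /= in hp hq.
have [p1 [q1 [/andP[a1 b1] /andP[c1 d1]]]] := h x.1.1.
have [p2 [q2 [/andP[a2 b2] /andP[c2 d2]]]] := h x.1.2.
have [p3 [q3 [/andP[a3 b3] /andP[c3 d3]]]] := h x.2.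
exists (p1, p2, p3), (q1, q2, q3); split.
  by split; [split|]; rewrite /= in_itv /= ?b1 ?b2 ?b3.
move=> y [[]]; rewrite /= !in_itv /= => /andP[e1 f1] /andP[e2 f2] /andP[e3 f3].
apply: eO; split; [split|]; rewrite /ball /= ltr_distlC; apply/andP; split; lra.
Qed.

Lemma open_bigcup_boxes (O : set (space3 R)) : open O ->
  O = \bigcup_(r in [set r : (rat * rat * rat) * (rat * rat * rat) |
         cbox (rat_point r.1) (rat_point r.2) `<=` O])
       obox (rat_point r.1) (rat_point r.2).
Proof.
move=> oO; apply/seteqP; split => [x Ox|x [r rO /obox_cbox/rO]//].
by have [p [q [xpq pqO]]] := open_rat_box oO Ox; exists (p, q).
Qed.

Lemma open_measurable_space3 (O : set (space3 R)) : open O -> measurable O.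
Proof.
move=> oO; rewrite (open_bigcup_boxes oO) bigcup_mkcond.
apply: countable_bigcupT_measurable; first exact: countableP.
by move=> r; case: ifP => // _; exact: measurable_obox.
Qed.

Lemma continuous_measurable_space3 (D : set (space3 R)) g : measurable D ->
  continuous g -> measurable_fun D g.
Proof.
move=> mD cg; apply: (measurability _ (RGenOpens.measurableE R)).
move=> _ [_ [a [b ->] <-]]; apply: measurableI => //.
by apply: open_measurable_space3; move/continuousP: cg; apply; exact: interval_open.
Qed.

Lemma vol_obox (a b : space3 R) : (vol (obox a b) < +oo)%E.
Proof.
have E := @product_measure1E _ _ _ _ _ (@lebesgue_measure R) (@lebesgue_measure R)
  `]a.1.1, b.1.1[%classic `]a.1.2, b.1.2[%classic (measurable_itv _) (measurable_itv _).
rewrite /Defs.vol /obox product_measure1E//; last exact: measurableX.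
rewrite [X in (X * _)%E]E.
have fin (c d : R) : @lebesgue_measure R `]c, d[%classic \is a fin_num.
  by rewrite lebesgue_measure_itv/=; case: ifPn; rewrite -?EFinB.
by rewrite ltey_eq; apply/orP; left; do 2 ?[apply: fin_numM]; exact: fin.
Qed.

Lemma bounded_vol_lty (O : set (space3 R)) : measurable O -> bounded_set O ->
  (vol O < +oo)%E.
Proof.
move=> mO [M [Mr HM]].
have {}HM := HM (`|M| + 1) ltac:(by rewrite (le_lt_trans (ler_norm _))// ltrDl).
pose c := `|M| + 2.
apply: le_lt_trans (vol_obox (- c, - c, - c) (c, c, c)).
apply: le_measure; rewrite ?inE//; first exact: measurable_obox.
move=> x /HM /=; rewrite !prod_normE !ge_max => /andP[/andP[h1 h2] h3].
by split; [split|]; rewrite /= in_itv /= -ltr_norml; apply: le_lt_trans; try eassumption; rewrite /c; lra.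
Qed.

End Boxes.

(** The sets on whose trace in Q the integral of f vanishes form a Dynkin system, the integral over
    Q itself being 0. It contains the pi-system G, hence every measurable set. *)
Lemma integral_pi_system_ae0 d (T : measurableType d) (R : realType)
    (mu : {measure set T -> \bar R}) (Q : set T) (f : T -> \bar R) (G : set (set T)) :
  d.-measurable = <<s G >> -> setI_closed G -> measurable Q ->
  mu.-integrable Q f -> (\int[mu]_(x in Q) f x = 0)%E ->
  (forall B, G B -> \int[mu]_(x in Q `&` B) f x = 0)%E ->
  ae_eq mu Q f (cst 0%E).
Proof.
move=> EG GI mQ iQ Q0 GQ.
have mf := measurable_int _ iQ.
have key (S : set T) : measurable S -> (\int[mu]_(x in Q `&` S) f x = 0)%E.
  move=> mS.
  apply: (@dynkin_induction _ _ G (fun S => \int[mu]_(x in Q `&` S) f x = 0)%E EG GI).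
  - by rewrite setIT.
  - exact: GQ.
  - move=> A mA QA.
    have dj : [disjoint Q `&` A & Q `&` ~` A].
      apply/disj_setPS => x [[_ Ax] [_ nAx]]; exact: nAx.
    have U : (Q `&` A) `|` (Q `&` ~` A) = Q by rewrite -setIUr setUv setIT.
    have := @integral_setU _ _ _ mu (Q `&` A) (Q `&` ~` A) f.
    rewrite U Q0 QA add0e => <- //; apply: measurableI => //; exact: measurableC.
  - move=> F mF tF HF; rewrite setI_bigcupr integral_bigcup.
    + by apply: eseries0 => n _ _; exact: HF.
    + exact: trivIset_setIl.
    + by move=> k; exact: measurableI.
    + rewrite -setI_bigcupr; apply: integrableS iQ => //.
      by apply: measurableI => //; exact: bigcupT_measurable.
  - by rewrite -EG.
apply: integral_ae_eq => // E EQ mE.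
by rewrite integral0 -(key _ mE) setIidr.
Qed.

Lemma ae_weaken d (T : measurableType d) (R : realType) (mu : {measure set T -> \bar R})
    (P Q : T -> Prop) :
  (forall x, P x -> Q x) -> {ae mu, forall x, P x} -> {ae mu, forall x, Q x}.
Proof. by move=> PQ; apply: filterS. Qed.

Section FundamentalLemma.
Context {R : realType} (Omega : set (space3 R)).
Hypothesis oO : open Omega.
Local Notation vol := (@vol R).

Lemma obox_setI_closed : setI_closed [set B | exists a b : space3 R, B = obox a b].
Proof. by move=> _ _ [a [b ->]] [c [d ->]]; rewrite oboxI; eexists; eexists. Qed.

(** Dominated convergence: h times the bumps tends to h times the indicator of the open box, and |h|
    dominates. *)
Lemma integral_obox0 (h : space3 R -> R) (a b : space3 R) :
  vol.-integrable Omega (EFin \o h) ->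
  (forall psi, test_function Omega psi -> \int[vol]_(x in Omega) (h x * psi x) = 0) ->
  cbox a b `<=` Omega ->
  (\int[vol]_(x in obox a b) (h x)%:E = 0)%E.
Proof.
move=> ih h0 abO.
have mO := open_measurable_space3 oO.
have mh := measurable_int _ ih.
have abO' : obox a b `<=` Omega by move=> x /obox_cbox /abO.
pose F n := EFin \o (fun x => h x * box_bump n a b x).
have mF n : measurable_fun Omega (F n).
  apply/measurable_EFinP; apply: measurable_funM.
    by apply/measurable_EFinP.
  apply: continuous_measurable_space3 => //; apply: smooth_continuous.
  exact: smooth_box_bump.
have leF n x : (`|F n x| <= `|(h x)%:E|)%E.
  by rewrite lee_fin normrM ler_piMr// box_bump_norm.
have F0 : (fun n => (\int[vol]_(x in Omega) F n x)%E) = cst 0%E.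
  apply/funext => n; have iF : vol.-integrable Omega (F n).
    exact: (@le_integrable _ _ _ vol Omega mO (F n) (EFin \o h) (mF n) (fun x _ => leF n x) ih).
  have := h0 _ (test_function_box_bump n abO).
  by rewrite /Rintegral => /eqP; rewrite fine_eq0 ?integrable_fin_num// => /eqP.
have H : (fun n => (\int[vol]_(x in Omega) F n x)%E) @ \oo -->
    (\int[vol]_(x in Omega) ((EFin \o h) \_ (obox a b)) x)%E.
  have mf : measurable_fun Omega ((EFin \o h) \_ (obox a b)).
    apply: (measurable_restrict (EFin \o h) (measurable_obox a b) mO).1.
    by apply: measurable_funS mh => //; exact: subIsetl.
  have cv : {ae vol, forall x, Omega x -> F n x @[n --> \oo] --> ((EFin \o h) \_ (obox a b)) x}.
    apply: aeW => x Ox; rewrite patchE.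
    have := @cvg_box_bump R a b x; rewrite indicE; case: ifPn => /= xab c.
      apply: cvg_EFin; first by near=> n.
      by have := cvgM (cvg_cst (h x)) c; rewrite mulr1; apply.
    apply: cvg_EFin; first by near=> n.
    by have := cvgM (cvg_cst (h x)) c; rewrite mulr0; apply.
  have bd : {ae vol, forall x n, Omega x -> (`|F n x| <= `|(h x)%:E|)%E}.
    by apply: aeW => x n _; exact: leF.
  by case: (@dominated_convergence _ _ _ vol Omega mO F _ _ mF mf cv (integrable_abse ih) bd).
move: H; rewrite F0 -integral_mkcondr setIidr// => H.
by rewrite -(cvg_lim _ H)// lim_cst.
Unshelve. all: by end_near. Qed.

(* Products of bumps increase to the indicators of open boxes, a pi-system. *)
Lemma test_function_ae0 (h : space3 R -> R) :
  vol.-integrable Omega (EFin \o h) ->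
  (forall psi, test_function Omega psi -> \int[vol]_(x in Omega) (h x * psi x) = 0) ->
  {ae vol, forall x, Omega x -> h x = 0}.
Proof.
move=> ih h0.
have mO := open_measurable_space3 oO.
have box0 (a b : space3 R) : cbox a b `<=` Omega ->
    {ae vol, forall x, obox a b x -> h x = 0}.
  move=> abO.
  have abO' : obox a b `<=` Omega by move=> x /obox_cbox /abO.
  have iab : vol.-integrable (obox a b) (EFin \o h).
    by apply: integrableS ih => //; exact: measurable_obox.
  have : ae_eq vol (obox a b) (EFin \o h) (cst 0%E).
    apply: (@integral_pi_system_ae0 _ _ R vol (obox a b) (EFin \o h) _
      space3_measurable_generated obox_setI_closed (measurable_obox a b) iab).
    - exact: integral_obox0.
    - move=> _ [c [d ->]]; rewrite oboxI; apply: integral_obox0 => // -[[x y] z].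
      rewrite /cbox /= !in_itv /= !ge_max !le_min.
      move=> [[/andP[/andP[e1 _] /andP[f1 _]] /andP[/andP[e2 _] /andP[f2 _]]]
        /andP[/andP[e3 _] /andP[f3 _]]].
      by apply: abO; split; [split|]; rewrite /= in_itv /= ?e1 ?e2 ?e3.
  by apply: filterS => x /[apply] -[].
(* [B] enumerates the rational boxes whose closed version lies in Omega; the other codes give the
   empty set, on which nothing is to be proved. *)
pose B n := if unpickle n is Some r then
  if `[< cbox (rat_point r.1) (rat_point r.2) `<=` Omega >]
  then obox (rat_point r.1) (rat_point r.2) : set (space3 R) else set0 else set0.
have : {ae vol, forall x n, B n x -> h x = 0}.
  apply: ae_foralln => n; rewrite /B; case: (unpickle n) => [r|]; last by apply: aeW.
  case: ifPn => [/asboolP|_]; [exact: box0|by apply: aeW].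
apply: (@ae_weaken _ _ R vol) => x Bx Ox.
have [p [q [xpq pqO]]] := open_rat_box oO Ox.
by apply: (Bx (pickle (p, q))); rewrite /B pickleK; case: asboolP.
Qed.

End FundamentalLemma.

(** * Weakly continuous curves in a Hilbert space *)

Section SquareIntegrable.
Context d (T : measurableType d) (R : realType) (mu : {measure set T -> \bar R}).
Context (O : set T) (mO : measurable O).
Implicit Types g h : T -> R.

Lemma ae_le_integrable g h : measurable_fun O g -> mu.-integrable O (EFin \o h) ->
  {ae mu, forall x, O x -> `|g x| <= `|h x|} -> mu.-integrable O (EFin \o g).
Proof.
move=> mg ih gh; have /integrableP[mh hoo] := ih.
apply/integrableP; split; first exact/measurable_EFinP.
apply: le_lt_trans hoo; apply: ae_ge0_le_integral => //.
- by apply: measurableT_comp => //; exact/measurable_EFinP.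
- exact: measurableT_comp.
Qed.

Definition sqint g := measurable_fun O g /\ mu.-integrable O (fun x => (g x ^+ 2)%:E).

Lemma sqint_integrableM g h : sqint g -> sqint h ->
  mu.-integrable O (EFin \o (fun x => g x * h x)).
Proof.
move=> [mg ig] [mh ih].
apply: (@ae_le_integrable _ (fun x => g x ^+ 2 + h x ^+ 2)).
- exact: measurable_funM.
- exact: (integrableD mO ig ih).
- apply: aeW => x _; rewrite (ger0_norm (addr_ge0 (sqr_ge0 _) (sqr_ge0 _))).
  rewrite ler_norml; have := sqr_ge0 (g x + h x); have := sqr_ge0 (g x - h x).
  have := sqr_ge0 (g x); have := sqr_ge0 (h x); nra.
Qed.

Lemma sqint_sqr g : sqint g -> mu.-integrable O (EFin \o (fun x => g x ^+ 2)).
Proof. by case. Qed.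

Lemma sqint_bounded_mul g (b : T -> R) (C : R) : sqint g -> measurable_fun O b ->
  {ae mu, forall x, O x -> `|b x| <= C} -> sqint (fun x => b x * g x).
Proof.
move=> [mg ig] mb bC; split; first exact: measurable_funM.
apply: (@ae_le_integrable _ (fun x => C ^+ 2 * g x ^+ 2)).
- by apply: measurable_funX; exact: measurable_funM.
- by have := integrableZl mO (C ^+ 2) ig.
- apply: ae_weaken bC => x bC Ox.
  rewrite (ger0_norm (sqr_ge0 _)) (ger0_norm (mulr_ge0 (sqr_ge0 _) (sqr_ge0 _))).
  rewrite exprMn ler_wpM2r ?sqr_ge0// -[b x ^+ 2]real_normK ?num_real//.
  by rewrite lerXn2r ?nnegrE ?bC// (le_trans _ (bC Ox)).
Qed.

Lemma sqintZ (a : R) g : sqint g -> sqint (fun x => a * g x).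
Proof.
move=> sg; apply: (@sqint_bounded_mul g (cst a) `|a|) => //.
by apply: aeW => x _.
Qed.

Lemma sqintD g h : sqint g -> sqint h -> sqint (fun x => g x + h x).
Proof.
move=> sg sh; have [mg ig] := sg; have [mh ih] := sh; split.
  exact: measurable_funD.
have i1 := integrableZl mO 2 (sqint_integrableM sg sh).
have i2 := integrableD mO (integrableD mO ig i1) ih.
apply: (@ae_le_integrable _ (fun x => g x ^+ 2 + 2 * (g x * h x) + h x ^+ 2)).
- by apply: measurable_funX; exact: measurable_funD.
- exact: i2.
- by apply: aeW => x _; rewrite le_eqVlt; apply/orP; left; apply/eqP; congr `|_|; ring.
Qed.

Lemma sqintB g h : sqint g -> sqint h -> sqint (fun x => g x - h x).
Proof.
move=> sg sh; have := sqintD sg (sqintZ (-1) sh).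
by congr sqint; apply/funext => x; rewrite mulN1r.
Qed.

Lemma sqint_bounded (b : T -> R) (C : R) : (mu O < +oo)%E -> measurable_fun O b ->
  {ae mu, forall x, O x -> `|b x| <= C} -> sqint b.
Proof.
move=> Oo mb bC.
have -> : b = fun x => b x * cst 1 x by apply/funext => x; rewrite mulr1.
apply: (@sqint_bounded_mul _ _ C) => //; split=> //.
rewrite /= expr1n; apply/integrableP; split; first exact: measurable_cst.
by rewrite integral_cst//= normr1 mul1e.
Qed.

Lemma sqint_integrable g : (mu O < +oo)%E -> sqint g -> mu.-integrable O (EFin \o g).
Proof.
move=> Oo sg; have s1 : sqint (cst 1).
  by apply: (sqint_bounded (C := 1) Oo) => //; apply: aeW => x _; rewrite normr1.
by have := sqint_integrableM sg s1; congr integrable; apply/funext => x; rewrite /= mulr1.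
Qed.

(** Riesz-Fischer. The rate makes the series of the |g_(n+1) - g_n| integrable, so the sequence
    converges almost everywhere; Fatou's lemma then carries the L2 estimate to the limit. *)
Lemma sqint_limit (g : nat -> T -> R) : (mu O < +oo)%E -> (forall n, sqint (g n)) ->
  (forall n m, (n <= m)%N -> \int[mu]_(x in O) (g m x - g n x) ^+ 2 <= 4^-1 ^+ n) ->
  exists l, sqint l /\ forall n, \int[mu]_(x in O) (g n x - l x) ^+ 2 <= 4^-1 ^+ n.
Proof.
move=> Oo sg Hg.
have sd n m := sqintB (sg m) (sg n).
pose c := fine (mu O).
have cE : mu O = c%:E by rewrite fineK// ge0_fin_numE.
have c0 : 0 <= c by apply: fine_ge0.
(* From |y| <= 2^n y^2 + 2^-n, which on a set of measure c turns the L2 rate 4^-n into the L1 rate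
   (1 + c) 2^-n. *)
have intd n : (\int[mu]_(x in O) `|(g n.+1 x - g n x)%:E| <= ((1 + c) * 2^-1 ^+ n)%:E)%E.
  have i1 := integrableZl mO (2 ^+ n) (sqint_sqr (sd n n.+1)).
  have i2 : mu.-integrable O (cst (2^-1 ^+ n)%:E).
    apply/integrableP; split; first exact: measurable_cst.
    by rewrite integral_cst//= cE -EFinM ltry.
  have i3 := integrableD mO i1 i2.
  have i4 : mu.-integrable O (EFin \o (fun x => g n.+1 x - g n x)).
    exact: (sqint_integrable Oo (sd n n.+1)).
  have E : (\int[mu]_(x in O) (2 ^+ n * (g n.+1 x - g n x) ^+ 2 + 2^-1 ^+ n)%:E <=
      ((1 + c) * 2^-1 ^+ n)%:E)%E.
    have -> : (\int[mu]_(x in O) (2 ^+ n * (g n.+1 x - g n x) ^+ 2 + 2^-1 ^+ n)%:E =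
      (2 ^+ n * (\int[mu]_(x in O) (g n.+1 x - g n x) ^+ 2))%:E + (2^-1 ^+ n * c)%:E)%E.
      have -> := integralD mO i1 i2.
      rewrite integral_cst//= cE -EFinM; congr (_ + _)%E.
      have -> := integralZl mO (sqint_sqr (sd n n.+1)) (2 ^+ n).
      rewrite EFinM; congr (_ * _)%E; rewrite /Rintegral fineK//.
      by apply: integrable_fin_num => //; exact: (sqint_sqr (sd n n.+1)).
    rewrite -EFinD lee_fin mulrDl mul1r [c * _]mulrC lerD2r.
    have h4 : (4^-1 : R) ^+ n = 2^-1 ^+ n * 2^-1 ^+ n.
      by rewrite -exprMn; congr (_ ^+ _); field.
    apply: (@le_trans _ _ (2 ^+ n * 4^-1 ^+ n)); first by rewrite ler_wpM2l ?exprn_ge0// Hg.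
    by rewrite h4 mulrA -exprMn divff// expr1n mul1r.
  apply: le_trans E; apply: ge0_le_integral => //.
  - by apply: measurableT_comp => //; exact: measurable_int i4.
  - exact: measurable_int i3.
  - move=> x Ox; rewrite lee_fin.
    set y := g n.+1 x - g n x; set t := (2 : R) ^+ n.
    have t0 : 0 < t by rewrite exprn_gt0.
    have -> : 2^-1 ^+ n = t^-1 by rewrite exprVn.
    have y2 : y ^+ 2 = `|y| ^+ 2 by rewrite real_normK ?num_real.
    rewrite y2; move: `|y| (normr_ge0 y) => z z0.
    rewrite -(ler_pM2l t0) mulrDr divff ?gt_eqF//.
    have := sqr_ge0 (t * z - 1); have : 0 <= t * z by rewrite mulr_ge0// ltW.
    rewrite -subr_ge0 => h1 h2.
    have -> : t * (t * z ^+ 2) + 1 - t * z = (t * z - 1) ^+ 2 + t * z by ring.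
    exact: addr_ge0.
pose S x : \bar R := (\sum_(0 <= k <oo) `|(g k.+1 x - g k x)%:E|)%E.
have md k : measurable_fun O (fun x => `|(g k.+1 x - g k x)%:E|%E).
  apply: measurableT_comp => //; apply/measurable_EFinP.
  by apply: measurable_funB; case: (sg k); case: (sg k.+1).
have mS : measurable_fun O S by apply: ge0_emeasurable_sum.
have intS : (\int[mu]_(x in O) S x < +oo)%E.
  rewrite integral_nneseries//.
  apply: (@le_lt_trans _ _ (2 * (1 + c))%:E); last exact: ltry.
  apply: lime_le; first by apply: is_cvg_nneseries => n _ _; exact: integral_ge0.
  near=> N.
  apply: (@le_trans _ _ (\sum_(0 <= k < N) ((1 + c) * 2^-1 ^+ k)%:E)%E).
    by apply: lee_sum => k _; exact: intd.
  rewrite sumEFin lee_fin -mulr_sumr mulrC ler_wpM2r ?addr_ge0//.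
  rewrite (_ : \sum_(0 <= k < N) 2^-1 ^+ k = 2 - 2 * 2^-1 ^+ N :> R).
    by rewrite gerBl mulr_ge0 ?exprn_ge0.
  elim: (N) => [|k IH]; first by rewrite big_nil expr0; ring.
  by rewrite big_nat_recr//= IH exprS; field.
have Sfin : {ae mu, forall x, O x -> S x \is a fin_num}.
  apply: integrable_ae => //; apply/integrableP; split => //.
  rewrite (eq_integral S)// => x _; rewrite gee0_abs//.
  by apply: nneseries_ge0.
(* An upper limit is measurable with no convergence assumed; its value on the null set where the
   series diverges does not matter. *)
pose l x := fine (limn_esup (fun n => (g n x)%:E)).
have lim x : S x \is a fin_num -> g n x @[n --> \oo] --> l x.
  move=> Sx.
  have cvs : cvgn (series (telescope (g^~ x))).
    apply: normed_cvg; apply: nondecreasing_is_cvgn.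
      by apply: nondecreasing_series => n _ _; exact: normr_ge0.
    exists (fine (S x)) => _ [n _ <-].
    rewrite -lee_fin fineK// /series /= -sumEFin.
    exact: (@nneseries_lim_ge _ (fun k => `|(g k.+1 x - g k x)%:E|%E) xpredT).
  have cvg1 : cvgn (fun n => g n x).
    have -> : (fun n => g n x) = (fun n => g 0%N x + series (telescope (g^~ x)) n).
      by apply/funext => n; rewrite -eq_sum_telescope.
    by apply: is_cvgD => //; exact: is_cvg_cst.
  have cvg2 : (g n x)%:E @[n --> \oo] --> (limn (fun n => g n x))%:E.
    by apply: cvg_EFin => //; near=> n.
  by rewrite /l (cvg_limn_einf_sup cvg2).
have ml : measurable_fun O l.
  apply: (measurableT_comp (f := fine)); first exact: fine_measurable.
  by apply: measurable_fun_limn_esup => n; apply/measurable_EFinP; case: (sg n).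
have mgl n : measurable_fun O (fun x => (g n x - l x) ^+ 2).
  by apply: measurable_funX; apply: measurable_funB => //; case: (sg n).
have bound n : (\int[mu]_(x in O) ((g n x - l x) ^+ 2)%:E <= (4^-1 ^+ n)%:E)%E.
  pose f m x := ((g (m + n)%N x - g n x) ^+ 2)%:E.
  have mf m : measurable_fun O (f m).
    apply/measurable_EFinP; apply: measurable_funX.
    by case: (sd n (m + n)%N).
  have f0 m x : O x -> (0 <= f m x)%E by move=> _; rewrite lee_fin sqr_ge0.
  apply: (@le_trans _ _ (\int[mu]_(x in O) limn_einf (f^~ x))%E).
    apply: ae_ge0_le_integral => //.
    - by move=> x _; rewrite lee_fin sqr_ge0.
    - exact/measurable_EFinP.
    - move=> x Ox; rewrite limn_einf_lim; apply: lime_ge; first exact: is_cvg_einfs.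
      by near=> m; apply/ereal_infP => _ [k _ <-]; exact: f0.
    - apply: (measurableT_comp (f := oppe)); first exact: oppe_measurable.
      by apply: measurable_fun_limn_esup => m; apply: measurableT_comp => //; exact: oppe_measurable.
    - apply: ae_weaken Sfin => x Sx Ox; have := lim x (Sx Ox) => gl.
      have : f m x @[m --> \oo] --> ((g n x - l x) ^+ 2)%:E.
        apply: cvg_EFin; first by near=> m.
        have -> : (g n x - l x) ^+ 2 = (l x - g n x) ^+ 2 by ring.
        have gl' : g (m + n)%N x @[m --> \oo] --> l x.
          by rewrite (cvg_shiftn n (g^~ x)).
        have h : (fun m => g (m + n)%N x - g n x) @ \oo --> l x - g n x.
          by apply: cvgB => //; exact: cvg_cst.
        have h2 : (fun m => (g (m + n)%N x - g n x) ^+ 2) @ \oo --> (l x - g n x) ^+ 2.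
          exact: (@cvg_comp _ _ _ (fun m => g (m + n)%N x - g n x) (fun y : R => y ^+ 2) _ _ _ h (@exprn_continuous R 2 _)).
        exact: h2.
      by move=> /cvg_limn_einf_sup [-> _].
  apply: le_trans (fatou _ mO mf f0) _.
  rewrite limn_einf_lim; apply: lime_le; first exact: is_cvg_einfs.
  near=> m; apply: (@le_trans _ _ (\int[mu]_(x in O) f m x)%E).
    by apply: ereal_inf_lbound; exists m => //=.
  have if_ : mu.-integrable O (f m) by exact: (sqint_sqr (sd n (m + n)%N)).
  rewrite -(fineK (integrable_fin_num mO if_)) lee_fin.
  exact: (Hg n (m + n)%N (leq_addl _ _)).
have igl n : mu.-integrable O (fun x => ((g n x - l x) ^+ 2)%:E).
  apply/integrableP; split; first exact/measurable_EFinP.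
  under eq_integral do rewrite /= ger0_norm ?sqr_ge0//.
  exact: le_lt_trans (bound n) (ltry _).
exists l; split=> [|n].
  have : sqint (fun x => g 0%N x - (g 0%N x - l x)).
    apply: sqintB; first exact: sg.
    by split; [apply: measurable_funB => //; case: (sg 0%N)|exact: igl].
  by congr sqint; apply/funext => x; rewrite opprB addrC subrK.
by rewrite -lee_fin /Rintegral fineK ?integrable_fin_num.
Unshelve. all: by end_near. Qed.

End SquareIntegrable.

(** * Semi-inner product spaces *)

Section SemiHilbert.
Context {R : realType} {X : lmodType R} (S : set X) (ip : X -> X -> R).

(** Definiteness is not asked, since fields equal almost everywhere are not identified; linearity is
    asked on S only, where the integrals that will define [ip] converge. *)
Record semi_inner : Prop := SemiInner {
  semi_inner_lin : forall a u v, S u -> S v -> S (a *: u + v);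
  semi_innerC : forall u v, ip u v = ip v u;
  semi_inner_linl : forall a u v w, S u -> S v -> S w ->
    ip (a *: u + v) w = a * ip u w + ip v w;
  semi_inner_ge0 : forall u, S u -> 0 <= ip u u }.

(* Only sequences with a geometric rate are considered: every Cauchy sequence
   has such a subsequence. *)
Definition semi_complete : Prop :=
  forall s : nat -> X, (forall n, S (s n)) ->
  (forall n m, (n <= m)%N -> ip (s m - s n) (s m - s n) <= 4^-1 ^+ n) ->
  exists2 l, S l & exists2 C, 0 <= C & forall n, ip (s n - l) (s n - l) <= C * 4^-1 ^+ n.

Hypothesis SI : semi_inner.

Lemma semi_innerZ a u : S u -> S (a *: u).
Proof.
move=> Su; have S0 : S 0.
  by have := semi_inner_lin SI (-1) Su Su; rewrite scaleN1r addNr.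
by have := semi_inner_lin SI a Su S0; rewrite addr0.
Qed.

Lemma semi_innerD u v : S u -> S v -> S (u + v).
Proof. by move=> Su Sv; have := semi_inner_lin SI 1 Su Sv; rewrite scale1r. Qed.

Lemma semi_innerB u v : S u -> S v -> S (u - v).
Proof. by move=> Su Sv; apply: semi_innerD => //; rewrite -scaleN1r; exact: semi_innerZ. Qed.

Lemma ipDl u v w : S u -> S v -> S w -> ip (u + v) w = ip u w + ip v w.
Proof. by move=> Su Sv Sw; have := semi_inner_linl SI 1 Su Sv Sw; rewrite scale1r mul1r. Qed.

Lemma ipZl a u w : S u -> S w -> ip (a *: u) w = a * ip u w.
Proof.
move=> Su Sw; have S0 : S 0 by rewrite -(scale0r u); exact: semi_innerZ.
have ip0 : ip 0 w = 0.
  by have := ipDl S0 S0 Sw; rewrite addr0 => /esym/eqP; rewrite -subr_eq0 addrK => /eqP.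
by have := semi_inner_linl SI a Su S0 Sw; rewrite addr0 ip0 addr0.
Qed.

Lemma ipBl u v w : S u -> S v -> S w -> ip (u - v) w = ip u w - ip v w.
Proof.
move=> Su Sv Sw; have SNv : S (- v) by rewrite -scaleN1r; exact: semi_innerZ.
by rewrite ipDl// -(scaleN1r v) ipZl// mulN1r.
Qed.

Lemma ipDr u v w : S u -> S v -> S w -> ip w (u + v) = ip w u + ip w v.
Proof. by move=> *; rewrite (semi_innerC SI) ipDl// !(semi_innerC SI w). Qed.

Lemma ipZr a u w : S u -> S w -> ip w (a *: u) = a * ip w u.
Proof. by move=> *; rewrite (semi_innerC SI) ipZl// (semi_innerC SI w). Qed.

Lemma ip_sqrD a u v : S u -> S v ->
  ip (u + a *: v) (u + a *: v) = ip u u + 2 * a * ip u v + a ^+ 2 * ip v v.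
Proof.
move=> Su Sv; have Sav := semi_innerZ a Sv; have Suv := semi_innerD Su Sav.
rewrite ipDl// !ipDr// !ipZl// !ipZr// (semi_innerC SI v u); ring.
Qed.

Lemma ip_sqrB u v : S u -> S v ->
  ip (u - v) (u - v) = ip u u - 2 * ip u v + ip v v.
Proof. by move=> Su Sv; rewrite -scaleN1r ip_sqrD//; ring. Qed.

Lemma ip_sqrBC u v : S u -> S v -> ip (u - v) (u - v) = ip (v - u) (v - u).
Proof. by move=> Su Sv; rewrite !ip_sqrB// (semi_innerC SI v u); ring. Qed.

Lemma ip_sqr_triangle u v w : S u -> S v -> S w ->
  ip (u - w) (u - w) <= 2 * ip (u - v) (u - v) + 2 * ip (v - w) (v - w).
Proof.
move=> Su Sv Sw.
have Suv := semi_innerB Su Sv; have Svw := semi_innerB Sv Sw.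
have -> : u - w = (u - v) + 1 *: (v - w) by rewrite scale1r addrA subrK.
rewrite ip_sqrD//.
have := semi_inner_ge0 SI (semi_innerB Suv Svw); rewrite ip_sqrB//; lra.
Qed.

Lemma cauchy_schwarz u v : S u -> S v -> ip u v ^+ 2 <= ip u u * ip v v.
Proof.
move=> Su Sv.
have P a : 0 <= ip u u + 2 * a * ip u v + a ^+ 2 * ip v v.
  rewrite -ip_sqrD//; apply: (semi_inner_ge0 SI).
  by apply: semi_innerD => //; exact: semi_innerZ.
have [v0|v0] := eqVneq (ip v v) 0.
  have [-> //|uv0] := eqVneq (ip u v) 0; first by rewrite v0 mulr0 expr0n.
  (* When [ip v v] is 0 the nonnegative trinomial is affine in a, and this value of a makes it equal
     to -1. *)
  have := P (- (ip u u + 1) / (2 * ip u v)); rewrite v0 mulr0 addr0.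
  rewrite (_ : 2 * _ * _ = - (ip u u + 1)); last by field.
  lra.
have vp : 0 < ip v v by rewrite lt_neqAle eq_sym v0 (semi_inner_ge0 SI).
have := P (- ip u v / ip v v).
rewrite -(pmulr_lge0 _ vp) => h.
rewrite -subr_ge0; apply: le_trans h _; rewrite le_eqVlt; apply/orP; left; apply/eqP.
by field.
Qed.

Lemma parallelogram u v : S u -> S v ->
  ip (u - v) (u - v) = 2 * ip v v + 2 * ip u u -
    4 * ip (2^-1 *: (u + 1 *: v)) (2^-1 *: (u + 1 *: v)).
Proof.
move=> Su Sv; have Suv := semi_innerD Su (semi_innerZ 1 Sv).
by rewrite ipZl ?ipZr ?ip_sqrD ?ip_sqrB//; [field|exact: semi_innerZ].
Qed.

Definition rat_comb (u : R -> X) (l : seq (rat * rat)) : X :=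
  \sum_(p <- l) ratr p.1 *: u (ratr p.2).

Section WeaklyContinuous.
Hypothesis SC : semi_complete.
Context (u : R -> X).
Hypothesis Su : forall t, S (u t).
Hypothesis uc : forall h, S h -> continuous (fun t => ip (u t) h).

Local Notation N v := (ip v v).

Lemma rat_comb_in l : S (rat_comb u l).
Proof.
rewrite /rat_comb; elim: l => [|p l IH]; rewrite ?big_nil ?big_cons.
  by rewrite -(scale0r (u 0)); exact: semi_innerZ.
exact: (semi_inner_lin SI).
Qed.

Lemma rat_combD l1 l2 : rat_comb u l1 + rat_comb u l2 = rat_comb u (l1 ++ l2).
Proof. by rewrite /rat_comb big_cat. Qed.

Lemma rat_combZ (q : rat) l :
  ratr q *: rat_comb u l = rat_comb u [seq (q * p.1, p.2) | p <- l].
Proof.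
rewrite /rat_comb big_map scaler_sumr; apply: eq_bigr => p _ /=.
by rewrite rmorphM /= scalerA.
Qed.

(* Mazur: the orthogonal projection of [u t] on the closed span of the [u q],
   q rational, is [u t] itself, because the remainder is orthogonal to every
   [u q], hence by weak continuity to [u t]. *)
Lemma rat_comb_dense t (e : R) : 0 < e -> exists l, N (u t - rat_comb u l) < e.
Proof.
move=> e0; pose v := u t.
pose D := [set N (v - rat_comb u l) | l in [set: seq (rat * rat)]].
have SB l : S (v - rat_comb u l) by apply: semi_innerB; [exact: Su|exact: rat_comb_in].
have lbD : has_inf D.
  split; first by exists (N (v - rat_comb u [::])), [::].
  by exists 0 => _ [l _ <-]; exact: (semi_inner_ge0 SI).
pose del := inf D.
have del_le l : del <= N (v - rat_comb u l) by apply: ge_inf; [case: lbD|exists l].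
(* The midpoint of two rational combinations is one too, so its squared distance to v is at least
   [del]. With the error 4^-n / 4 the parallelogram law then gives the rate 4^-n required by
   [semi_complete]. *)
have approx (n : nat) : exists l, N (v - rat_comb u l) < del + 4^-1 ^+ n / 4.
  have h4 : 0 < (4^-1 : R) ^+ n / 4 by rewrite divr_gt0// exprn_gt0.
  have [_ [l _ <-] Hl] := inf_adherent h4 lbD.
  by exists l.
have [L HL] := choice approx; pose s n := rat_comb u (L n).
have Ss n : S (s n) by exact: rat_comb_in.
have half : (ratr (2%:R^-1 : rat)%R : R) = 2^-1 by rewrite fmorphV /= ratr_nat.
have cauchy n m : (n <= m)%N -> N (s m - s n) <= 4^-1 ^+ n.
  move=> nm.
  have Em : N (s m - s n) = 2 * N (v - s m) + 2 * N (v - s n) -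
      4 * N (v - 2^-1 *: (s m + s n)).
    have -> : s m - s n = (v - s n) - (v - s m) by rewrite opprB [RHS]addrC addrA subrK.
    have -> : v - 2^-1 *: (s m + s n) = 2^-1 *: ((v - s n) + 1 *: (v - s m)).
      have -> : (v - s n) + 1 *: (v - s m) = 2 *: v - (s m + s n).
        by rewrite scale1r addrACA -opprD [s n + _]addrC scaler_nat mulr2n.
      by rewrite scalerBr scalerA mulVf ?pnatr_eq0// scale1r.
    by rewrite (parallelogram (SB (L n)) (SB (L m))).
  have mid : del <= N (v - 2^-1 *: (s m + s n)).
    by rewrite -half rat_combD rat_combZ; exact: del_le.
  rewrite Em; have h1 := HL m; have h2 := HL n; rewrite -/(s m) -/(s n) in h1 h2.
  have h3 : (4^-1 : R) ^+ m <= 4^-1 ^+ n by apply: ler_wiXn2l => //; lra.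
  by clear -mid h1 h2 h3; lra.
have [p Sp [C C0 Hp]] := SC Ss cauchy.
have Svp : S (v - p) by apply: semi_innerB => //; exact: Su.
have small (a b K : R) : (forall n, a <= b + K * 2^-1 ^+ n) -> a <= b.
  move=> H; rewrite leNgt; apply/negP => ba.
  have : K * 2^-1 ^+ n @[n --> \oo] --> K * 0.
    by apply: cvgMl_tmp; apply: cvg_expr; rewrite ger0_norm//; lra.
  rewrite mulr0 => /cvgrPdist_lt/(_ (a - b)); rewrite subr_gt0 => /(_ ba)[n _ /(_ n (leqnn n))] /=.
  rewrite sub0r normrN => h; have := H n; have := ler_norm (K * 2^-1 ^+ n); lra.
have cross w : S w -> forall n, `|ip (p - s n) w| <= (1 + C * N w) * 2^-1 ^+ n.
  move=> Sw n; have w0 := semi_inner_ge0 SI Sw.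
  have q0 : 0 <= (2^-1 : R) ^+ n by rewrite exprn_ge0.
  have E4 : (4^-1 : R) ^+ n = 2^-1 ^+ n * 2^-1 ^+ n.
    by rewrite -exprMn; congr (_ ^+ _); field.
  rewrite -(@ler_pXn2r _ 2)// ?nnegrE ?mulr_ge0 ?addr_ge0 ?mulr_ge0//.
  rewrite real_normK ?num_real//.
  apply: le_trans (cauchy_schwarz (semi_innerB Sp (Ss n)) Sw) _.
  apply: (@le_trans _ _ (C * 4^-1 ^+ n * N w)).
    by rewrite ler_wpM2r// ip_sqrBC.
  have Cw : 0 <= C * N w by rewrite mulr_ge0.
  rewrite exprMn [(2^-1 ^+ n) ^+ 2]expr2 -E4 mulrAC ler_wpM2r//.
  by move: (C * N w) Cw => y; nra.
have orth l : ip (v - p) (rat_comb u l) = 0.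
  have Sw := rat_comb_in l; set w := rat_comb u l in Sw *.
  have w0 := semi_inner_ge0 SI Sw.
  (* First variation: the competitor [s n + ratr q *: w] is again a rational combination, so its
     squared distance to v is at least [del], and n tends to infinity. Taking q = 2^-k and q = -
     2^-k with k large then forces orthogonality. *)
  have key (q : rat) : 2 * ratr q * ip (v - p) w <= ratr q ^+ 2 * N w.
    set lam : R := ratr q.
    apply: (small _ _ (1 + 2 * `|lam| * (1 + C * N w))) => n.
    have : del <= N (v - s n + (- lam) *: w).
      rewrite -addrA scaleNr -opprD /w /lam rat_combZ rat_combD; exact: del_le.
    rewrite ip_sqrD//; last exact: SB.
    have -> : v - s n = (v - p) + (p - s n) by rewrite addrA subrK.
    have Sps := semi_innerB Sp (Ss n).
    rewrite [ip (_ + _) w]ipDl//.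
    have := HL n; rewrite -/(s n).
    have -> : v - s n = (v - p) + (p - s n) by rewrite addrA subrK.
    have hc := cross _ Sw n.
    have : - (lam * ip (p - s n) w) <= `|lam| * ((1 + C * N w) * 2^-1 ^+ n).
      by apply: le_trans (ler_norm _) _; rewrite normrN normrM ler_wpM2l.
    have : (4^-1 : R) ^+ n / 4 <= 2^-1 ^+ n.
      have : (4^-1 : R) ^+ n <= 2^-1 ^+ n by rewrite lerXn2r ?nnegrE//; lra.
      have : 0 <= (4^-1 : R) ^+ n by rewrite exprn_ge0.
      lra.
    clear; set a := ip (v - p) w; set b := ip (p - s n) w; set g := N w.
    set d := (4^-1) ^+ n; set f := (2^-1) ^+ n; set c := N (_ + _); set h := `|lam|.
    move=> h1 h2 h3 h4.
    have -> : (1 + 2 * h * (1 + C * g)) * f = f + 2 * (h * ((1 + C * g) * f)) by ring.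
    have h6 : (- lam) ^+ 2 = lam ^+ 2 by ring.
    have h7 : 2 * - lam * (a + b) = - 2 * (lam * a) - 2 * (lam * b) by ring.
    rewrite h6 h7 in h4; rewrite -mulrA; clear -h1 h2 h3 h4.
    move: (lam * a) (lam * b) (lam ^+ 2 * g) (h * _) h1 h2 h3 h4 => x1 x2 x3 x4; lra.
  have q2 k : (ratr (2^-1 ^+ k) : R) = 2^-1 ^+ k by rewrite rmorphXn /= half.
  have pos k : 0 < (2^-1 : R) ^+ k by rewrite exprn_gt0.
  have half_le (f x g : R) : 0 < f -> 0 <= g -> 2 * f * x <= f ^+ 2 * g -> x <= 0 + g * f.
    move=> f0 g0; rewrite -subr_ge0.
    have -> : f ^+ 2 * g - 2 * f * x = f * (f * g - 2 * x) by ring.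
    rewrite pmulr_rge0// => h; have : 0 <= f * g by rewrite mulr_ge0// ltW.
    rewrite add0r [g * f]mulrC; move: (f * g) h => y; lra.
  apply/eqP; rewrite eq_le; apply/andP; split.
    by apply: (small _ _ (N w)) => k; apply: half_le => //; have := key (2^-1 ^+ k); rewrite q2.
  rewrite -oppr_le0; apply: (small _ _ (N w)) => k; apply: half_le => //.
  by have := key (- 2^-1 ^+ k); rewrite rmorphN /= q2 sqrrN mulrN mulNr mulrN.
have orthv : ip v (v - p) = 0.
  apply/eqP/negPn/negP => nz.
  have cz := uc Svp.
  have : \forall s \near t, ip (u s) (v - p) != 0.
    by move/cvgr_neq0: (cz t); apply.
  move=> /nbhs_ballP[d /= d0 Hd].
  have [q] := @rat_in_itvoo R t (t + d) ltac:(by rewrite ltrDl).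
  rewrite in_itv /= => /andP[tq qd].
  have : ip (u (ratr q)) (v - p) != 0.
    by apply: Hd; rewrite /ball /= ltr_distlC; apply/andP; split; lra.
  rewrite (semi_innerC SI).
  by have := orth [:: (1, q)]; rewrite /rat_comb big_seq1 /= rmorph1 scale1r => ->; rewrite eqxx.
have Sv : S v by exact: Su.
have orthp : ip p (v - p) = 0.
  have h n : `|ip p (v - p)| <= (1 + C * N (v - p)) * 2^-1 ^+ n.
    have := cross _ Svp n; rewrite ipBl//.
    by rewrite [ip (s n) _](semi_innerC SI) orth subr0.
  apply/eqP; rewrite -normr_le0; apply: (small _ _ (1 + C * N (v - p))) => n.
  by rewrite add0r.
have r0 : N (v - p) = 0 by rewrite ipBl// orthv orthp subr0.
have : exists n, 2 * (C * 4^-1 ^+ n) < e.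
  apply: contrapT => /forallNP H.
  have : e <= 0.
    apply: (small _ _ (2 * C)) => n; rewrite add0r -mulrA.
    apply: (@le_trans _ _ (2 * (C * 4^-1 ^+ n))); first by rewrite leNgt; apply/negP/H.
    by rewrite ler_wpM2l// ler_wpM2l// lerXn2r ?nnegrE//; lra.
  by rewrite leNgt e0.
move=> [n Hn]; exists (L n).
apply: le_lt_trans (ip_sqr_triangle Sv Sp (Ss n)) _.
rewrite r0 mulr0 add0r ip_sqrBC//; apply: le_lt_trans Hn.
by rewrite ler_wpM2l.
Unshelve. all: by end_near. Qed.

(** Weak lower semicontinuity of the norm: N (u s - d) is at least 2 ip (u s - d) (u t - d) - N (u t
    - d), which is continuous in s and an equality at s = t. The sets where the distance exceeds a
    level are therefore open. *)
Lemma measurable_sqr_dist (d : X) : S d -> measurable_fun setT (fun t => N (u t - d)).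
Proof.
move=> Sd; apply: (measurability _ (RGenOInfty.measurableE R)) => //.
move=> _ [_ [a ->] <-]; rewrite setTI; apply: open_measurable.
rewrite openE => t /=; rewrite in_itv /= andbT => at_.
have Sud := semi_innerB (Su t) Sd.
pose g s := 2 * ip (u s) (u t - d) - 2 * ip d (u t - d) - N (u t - d).
have gc : continuous g.
  move=> s; apply: cvgB; last exact: cvg_cst.
  apply: cvgB; last exact: cvg_cst.
  by apply: cvgMl_tmp; exact: uc.
have gt : g t = N (u t - d) by rewrite /g -mulrBr -ipBl//; ring.
have gle s : g s <= N (u s - d).
  have Susd := semi_innerB (Su s) Sd.
  have := semi_inner_ge0 SI (semi_innerB Susd Sud); rewrite ip_sqrB// /g.
  by rewrite [ip (u s - d) (u t - d)]ipBl//; lra.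
have : \forall s \near t, a < g s.
  by apply: (cvgr_gt _ (gc t)); rewrite gt.
apply: filterS => s ags; rewrite /= in_itv /= andbT.
exact: lt_le_trans (gle s).
Qed.

(* A Pettis argument: [Q > a] is a countable union of balls centred at rational
   combinations of the [u q]. *)
Lemma measurable_continuous_comp (Q : X -> R) :
  (forall v, S v -> forall e, 0 < e -> exists2 del, 0 < del &
     forall w, S w -> N (w - v) < del -> `|Q w - Q v| < e) ->
  measurable_fun setT (fun t => Q (u t)).
Proof.
move=> Qc; apply: (measurability _ (RGenOInfty.measurableE R)) => //.
move=> _ [_ [a ->] <-]; rewrite setTI.
pose P (i : seq (rat * rat) * nat) :=
  `[< forall w, S w -> N (w - rat_comb u i.1) < i.2.+1%:R^-1 -> a < Q w >].
pose A i := if P i then [set t | N (u t - rat_comb u i.1) < i.2.+1%:R^-1] else set0.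
have -> : (fun t => Q (u t)) @^-1` `]a, +oo[%classic = \bigcup_i A i.
  apply/seteqP; split => [t|t [i _]]; rewrite /= in_itv /= andbT; last first.
    rewrite /A; case: ifPn => // /asboolP H /= Hi; exact: H.
  move=> at_.
  have [del del0 Hdel] : exists2 del, 0 < del &
      forall w, S w -> N (w - u t) < del -> a < Q w.
    have [del del0 Hdel] := Qc _ (Su t) (Q (u t) - a) ltac:(by rewrite subr_gt0).
    exists del => // w Sw /(Hdel _ Sw); rewrite ltr_distl => /andP[+ _]; lra.
  (* The quarter pays for the two factors 2 of [ip_sqr_triangle], both distances being below the
     radius 1/(n+1). *)
  have [n Hn] : exists n : nat, n.+1%:R^-1 < del / 4.
    exists (Num.trunc ((del / 4)^-1)); rewrite invf_plt ?posrE ?divr_gt0//.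
    exact: truncnS_gt.
  have [l Hl] := rat_comb_dense t (e := n.+1%:R^-1) ltac:(by rewrite invr_gt0).
  exists (l, n) => //; rewrite /A /P; case: asboolP => //= nP; case: nP => w Sw Hw.
  apply: Hdel => //; have Sl := rat_comb_in l.
  apply: le_lt_trans (ip_sqr_triangle Sw Sl (Su t)) _.
  rewrite /= in Hw; rewrite (ip_sqrBC Sl (Su t)).
  by move: (n.+1%:R^-1) (N _) (N _) Hn Hl Hw => x y z; lra.
apply: countable_bigcupT_measurable; first exact: countableP.
move=> i; rewrite /A; case: ifPn => // _.
have Sl := rat_comb_in i.1.
have := measurable_sqr_dist Sl measurableT (@measurable_itv R `]-oo, i.2.+1%:R^-1[).
rewrite setTI; congr measurable; apply/seteqP; split => t /=; by rewrite in_itv.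
Qed.

End WeaklyContinuous.
End SemiHilbert.

(** * Square-integrable vector fields *)

Section SquareIntegrableFields.
Context d (T : measurableType d) (R : realType) (mu : {measure set T -> \bar R}).
Context (O : set T) (mO : measurable O) (n : nat).
Implicit Types (u v w : T -> 'rV[R]_n).

Definition sqint_field : set (T -> 'rV[R]_n) :=
  [set u | forall i, sqint mu O (fun x => u x 0 i)].

Definition field_ip u v : R := \int[mu]_(x in O) \sum_i (u x 0 i * v x 0 i).

Lemma integrable_sumR (I : Type) (s : seq I) (F : I -> T -> R) :
  (forall i, mu.-integrable O (EFin \o F i)) ->
  mu.-integrable O (EFin \o (fun x => \sum_(i <- s) F i x)).
Proof.
move=> iF; rewrite (_ : _ \o _ = fun x => (\sum_(i <- s) (F i x)%:E)%E).
  by apply: integrable_sum => // i _; exact: iF.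
by apply/funext => x; rewrite /= sumEFin.
Qed.

Lemma Rintegral_sumR (I : Type) (s : seq I) (F : I -> T -> R) :
  (forall i, mu.-integrable O (EFin \o F i)) ->
  \int[mu]_(x in O) (\sum_(i <- s) F i x) = \sum_(i <- s) \int[mu]_(x in O) F i x.
Proof.
move=> iF; elim: s => [|i s IH].
  rewrite big_nil (_ : (fun x => _) = cst 0); first by rewrite Rintegral_cst// mul0r.
  by apply/funext => x; rewrite big_nil.
rewrite big_cons -IH -RintegralD//; last exact: integrable_sumR.
by congr Rintegral; apply/funext => x; rewrite big_cons.
Qed.

Lemma field_ip_integrable u v : sqint_field u -> sqint_field v ->
  mu.-integrable O (EFin \o (fun x => \sum_i (u x 0 i * v x 0 i))).
Proof. by move=> su sv; apply: integrable_sumR => i; exact: sqint_integrableM. Qed.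

Lemma field_ipE u v : sqint_field u -> sqint_field v ->
  field_ip u v = \sum_i \int[mu]_(x in O) (u x 0 i * v x 0 i).
Proof.
by move=> su sv; rewrite /field_ip Rintegral_sumR// => i; exact: sqint_integrableM.
Qed.

Lemma sqint_field_lin (a : R) u v : sqint_field u -> sqint_field v ->
  sqint_field (a *: u + v).
Proof.
move=> su sv i; have := sqintD mO (sqintZ mO a (su i)) (sv i).
by congr sqint; apply/funext => x; rewrite !mxE.
Qed.

Lemma semi_inner_field : semi_inner sqint_field field_ip.
Proof.
split.
- exact: sqint_field_lin.
- by move=> u v; congr Rintegral; apply/funext => x; apply: eq_bigr => i _; rewrite mulrC.
- move=> a u v w su sv sw.
  rewrite /field_ip -RintegralZl//; last exact: field_ip_integrable.
  rewrite -RintegralD//; last 2 first.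
  + by apply: (integrableZl mO a (field_ip_integrable su sw)).
  + exact: field_ip_integrable.
  congr Rintegral; apply/funext => x.
  by rewrite mulr_sumr -big_split /=; apply: eq_bigr => i _; rewrite !mxE mulrDl mulrA.
- by move=> u su; apply: Rintegral_ge0 => x _; apply: sumr_ge0 => i _; rewrite -expr2 sqr_ge0.
Qed.

Lemma semi_complete_field : (mu O < +oo)%E -> semi_complete sqint_field field_ip.
Proof.
move=> Oo s Ss Hs.
have dist i k m : (k <= m)%N ->
    \int[mu]_(x in O) (s m x 0 i - s k x 0 i) ^+ 2 <= 4^-1 ^+ k.
  move=> km; apply: le_trans (Hs _ _ km).
  have Sd : sqint_field (s m - s k) by exact: (semi_innerB semi_inner_field).
  rewrite field_ipE// (bigD1 i)//=.
  apply: ler_wpDr.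
    by apply: sumr_ge0 => j _; apply: Rintegral_ge0 => x _; rewrite -expr2 sqr_ge0.
  rewrite le_eqVlt; apply/orP; left; apply/eqP; congr Rintegral.
  by apply/funext => x; rewrite !mxE -expr2.
have [l Hl] := choice (fun i => sqint_limit mO Oo (fun k => Ss k i) (dist i)).
pose L x : 'rV[R]_n := \row_i l i x.
have SL : sqint_field L.
  by move=> i; have [+ _] := Hl i; congr sqint; apply/funext => x; rewrite mxE.
(* Each of the n components converges at the rate 4^-k, whence the constant n. *)
exists L => //; exists n%:R => // k.
have Sd : sqint_field (s k - L) by exact: (semi_innerB semi_inner_field).
rewrite field_ipE//.
apply: (@le_trans _ _ (\sum_(i < n) 4^-1 ^+ k)); last first.
  by rewrite sumr_const card_ord mulr_natl lexx.
apply: ler_sum => i _; have [_ /(_ k)] := Hl i; apply: le_trans.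
rewrite le_eqVlt; apply/orP; left; apply/eqP; congr Rintegral.
by apply/funext => x; rewrite !mxE -expr2.
Qed.

End SquareIntegrableFields.

(** * Subspaces defined by orthogonality *)

Section Submodule.
Context {R : realType} {I : Type} {V : lmodType R} (S : set V) (ip : V -> V -> R).
Hypothesis SI : semi_inner S ip.
Context (phi : I -> V) (Sphi : forall i, S (phi i)).

Definition orthogonal_to : set V := [set u | S u /\ forall i, ip u (phi i) = 0].

Lemma semi_inner_orthogonal : semi_inner orthogonal_to ip.
Proof.
case: (SI) => lin sym linl ge0; split => //.
- move=> a u v [Su u0] [Sv v0]; split; first exact: lin.
  by move=> i; rewrite linl// u0 v0 mulr0 addr0.
- by move=> a u v w [Su _] [Sv _] [Sw _]; exact: linl.
- by move=> u [Su _]; exact: ge0.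
Qed.

(** Cauchy-Schwarz and the geometric rate carry each orthogonality constraint to the limit. *)
Lemma semi_complete_orthogonal : semi_complete S ip -> semi_complete orthogonal_to ip.
Proof.
move=> SC s Ss Hs.
have [l Sl [C C0 Hl]] := SC s (fun n => (Ss n).1) Hs.
exists l; last by exists C.
split=> // i; have Ni := semi_inner_ge0 SI (Sphi i).
have bnd n : ip l (phi i) ^+ 2 <= C * ip (phi i) (phi i) * 4^-1 ^+ n.
  have := cauchy_schwarz SI (semi_innerB SI (Ss n).1 Sl) (Sphi i).
  rewrite (ipBl SI (Ss n).1 Sl)// (Ss n).2 sub0r sqrrN => h; apply: le_trans h _.
  by rewrite mulrAC ler_wpM2r.
apply/eqP; rewrite -sqrf_eq0 eq_le sqr_ge0 andbT leNgt; apply/negP => p0.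
have : (C * ip (phi i) (phi i)) * 4^-1 ^+ n @[n --> \oo] --> (C * ip (phi i) (phi i)) * 0.
  by apply: cvgMl_tmp; apply: cvg_expr; rewrite ger0_norm//; lra.
rewrite mulr0 => /cvgrPdist_lt/(_ _ p0)[n _ /(_ n (leqnn n))] /=.
rewrite sub0r normrN => h; have := bnd n.
have := ler_norm (C * ip (phi i) (phi i) * 4^-1 ^+ n); lra.
Qed.

End Submodule.

(** * The spaces of divergence-free fields *)

Section ScalarFacts.
Context d (T : measurableType d) (R : realType) (mu : {measure set T -> \bar R}).
Context (O : set T) (mO : measurable O).
Implicit Types (f g h : T -> R).

Lemma ae_eq_Rintegral f g : measurable_fun O f -> measurable_fun O g ->
  {ae mu, forall x, O x -> f x = g x} ->
  \int[mu]_(x in O) f x = \int[mu]_(x in O) g x.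
Proof.
move=> mf mg fg; congr fine; apply: ae_eq_integral => //.
- exact/measurable_EFinP.
- exact/measurable_EFinP.
- by apply: ae_weaken fg => x + Ox => ->.
Qed.

Lemma sqint_cauchy_schwarz g h : sqint mu O g -> sqint mu O h ->
  (\int[mu]_(x in O) (g x * h x)) ^+ 2 <=
  (\int[mu]_(x in O) (g x ^+ 2)) * (\int[mu]_(x in O) (h x ^+ 2)).
Proof.
move=> sg sh; pose F (k : T -> R) x : 'rV[R]_1 := const_mx (k x).
have sF k : sqint mu O k -> sqint_field mu O (F k).
  by move=> sk i; move: sk; congr sqint; apply/funext => x; rewrite mxE.
have E a b : field_ip mu O (F a) (F b) = \int[mu]_(x in O) (a x * b x).
  by congr Rintegral; apply/funext => x; rewrite big_ord1 !mxE.
have := cauchy_schwarz (@semi_inner_field _ _ _ mu _ mO 1) (sF _ sg) (sF _ sh).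
by rewrite !E.
Qed.

(** The last step of a density argument: a and b are approximation errors, paired with the fixed
    functions h and k. *)
Lemma sqint_approx_eq0 (h k : T -> R) (c : R) : sqint mu O h -> sqint mu O k ->
  (forall eps, 0 < eps -> exists a b, [/\ sqint mu O a, sqint mu O b,
     \int[mu]_(x in O) (a x ^+ 2) < eps, \int[mu]_(x in O) (b x ^+ 2) < eps &
     c = \int[mu]_(x in O) (a x * h x) + \int[mu]_(x in O) (b x * k x)]) ->
  c = 0.
Proof.
move=> sh sk H; apply/eqP; rewrite -sqrf_eq0 eq_le sqr_ge0 andbT leNgt; apply/negP => c0.
have pos g : 0 <= \int[mu]_(x in O) (g x ^+ 2) by apply: Rintegral_ge0 => x _; exact: sqr_ge0.
have [M M0 [hM kM]] : exists2 M, 0 < M & \int[mu]_(x in O) (h x ^+ 2) <= M /\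
    \int[mu]_(x in O) (k x ^+ 2) <= M.
  exists (\int[mu]_(x in O) (h x ^+ 2) + \int[mu]_(x in O) (k x ^+ 2) + 1).
    by rewrite ltr_wpDl ?addr_ge0.
  by have := pos h; have := pos k; split; lra.
(* With this eps both pairings have square at most c^2 / 8, so c^2 would be at most 2 (c^2 / 8 + c^2
   / 8) = c^2 / 2. *)
have [a [b [sa sb ea eb cE]]] := H (c ^+ 2 / (8 * M)) ltac:(by rewrite divr_gt0// mulr_gt0).
have := sqint_cauchy_schwarz sa sh; have := sqint_cauchy_schwarz sb sk.
have Ha : (\int[mu]_(x in O) (a x ^+ 2)) * (\int[mu]_(x in O) (h x ^+ 2)) <= c ^+ 2 / (8 * M) * M.
  by apply: ler_pM => //; exact: ltW.
have Hb : (\int[mu]_(x in O) (b x ^+ 2)) * (\int[mu]_(x in O) (k x ^+ 2)) <= c ^+ 2 / (8 * M) * M.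
  by apply: ler_pM => //; exact: ltW.
have E : c ^+ 2 / (8 * M) * M = c ^+ 2 / 8 by field; rewrite gt_eqF.
have key (x y : R) : c = x + y -> x ^+ 2 <= c ^+ 2 / 8 -> y ^+ 2 <= c ^+ 2 / 8 -> False.
  by move=> cxy; move: c0; rewrite cxy => *; have := sqr_ge0 (x - y); nra.
rewrite E in Ha Hb => hy hx.
exact: (key _ _ cE (le_trans hx Ha) (le_trans hy Hb)).
Qed.

End ScalarFacts.

Section EssentiallyBounded.
Context d (T : measurableType d) (R : realType) (mu : {measure set T -> \bar R}).
Context (O : set T).
Implicit Types g : T -> R.

Lemma Lnorm_oo_ae g : ('N[mu]_+oo [EFin \o (g \_ O)] < +oo)%E ->
  {ae mu, forall x, O x -> `|g x| <= fine ('N[mu]_+oo [EFin \o (g \_ O)])}.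
Proof.
move=> goo.
have gfin : 'N[mu]_+oo [EFin \o (g \_ O)]%E \is a fin_num.
  by rewrite ge0_fin_numE// Lnorm_ge0.
move: goo gfin; rewrite unlock; case: ifPn => [_|m0] goo gfin.
  have := ess_sup_inf.ess_sup_ge mu (abse \o (EFin \o (g \_ O))).
  apply: ae_weaken => x + Ox.
  rewrite -[X in (_ <= X)%E](fineK gfin) /= lee_fin patchE.
  by case: ifPn => //; rewrite notin_setE.
(* In the remaining case the whole space has measure zero and is itself the exceptional set. *)
exists setT; split => //.
by apply/eqP; rewrite eq_le measure_ge0 andbT leNgt.
Qed.

Lemma ae_Lnorm_oo_lty g (C : R) : {ae mu, forall x, O x -> `|g x| <= C} ->
  ('N[mu]_+oo [EFin \o (g \_ O)] < +oo)%E.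
Proof.
move=> gC; rewrite unlock; case: ifPn => // _.
apply: (@le_lt_trans _ _ (Num.max C 0)%:E); last exact: ltry.
apply/ess_sup_inf.ess_supP; apply: ae_weaken gC => x gC /=.
rewrite lee_fin patchE; case: ifPn => [/set_mem/gC|_]; rewrite le_max ?normr0 ?lexx ?orbT//.
by move=> ->.
Qed.

End EssentiallyBounded.

(** * Linear structure and forms on H, V, D(A) and W *)

Section FieldSpaces.
Context {R : realType} (Omega : set (space3 R)).
Hypotheses (oO : open Omega) (bO : bounded_set Omega).
Local Notation vol := (@vol R).
Implicit Types (g h psi b : space3 R -> R) (i j : 'I_3).

Let mO : measurable Omega := open_measurable_space3 oO.
Let vO : (vol Omega < +oo)%E := bounded_vol_lty mO bO.
Local Notation L2 := (sqint vol Omega).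
Local Notation int1 g := (vol.-integrable Omega (EFin \o g)).

(* [in_L2] elaborates with another display for the same sigma-algebra. *)
Lemma in_L2P g : in_L2 Omega g <-> L2 g.
Proof. by split. Qed.

Let L2B g h (sg : L2 g) (sh : L2 h) := @sqintB _ _ _ vol Omega mO g h sg sh.
Let L2D g h (sg : L2 g) (sh : L2 h) := @sqintD _ _ _ vol Omega mO g h sg sh.
Let L2Z a g (sg : L2 g) := @sqintZ _ _ _ vol Omega mO a g sg.
Let L2int g (sg : L2 g) := @sqint_integrable _ _ _ vol Omega mO g vO sg.
Let L2intM g h (sg : L2 g) (sh : L2 h) := @sqint_integrableM _ _ _ vol Omega mO g h sg sh.
Let intD g h (ig : int1 g) (ih : int1 h) := @RintegralD _ _ _ vol Omega g h mO ig ih.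
Let intB g h (ig : int1 g) (ih : int1 h) := @RintegralB _ _ _ vol Omega g h mO ig ih.
Let intZ a g (ig : int1 g) := @RintegralZl _ _ _ vol Omega g a mO ig.
Let int1Z a g (ig : int1 g) : int1 (fun x => a * g x) := @integrableZl _ _ _ vol Omega mO a _ ig.
Let int1D g h (ig : int1 g) (ih : int1 h) : int1 (fun x => g x + h x) :=
  @integrableD _ _ _ vol Omega mO _ _ ig ih.

Lemma test_function_partial psi i :
  test_function Omega psi -> test_function Omega (partial i psi).
Proof.
move=> [spsi [K [cK KO psi0]]]; split; first exact: smooth_partial.
exists K; split=> // x nKx.
have cl : closed K by apply: compact_closed => //; exact: norm_hausdorff.
rewrite /partial (near_eq_derive (g := cst 0)); first exact: derive_cst.
have : nbhs x (~` K) by apply: open_nbhs_nbhs; split=> //; exact: closed_openC.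
by apply: filterS => y /psi0.
Qed.

Lemma test_function_bounded psi : test_function Omega psi -> exists C, forall x, `|psi x| <= C.
Proof.
move=> [spsi [K [cK KO psi0]]].
have : compact [set psi x | x in K].
  by apply: continuous_compact => //; apply: continuous_subspaceT; exact: smooth_continuous.
move=> /compact_bounded [M [Mr HM]]; exists (`|M| + 1) => x.
have [Kx|nK] := pselect (K x); last by rewrite psi0// normr0 addr_ge0.
by apply: (HM (`|M| + 1)); [rewrite (le_lt_trans (ler_norm _))// ltrDl|exists x].
Qed.

Lemma test_function_measurable psi : test_function Omega psi -> measurable_fun Omega psi.
Proof. by move=> [sp _]; apply: continuous_measurable_space3 => //; exact: smooth_continuous. Qed.

Lemma test_function_L2 psi : test_function Omega psi -> L2 psi.
Proof.
move=> tp; have [C HC] := test_function_bounded tp.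
apply: (@sqint_bounded _ _ _ vol Omega mO psi C vO); first exact: test_function_measurable.
by apply: aeW => x _; exact: HC.
Qed.

Lemma wpartialP i g : in_H1 Omega g -> is_weak_partial Omega i g (wpartial Omega i g).
Proof. by move=> [_ /(_ i)]; exact: xgetPex. Qed.

(** The fundamental lemma applied to the difference. As [wpartial] is a chosen representative, each
    identity for it is obtained by exhibiting a weak derivative and invoking this uniqueness. *)
Lemma weak_partial_unique i g dg dh : is_weak_partial Omega i g dg ->
  is_weak_partial Omega i g dh -> {ae vol, forall x, Omega x -> dg x = dh x}.
Proof.
move=> [/in_L2P sg Hg] [/in_L2P sh Hh].
have sB := L2B sg sh.
have iB := L2int sB.
have := @test_function_ae0 R Omega oO (fun x => dg x - dh x) iB.
have H psi : test_function Omega psi ->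
    \int[vol]_(x in Omega) ((dg x - dh x) * psi x) = 0.
  move=> tp; have sp := test_function_L2 tp.
  have -> : \int[vol]_(x in Omega) ((dg x - dh x) * psi x) =
      \int[vol]_(x in Omega) (dg x * psi x - dh x * psi x).
    by congr Rintegral; apply/funext => x; rewrite mulrBl.
  rewrite (intB (L2intM sg sp) (L2intM sh sp)).
  by apply/eqP; rewrite subr_eq0 -eqr_opp -Hg// -Hh.
move=> /(_ H); apply: ae_weaken => x + Ox => /(_ Ox)/eqP.
by rewrite subr_eq0 => /eqP.
Qed.

Lemma weak_partial_lin i (a : R) g h dg dh : in_L2 Omega g -> in_L2 Omega h ->
  is_weak_partial Omega i g dg -> is_weak_partial Omega i h dh ->
  is_weak_partial Omega i (fun x => a * g x + h x) (fun x => a * dg x + dh x).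
Proof.
move=> /in_L2P sg /in_L2P sh [/in_L2P sdg Hg] [/in_L2P sdh Hh]; split.
  exact: (L2D (L2Z a sdg) sdh).
move=> psi tp; have sp := test_function_L2 tp.
have sdp := test_function_L2 (test_function_partial i tp).
have E u v w : L2 u -> L2 v -> L2 w ->
    \int[vol]_(x in Omega) ((a * u x + v x) * w x) =
    a * (\int[vol]_(x in Omega) (u x * w x)) + \int[vol]_(x in Omega) (v x * w x).
  move=> su sv sw; have iu := L2intM su sw; have iv := L2intM sv sw.
  rewrite -(intZ a iu) -(intD (int1Z a iu) iv).
  by congr Rintegral; apply/funext => x; rewrite mulrDl mulrA.
by rewrite !E// Hg// Hh// mulrN opprD.
Qed.

Lemma in_H1_lin (a : R) g h : in_H1 Omega g -> in_H1 Omega h ->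
  in_H1 Omega (fun x => a * g x + h x).
Proof.
move=> Hg Hh; have [/in_L2P sg _] := Hg; have [/in_L2P sh _] := Hh; split.
  exact: (L2D (L2Z a sg) sh).
move=> i; eexists; exact: (weak_partial_lin a sg sh (wpartialP i Hg) (wpartialP i Hh)).
Qed.

Lemma wpartial_lin i (a : R) g h : in_H1 Omega g -> in_H1 Omega h ->
  {ae vol, forall x, Omega x -> wpartial Omega i (fun x => a * g x + h x) x =
     a * wpartial Omega i g x + wpartial Omega i h x}.
Proof.
move=> Hg Hh; have [/in_L2P sg _] := Hg; have [/in_L2P sh _] := Hh.
exact: (weak_partial_unique (wpartialP i (in_H1_lin a Hg Hh))
  (weak_partial_lin a sg sh (wpartialP i Hg) (wpartialP i Hh))).
Qed.

Lemma wpartial_L2 i g : in_H1 Omega g -> L2 (wpartial Omega i g).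
Proof. by move=> /(wpartialP i)[/in_L2P]. Qed.

Lemma H10_approx g (e : R) : in_H10 Omega g -> 0 < e ->
  exists psi, [/\ test_function Omega psi,
    \int[vol]_(x in Omega) (g x - psi x) ^+ 2 < e &
    forall i, \int[vol]_(x in Omega) (wpartial Omega i g x - partial i psi x) ^+ 2 < e].
Proof.
move=> [Hg Ag] /Ag [psi [tp Hp]]; exists psi.
have [/in_L2P sg _] := Hg; have sp := test_function_L2 tp.
have s0 := L2B sg sp.
have sd i := L2B (wpartial_L2 i Hg) (test_function_L2 (test_function_partial i tp)).
have iS := @integrable_sumR _ _ _ vol Omega mO _ (index_enum 'I_3) _ (fun i => (sd i).2).
have pos f : 0 <= \int[vol]_(x in Omega) (f x ^+ 2).
  by apply: Rintegral_ge0 => x _; exact: sqr_ge0.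
move: Hp; rewrite (@RintegralD _ _ _ vol Omega _ _ mO s0.2 iS).
rewrite (@Rintegral_sumR _ _ _ vol Omega mO _ _ _ (fun i => (sd i).2)) => Hp.
have S0 (P : pred 'I_3) : 0 <= \sum_(i < 3 | P i)
    \int[vol]_(x in Omega) (wpartial Omega i g x - partial i psi x) ^+ 2.
  by apply: sumr_ge0 => i _; exact: pos.
split => // [|i]; first by apply: le_lt_trans Hp; rewrite lerDl.
apply: le_lt_trans Hp; rewrite (bigD1 i)//= addrCA lerDl addr_ge0//.
Qed.

(* Leibniz rule for a factor in [H10], by density of the test functions. *)
Lemma weak_partialM i g b db (C : R) : in_H10 Omega g -> in_L2 Omega b ->
  is_weak_partial Omega i b db ->
  {ae vol, forall x, Omega x -> `|b x| <= C} ->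
  {ae vol, forall x, Omega x -> `|db x| <= C} ->
  is_weak_partial Omega i (fun x => g x * b x)
    (fun x => wpartial Omega i g x * b x + g x * db x).
Proof.
move=> H10g /in_L2P sb [/in_L2P sdb Hb] bC dbC; have [Hg _] := H10g; have [/in_L2P sg _] := Hg.
have sdg := wpartial_L2 i Hg.
have mulC u v : L2 u -> L2 v ->
    {ae vol, forall x, Omega x -> `|v x| <= C} -> L2 (fun x => u x * v x).
  move=> su [mv _] vC; have := @sqint_bounded_mul _ _ _ vol Omega mO u v C su mv vC.
  by congr sqint; apply/funext => x; rewrite mulrC.
split.
  by apply: L2D; exact: mulC.
move=> psi tp; have sp := test_function_L2 tp.
have tdp := test_function_partial i tp; have sdp := test_function_L2 tdp.
apply/eqP; rewrite -subr_eq0 opprK; apply/eqP.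
(* With a test function th in place of g the sum vanishes: test the weak derivative of b with th psi
   ([key] below). What is left pairs the errors g - th and those of the partial derivative with the
   fixed functions of [s1] and [s2]. *)
have s1 : L2 (fun x => partial i psi x * b x + psi x * db x).
  by apply: L2D; exact: mulC.
have s2 : L2 (fun x => psi x * b x) by exact: mulC.
apply: (@sqint_approx_eq0 _ _ _ vol Omega mO _ _ _ s1 s2) => eps eps0.
have [th [tth H1 H2]] := H10_approx H10g eps0.
have sth := test_function_L2 tth.
have sdth := test_function_L2 (test_function_partial i tth).
have sd1 := L2B sg sth; have sd2 := L2B sdg sdth.
exists (fun x => g x - th x), (fun x => wpartial Omega i g x - partial i th x); split => //.
have I u v : L2 u -> L2 v ->
    vol.-integrable Omega (EFin \o (fun x => u x * v x)).
  by move=> su sv; exact: L2intM.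
have ID u v : vol.-integrable Omega (EFin \o u) -> vol.-integrable Omega (EFin \o v) ->
    \int[vol]_(x in Omega) (u x + v x) =
    \int[vol]_(x in Omega) u x + \int[vol]_(x in Omega) v x.
  by move=> iu iv; exact: intD.
have key : \int[vol]_(x in Omega) (th x * (partial i psi x * b x + psi x * db x)) +
    \int[vol]_(x in Omega) (partial i th x * (psi x * b x)) = 0.
  have tpt := test_functionM tth tp.1.
  have := Hb _ tpt; rewrite partialM//; [|exact: tth.1|exact: tp.1].
  move=> /eqP; rewrite -subr_eq0 opprK -ID; last 2 first.
  - apply: (I _ _ sb); have := test_function_L2 (test_function_partial i tpt).
    by rewrite partialM//; [exact: tth.1|exact: tp.1].
  - by apply: (I _ _ sdb); exact: test_function_L2.
  rewrite -ID; [|exact: I|exact: I].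
  move=> /eqP <-; congr Rintegral; apply/funext => x; rewrite !fctE; ring.
rewrite -[RHS]addr0 -key.
have sgb := mulC _ _ sg sb bC.
have sD := L2D (mulC _ _ sdg sb bC) (mulC _ _ sg sdb dbC).
have i1 := I _ _ sgb sdp; have i2 := I _ _ sD sp.
have i3 := I _ _ sd1 s1; have i4 := I _ _ sd2 s2.
have i5 := I _ _ sth s1; have i6 := I _ _ sdth s2.
rewrite -(ID _ _ i1 i2) -(ID _ _ i3 i4) -(ID _ _ i5 i6) -(ID _ _ (int1D i3 i4) (int1D i5 i6)).
by congr Rintegral; apply/funext => x; ring.
Qed.

Implicit Types u v w : vfield R.

Lemma H10_of_approx g : in_H1 Omega g ->
  (forall e, 0 < e -> exists psi, [/\ test_function Omega psi,
    \int[vol]_(x in Omega) (g x - psi x) ^+ 2 < e &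
    forall i, \int[vol]_(x in Omega) (wpartial Omega i g x - partial i psi x) ^+ 2 < e]) ->
  in_H10 Omega g.
Proof.
move=> Hg Ag; split=> // eps eps0.
(* The four errors, for g and its three partial derivatives, add up to at most eps / 2. *)
have [psi [tp H0 Hi]] := Ag (eps / 8) ltac:(by rewrite divr_gt0).
exists psi; split=> //.
have [/in_L2P sg _] := Hg; have sp := test_function_L2 tp.
have s0 := L2B sg sp.
have sd i := L2B (wpartial_L2 i Hg) (test_function_L2 (test_function_partial i tp)).
have iS := @integrable_sumR _ _ _ vol Omega mO _ (index_enum 'I_3) _ (fun i => (sd i).2).
rewrite (@RintegralD _ _ _ vol Omega _ _ mO s0.2 iS).
rewrite (@Rintegral_sumR _ _ _ vol Omega mO _ _ _ (fun i => (sd i).2)).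
apply: le_lt_trans (lerD (ltW H0) (ler_sum _ (fun i _ => ltW (Hi i)))) _.
by rewrite sumr_const card_ord -mulr_natr; lra.
Qed.

Lemma in_H10_lin (a : R) g h : in_H10 Omega g -> in_H10 Omega h ->
  in_H10 Omega (fun x => a * g x + h x).
Proof.
move=> H10g H10h; have [Hg _] := H10g; have [Hh _] := H10h.
have HH := in_H1_lin a Hg Hh.
have [/in_L2P sg _] := Hg; have [/in_L2P sh _] := Hh.
apply: H10_of_approx => // e e0.
(* From (a x + y)^2 <= 2 a^2 x^2 + 2 y^2, the resulting error is below 2 (a^2 + 1) e' = e / 2. *)
pose e' := e / (4 * (a ^+ 2 + 1)).
have a0 := sqr_ge0 a.
have e'0 : 0 < e' by rewrite divr_gt0// mulr_gt0// ltr_wpDl.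
have [p [tp p0 p1]] := H10_approx H10g e'0.
have [q [tq q0 q1]] := H10_approx H10h e'0.
have tpq := test_function_lin a tp tq.
have bound (u v : space3 R -> R) : L2 u -> L2 v -> \int[vol]_(x in Omega) (u x ^+ 2) < e' ->
    \int[vol]_(x in Omega) (v x ^+ 2) < e' ->
    \int[vol]_(x in Omega) ((a * u x + v x) ^+ 2) < e.
  move=> su sv hu hv.
  have iu : int1 (fun x => u x ^+ 2) := su.2; have iv : int1 (fun x => v x ^+ 2) := sv.2.
  have iuv : int1 (fun x => (a * u x + v x) ^+ 2) := (L2D (L2Z a su) sv).2.
  have i1 := int1Z (2 * a ^+ 2) iu; have i2 := int1Z 2 iv.
  apply: (@le_lt_trans _ _ (\int[vol]_(x in Omega) (2 * a ^+ 2 * u x ^+ 2 + 2 * v x ^+ 2))).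
    apply: (@le_Rintegral _ _ _ vol Omega _ _ mO iuv (int1D i1 i2)) => x _.
    by rewrite -subr_ge0 (_ : _ - _ = (a * u x - v x) ^+ 2) ?sqr_ge0//; ring.
  rewrite (intD i1 i2) (intZ _ iu) (intZ _ iv).
  have -> : e = 2 * (a ^+ 2 * e' + e') + 2 * (a ^+ 2 * e' + e').
    by rewrite /e'; field; rewrite gt_eqF// ltr_wpDl.
  have h1 : a ^+ 2 * (\int[vol]_(x in Omega) u x ^+ 2) <= a ^+ 2 * e' by rewrite ler_wpM2l// ltW.
  have h2 : 0 <= a ^+ 2 * e' by rewrite mulr_ge0// ltW.
  have fin (x y z t r : R) : x <= z -> 0 <= z -> y < t -> 0 < t -> r = 2 * x + 2 * y ->
      r < 2 * (z + t) + 2 * (z + t) by move=> *; lra.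
  by apply: (fin _ _ _ _ _ h1 h2 hv e'0); rewrite mulrA.
have sp := test_function_L2 tp; have sq := test_function_L2 tq.
exists (cst a * p + q); split => //.
  rewrite (_ : Rintegral _ _ _ = \int[vol]_(x in Omega)
      ((a * (g x - p x) + (h x - q x)) ^+ 2)).
    by apply: bound => //; exact: L2B.
  by congr Rintegral; apply/funext => x; rewrite !fctE; ring.
move=> i.
have dp := test_function_L2 (test_function_partial i tp).
have dq := test_function_L2 (test_function_partial i tq).
have dpq := test_function_L2 (test_function_partial i tpq).
have wg := wpartial_L2 i Hg; have wh := wpartial_L2 i Hh; have wgh := wpartial_L2 i HH.
have B1 := L2B wg dp; have B2 := L2B wh dq.
rewrite (@ae_eq_Rintegral _ _ _ vol Omega mO _
  (fun x => (a * (wpartial Omega i g x - partial i p x) + (wpartial Omega i h x - partial i q x)) ^+ 2)).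
- exact: bound.
- by apply: measurable_funX; exact: (L2B wgh dpq).1.
- by apply: measurable_funX; exact: (L2D (L2Z a B1) B2).1.
- have := wpartial_lin i a Hg Hh.
  apply: (@ae_weaken _ _ R vol) => x + Ox => /(_ Ox) ->.
  by rewrite partial_lin; [ring|exact: tp.1|exact: tq.1].
Qed.

Definition fieldL2 : set (vfield R) := @sqint_field _ _ _ vol Omega 3.

Lemma fieldL2P u : (forall i, in_L2 Omega (component i u)) <-> fieldL2 u.
Proof. by split. Qed.

Lemma semi_inner_fieldL2 : semi_inner fieldL2 (ip Omega).
Proof. exact: (@semi_inner_field _ _ _ vol Omega mO 3). Qed.

Lemma semi_complete_fieldL2 : semi_complete fieldL2 (ip Omega).
Proof. exact: (@semi_complete_field _ _ _ vol Omega mO 3 vO). Qed.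

(** Both conditions defining H are orthogonality to gradients: classical gradients of test functions
    for the divergence, weak gradients of H1 functions for the normal trace. Indexing the two
    families together presents H as one orthogonal complement, which is complete. *)
Definition H_test (t : {psi | test_function Omega psi} + {g | in_H1 Omega g}) : vfield R :=
  match t with
  | inl psi => fun x => \row_i partial i (sval psi) x
  | inr g => fun x => \row_i wpartial Omega i (sval g) x
  end.

Lemma H_test_L2 t : fieldL2 (H_test t).
Proof.
move=> i; case: t => -[g Hg] /=.
  have := test_function_L2 (test_function_partial i Hg).
  by congr sqint; apply/funext => x; rewrite mxE.
by have := wpartial_L2 i Hg; congr sqint; apply/funext => x; rewrite mxE.
Qed.

Lemma HspaceE : Hspace Omega = orthogonal_to fieldL2 (ip Omega) H_test.
Proof.
apply/seteqP; split => [u [/fieldL2P su du zu]|u [su u0]]; split => //.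
- case=> -[g Hg].
    rewrite -[RHS](du g Hg); congr Rintegral; apply/funext => x.
    by apply: eq_bigr => i _; rewrite mxE.
  rewrite -[RHS](zu g Hg); congr Rintegral; apply/funext => x.
  by apply: eq_bigr => i _; rewrite mxE.
- move=> g Hg; rewrite -[RHS](u0 (inl (exist _ g Hg))); congr Rintegral; apply/funext => x.
  by apply: eq_bigr => i _; rewrite mxE.
- move=> g Hg; rewrite -[RHS](u0 (inr (exist _ g Hg))); congr Rintegral; apply/funext => x.
  by apply: eq_bigr => i _; rewrite mxE.
Qed.

Lemma semi_inner_Hspace : semi_inner (Hspace Omega) (ip Omega).
Proof. by rewrite HspaceE; exact: (semi_inner_orthogonal semi_inner_fieldL2 H_test_L2). Qed.

Lemma semi_complete_Hspace : semi_complete (Hspace Omega) (ip Omega).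
Proof.
rewrite HspaceE.
exact: (semi_complete_orthogonal semi_inner_fieldL2 H_test_L2 semi_complete_fieldL2).
Qed.

Lemma Hspace_L2 u : Hspace Omega u -> fieldL2 u.
Proof. by case=> /fieldL2P. Qed.

Lemma component_lin (a : R) u v i :
  component i (a *: u + v) = fun x => a * component i u x + component i v x.
Proof. by apply/funext => x; rewrite /component !mxE. Qed.

Lemma Vspace_H1 u i : Vspace Omega u -> in_H1 Omega (component i u).
Proof. by move=> [_ /(_ i)[]]. Qed.

Lemma Vspace_lin (a : R) u v : Vspace Omega u -> Vspace Omega v -> Vspace Omega (a *: u + v).
Proof.
move=> [Hu Lu] [Hv Lv]; split; first exact: (semi_inner_lin semi_inner_Hspace).
by move=> i; rewrite component_lin; exact: in_H10_lin.
Qed.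

Lemma gradipE u v : Vspace Omega u -> Vspace Omega v ->
  gradip Omega u v = \sum_i \sum_j \int[vol]_(x in Omega)
    (wpartial Omega j (component i u) x * wpartial Omega j (component i v) x).
Proof.
move=> Vu Vv.
have I i j : int1 (fun x => wpartial Omega j (component i u) x * wpartial Omega j (component i v) x).
  by apply: L2intM; apply: wpartial_L2; exact: Vspace_H1.
rewrite /gradip (@Rintegral_sumR _ _ _ vol Omega mO); last first.
  by move=> i; exact: (@integrable_sumR _ _ _ vol Omega mO).
by apply: eq_bigr => i _; rewrite (@Rintegral_sumR _ _ _ vol Omega mO).
Qed.

Lemma gradipC u v : gradip Omega u v = gradip Omega v u.
Proof.
congr Rintegral; apply/funext => x.
by apply: eq_bigr => i _; apply: eq_bigr => j _; rewrite mulrC.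
Qed.

Lemma gradip_linl (a : R) u v w : Vspace Omega u -> Vspace Omega v -> Vspace Omega w ->
  gradip Omega (a *: u + v) w = a * gradip Omega u w + gradip Omega v w.
Proof.
move=> Vu Vv Vw; have Vuv := Vspace_lin a Vu Vv.
rewrite !gradipE// mulr_sumr -big_split /=; apply: eq_bigr => i _.
rewrite mulr_sumr -big_split /=; apply: eq_bigr => j _.
have su := wpartial_L2 j (Vspace_H1 i Vu); have sv := wpartial_L2 j (Vspace_H1 i Vv).
have sw := wpartial_L2 j (Vspace_H1 i Vw); have suv := wpartial_L2 j (Vspace_H1 i Vuv).
have iu := L2intM su sw; have iv := L2intM sv sw.
rewrite -(intZ a iu) -(intD (int1Z a iu) iv).
apply: (@ae_eq_Rintegral _ _ _ vol Omega mO).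
- by have /measurable_EFinP := measurable_int _ (L2intM suv sw).
- by have /measurable_EFinP := measurable_int _ (int1D (int1Z a iu) iv).
have := wpartial_lin j a (Vspace_H1 i Vu) (Vspace_H1 i Vv).
rewrite component_lin; apply: (@ae_weaken _ _ R vol) => x + Ox => /(_ Ox) ->.
by rewrite mulrDl mulrA.
Qed.

Lemma domA_lin (a : R) u v : domA Omega u -> domA Omega v -> domA Omega (a *: u + v).
Proof.
move=> [Vu [h [Hh Ah]]] [Vv [k [Hk Ak]]]; split; first exact: Vspace_lin.
exists (a *: h + k); split; first exact: (semi_inner_lin semi_inner_Hspace).
move=> w Vw; rewrite /stokes gradip_linl//.
rewrite -/(stokes _ _ _) Ah// -/(stokes _ _ _) Ak//.
by rewrite (semi_inner_linl semi_inner_fieldL2)//; apply: Hspace_L2 => //; case: Vw.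
Qed.

Lemma in_Linf_ae g : in_Linf Omega g ->
  {ae vol, forall x, Omega x -> `|g x| <= fine (Linfnorm Omega g)}.
Proof. by case=> mg goo; exact: (@Lnorm_oo_ae _ _ _ vol Omega). Qed.

Lemma in_Linf_of_ae g (C : R) : measurable_fun Omega g ->
  {ae vol, forall x, Omega x -> `|g x| <= C} -> in_Linf Omega g.
Proof. by move=> mg gC; split => //; exact: (@ae_Lnorm_oo_lty _ _ _ vol Omega _ C). Qed.

Lemma Linfnorm_ge0 g : 0 <= fine (Linfnorm Omega g).
Proof. by apply: fine_ge0; exact: Lnorm_ge0. Qed.

Lemma ae_bound_lin (a : R) g h k :
  {ae vol, forall x, Omega x -> k x = a * g x + h x} ->
  in_Linf Omega g -> in_Linf Omega h -> measurable_fun Omega k -> in_Linf Omega k.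
Proof.
move=> kE Lg Lh mk.
apply: (@in_Linf_of_ae _ (`|a| * fine (Linfnorm Omega g) + fine (Linfnorm Omega h))) => //.
have := @filterI _ _ (ae_filter_ringOfSetsType vol) _ _ (in_Linf_ae Lg) (in_Linf_ae Lh).
move=> /(@filterI _ _ (ae_filter_ringOfSetsType vol) _ _ kE).
apply: (@ae_weaken _ _ R vol) => x [kx [gx hx]] Ox.
rewrite kx//; apply: le_trans (ler_normD _ _) _; rewrite normrM lerD ?ler_wpM2l//.
  exact: gx.
exact: hx.
Qed.

Lemma Wspace_lin (a : R) u v : Wspace Omega u -> Wspace Omega v -> Wspace Omega (a *: u + v).
Proof.
move=> [du Lu] [dv Lv]; have [Vu _] := du; have [Vv _] := dv; split; first exact: domA_lin.
have Vuv := Vspace_lin a Vu Vv.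
move=> i; split.
  apply: (@ae_bound_lin a (component i u) (component i v)).
  - by apply: aeW => x _; rewrite component_lin.
  - by case: (Lu i).
  - by case: (Lv i).
  - by case: (Vspace_H1 i Vuv) => -[].
move=> j; apply: (@ae_bound_lin a (wpartial Omega j (component i u)) (wpartial Omega j (component i v))).
- have := wpartial_lin j a (Vspace_H1 i Vu) (Vspace_H1 i Vv).
  by rewrite component_lin.
- by case: (Lu i) => _; exact.
- by case: (Lv i) => _; exact.
- by case: (wpartial_L2 j (Vspace_H1 i Vuv)).
Qed.

Lemma Wspace_V w : Wspace Omega w -> Vspace Omega w.
Proof. by case=> -[]. Qed.

Lemma Wspace_bound w : Wspace Omega w -> exists C : R, 0 <= C /\ forall i,
  {ae vol, forall x, Omega x -> `|w x 0 i| <= C} /\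
  forall j, {ae vol, forall x, Omega x -> `|wpartial Omega j (component i w) x| <= C}.
Proof.
move=> [_ Lw].
pose n i := fine (Linfnorm Omega (component i w)).
pose m i j := fine (Linfnorm Omega (wpartial Omega j (component i w))).
have n0 i : 0 <= n i by exact: Linfnorm_ge0.
have m0 i j : 0 <= m i j by exact: Linfnorm_ge0.
have M0 i : 0 <= \sum_j m i j by apply: sumr_ge0.
exists (\sum_i (n i + \sum_j m i j)); split.
  by apply: sumr_ge0 => i _; rewrite addr_ge0.
move=> i; have le_i : n i + \sum_j m i j <= \sum_i (n i + \sum_j m i j).
  by rewrite [leRHS](bigD1 i)//= lerDl; apply: sumr_ge0 => k _; rewrite addr_ge0.
split.
  have := in_Linf_ae (Lw i).1; apply: (@ae_weaken _ _ R vol) => x + Ox => /(_ Ox) h.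
  by apply: le_trans h _; apply: le_trans le_i; rewrite lerDl.
move=> j; have := in_Linf_ae ((Lw i).2 j).
apply: (@ae_weaken _ _ R vol) => x + Ox => /(_ Ox) h.
apply: le_trans h _; apply: le_trans le_i; apply: ler_wpDl => //.
by rewrite (bigD1 j)//= lerDl; apply: sumr_ge0.
Qed.

Lemma trilinE u v w :
  (forall i j, int1 (fun x => u x 0 j * wpartial Omega j (component i v) x * w x 0 i)) ->
  trilin Omega u v w = \sum_i \sum_j \int[vol]_(x in Omega)
    (u x 0 j * wpartial Omega j (component i v) x * w x 0 i).
Proof.
move=> I; rewrite /trilin (@Rintegral_sumR _ _ _ vol Omega mO); last first.
  by move=> i; exact: (@integrable_sumR _ _ _ vol Omega mO).
by apply: eq_bigr => i _; rewrite (@Rintegral_sumR _ _ _ vol Omega mO).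
Qed.

Lemma L2_boundedM g b (C : R) : L2 g -> measurable_fun Omega b ->
  {ae vol, forall x, Omega x -> `|b x| <= C} -> L2 (fun x => g x * b x).
Proof.
move=> sg mb bC; have := @sqint_bounded_mul _ _ _ vol Omega mO g b C sg mb bC.
by congr sqint; apply/funext => x; rewrite mulrC.
Qed.

Lemma Wspace_wpartial_L2 w i j : Wspace Omega w -> L2 (wpartial Omega j (component i w)).
Proof. by move=> Ww; apply: wpartial_L2; apply: Vspace_H1; exact: Wspace_V. Qed.

Lemma Wspace_L2 w : Wspace Omega w -> fieldL2 w.
Proof. by move=> Ww; apply: Hspace_L2; case: (Wspace_V Ww). Qed.

(** The gradient of w is the bounded factor, which leaves a product of two L2 functions; in
    [trilin_int_V] the bounded factor is w itself. *)
Lemma trilin_int_W u v w i j : Wspace Omega w -> fieldL2 u -> fieldL2 v ->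
  int1 (fun x => u x 0 j * wpartial Omega j (component i w) x * v x 0 i).
Proof.
move=> Ww su sv; have [C [C0 /(_ i)[_ /(_ j) HC]]] := Wspace_bound Ww.
exact: (L2intM (L2_boundedM (su j) (Wspace_wpartial_L2 i j Ww).1 HC) (sv i)).
Qed.

Lemma trilin_int_V u v w i j : Wspace Omega w -> fieldL2 u -> Vspace Omega v ->
  int1 (fun x => u x 0 j * wpartial Omega j (component i v) x * w x 0 i).
Proof.
move=> Ww su Vv; have [C [C0 /(_ i)[HC _]]] := Wspace_bound Ww.
have sw := Wspace_L2 Ww.
have := L2intM (su j) (L2_boundedM (wpartial_L2 j (Vspace_H1 i Vv)) (sw i).1 HC).
by congr integrable; apply/funext => x /=; rewrite mulrA.
Qed.

(* [u] is orthogonal to the gradients of the H1 functions [u_i w_i]. *)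
Lemma trilin_skew u w : Vspace Omega u -> Wspace Omega w ->
  trilin Omega u w u = - trilin Omega u u w.
Proof.
move=> Vu Ww; have su := Hspace_L2 Vu.1; have sw := Wspace_L2 Ww.
have Vw := Wspace_V Ww.
have [C [C0 HC]] := Wspace_bound Ww.
apply/eqP; rewrite -subr_eq0 opprK; apply/eqP.
rewrite trilinE; last by move=> i j; exact: trilin_int_W.
rewrite trilinE; last by move=> i j; exact: trilin_int_V.
rewrite -big_split /=; apply: big1 => i _.
pose g x := component i u x * component i w x.
have [wC GC] := HC i.
have sg : L2 g by exact: (L2_boundedM (su i) (sw i).1 wC).
pose dg j x := wpartial Omega j (component i u) x * component i w x +
  component i u x * wpartial Omega j (component i w) x.
have Wg j : is_weak_partial Omega j g (dg j).
  by apply: (weak_partialM (Vu.2 i) _ (wpartialP j (Vspace_H1 i Vw)) wC (GC j)); exact/in_L2P/sw.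
have Hg : in_H1 Omega g by split=> [|j]; [exact/in_L2P|exists (dg j)].
have [_ _ /(_ _ Hg)] := Vu.1.
rewrite (@Rintegral_sumR _ _ _ vol Omega mO); last first.
  by move=> j; apply: L2intM; [exact: su|exact: wpartial_L2].
move=> zu.
have E j : \int[vol]_(x in Omega) (u x 0 j * wpartial Omega j g x) =
    \int[vol]_(x in Omega) (u x 0 j * wpartial Omega j (component i w) x * u x 0 i) +
    \int[vol]_(x in Omega) (u x 0 j * wpartial Omega j (component i u) x * w x 0 i).
  have i1 := trilin_int_W i j Ww su su; have i2 := trilin_int_V i j Ww su Vu.
  rewrite -(intD i1 i2).
  apply: (@ae_eq_Rintegral _ _ _ vol Omega mO).
  - by have /measurable_EFinP := measurable_int _ (L2intM (su j) (wpartial_L2 j Hg)).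
  - by have /measurable_EFinP := measurable_int _ (int1D i1 i2).
  have := weak_partial_unique (wpartialP j Hg) (Wg j).
  apply: (@ae_weaken _ _ R vol) => x + Ox => /(_ Ox) ->.
  by rewrite /dg /component; ring.
rewrite -[RHS]zu (eq_bigr _ (fun j _ => E j)) big_split.
by [].
Qed.

Lemma stokesHP w : domA Omega w -> is_stokesH Omega w (stokesH Omega w).
Proof. by move=> [_]; exact: xgetPex. Qed.

Lemma stokesH_H w : Wspace Omega w -> Hspace Omega (stokesH Omega w).
Proof. by move=> [/stokesHP[]]. Qed.

(** The bridge from the weak equation to the functional of the theorem: the viscous terms agree by
    the definition of A w in H, the nonlinear ones by skew-symmetry. *)
Lemma FV_FW (nu : R) f u w : Vspace Omega u -> Wspace Omega w ->
  FV Omega nu f u w = FW Omega nu f u w.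
Proof.
move=> Vu Ww; rewrite /FV /FW trilin_skew//; congr (_ - nu * _ + _).
rewrite /stokes gradipC; have [_ /(_ _ Vu)] := stokesHP Ww.1.
by rewrite /stokes => ->; rewrite (semi_innerC (semi_inner_fieldL2)).
Qed.

(** For u in V one may pass to [FV], where w enters through f, [gradip] and [trilin] and not through
    the chosen representative [stokesH]. *)
Lemma FW_lin (nu : R) f u (a : R) v w : Vdual Omega f -> Vspace Omega u ->
  Wspace Omega v -> Wspace Omega w ->
  FW Omega nu f u (a *: v + w) = a * FW Omega nu f u v + FW Omega nu f u w.
Proof.
move=> [fl _] Vu Wv Ww; have Wvw := Wspace_lin a Wv Ww.
rewrite -!FV_FW// /FV.
have su := Hspace_L2 Vu.1.
rewrite fl; [|exact: Wspace_V|exact: Wspace_V].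
rewrite /stokes !(gradipC u) (gradip_linl); [|exact: Wspace_V|exact: Wspace_V|by []].
have -> : trilin Omega u u (a *: v + w) = a * trilin Omega u u v + trilin Omega u u w.
  rewrite !trilinE; try by move=> i j; exact: trilin_int_V.
  rewrite mulr_sumr -big_split /=; apply: eq_bigr => i _.
  rewrite mulr_sumr -big_split /=; apply: eq_bigr => j _.
  have i1 := trilin_int_V i j Wv su Vu; have i2 := trilin_int_V i j Ww su Vu.
  rewrite -(intZ a i1) -(intD (int1Z a i1) i2); congr Rintegral; apply/funext => x.
  by rewrite !mxE; ring.
move: (f v) (f w) (gradip _ v u) (gradip _ w u) (trilin _ u u v) (trilin _ u u w).
by move=> x1 x2 x3 x4 x5 x6; ring.
Qed.

(** Writing 0 as -u + u derives everything from stability under linear combinations. It serves for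
    the empty sum in [FW_sum]. *)
Lemma Wspace0 u : Vspace Omega u -> Wspace Omega 0.
Proof.
move=> Vu.
have E0 : 0 = (-1) *: u + u by rewrite scaleN1r addNr.
have V0 : Vspace Omega 0 by rewrite E0; exact: Vspace_lin.
have H0 := V0.1.
split.
  split=> //; exists 0; split => // v Vv.
  rewrite /stokes {1}E0 (gradip_linl)// mulN1r addNr.
  have sv := Hspace_L2 Vv.1; have s0 := Hspace_L2 H0.
  by have := ipZl (semi_inner_fieldL2) 0 s0 sv; rewrite scale0r mul0r.
move=> i; have s0 := Hspace_L2 H0 i; have H1 := Vspace_H1 i V0; split.
  apply: (@in_Linf_of_ae _ 0); first exact: s0.1.
  by apply: aeW => x _; rewrite /component mxE normr0.
move=> j; apply: (@in_Linf_of_ae _ 0); first exact: (wpartial_L2 j H1).1.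
have := wpartial_lin j (-1) (Vspace_H1 i Vu) (Vspace_H1 i Vu).
rewrite -component_lin -E0; apply: (@ae_weaken _ _ R vol) => x + Ox => /(_ Ox) ->.
by rewrite mulN1r addNr normr0.
Qed.

Lemma FW_sum (nu : R) f u m (c : 'I_m -> R) (w : 'I_m -> vfield R) : Vdual Omega f ->
  Vspace Omega u -> (forall k, Wspace Omega (w k)) ->
  FW Omega nu f u (\sum_k c k *: w k) = \sum_k c k * FW Omega nu f u (w k).
Proof.
move=> Vf Vu Ww.
have W0 := Wspace0 Vu.
have FW0 : FW Omega nu f u 0 = 0.
  by have := FW_lin nu (-1) Vf Vu W0 W0; rewrite scaler0 addr0 mulN1r addNr.
have key (s : seq 'I_m) : Wspace Omega (\sum_(k <- s) c k *: w k) /\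
    FW Omega nu f u (\sum_(k <- s) c k *: w k) = \sum_(k <- s) c k * FW Omega nu f u (w k).
  elim: s => [|k s [IW IF]]; first by rewrite !big_nil.
  rewrite !big_cons; split; first exact: (Wspace_lin (c k) (Ww k) IW).
  by rewrite (FW_lin nu (c k) Vf Vu (Ww k) IW) IF.
by have [] := key (index_enum 'I_m).
Qed.


Lemma ae_le_Rintegral g h : int1 g -> int1 h ->
  {ae vol, forall x, Omega x -> g x <= h x} ->
  \int[vol]_(x in Omega) g x <= \int[vol]_(x in Omega) h x.
Proof.
move=> ig ih gh; rewrite -subr_ge0 -(intB ih ig).
have mgh : measurable_fun Omega (fun x => h x - g x).
  have /measurable_EFinP mg := measurable_int _ ig.
  have /measurable_EFinP mh := measurable_int _ ih.
  exact: measurable_funB.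
rewrite (@ae_eq_Rintegral _ _ _ vol Omega mO _ (fun x => `|h x - g x|)) => //.
- by apply: Rintegral_ge0 => x _.
- exact: measurableT_comp.
by apply: (@ae_weaken _ _ R vol) gh => x gh Ox; rewrite ger0_norm// subr_ge0 gh.
Qed.

(** Pointwise, |a p b| <= C (a^2 + b^2) when |p| <= C; each component occurs three times in the
    double sum, whence 3 C. Continuity is recovered from this sum of squares by rescaling, in
    [bilinear_diag_continuous]. *)
Lemma trilin_bound w : Wspace Omega w -> exists2 K : R, 0 <= K & forall u v,
  fieldL2 u -> fieldL2 v ->
  `|trilin Omega u w v| <= K * (ip Omega u u + ip Omega v v).
Proof.
move=> Ww; have [C [C0 HC]] := Wspace_bound Ww.
exists (3 * C) => [|u v su sv]; first by rewrite mulr_ge0.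
rewrite trilinE; last by move=> i j; exact: trilin_int_W.
have sq y i : fieldL2 y -> int1 (fun x => y x 0 i * y x 0 i) by move=> sy; exact: L2intM.
have term i j : `|\int[vol]_(x in Omega) (u x 0 j * wpartial Omega j (component i w) x * v x 0 i)| <=
    C * (\int[vol]_(x in Omega) (u x 0 j * u x 0 j)) + C * (\int[vol]_(x in Omega) (v x 0 i * v x 0 i)).
  have iuv := trilin_int_W i j Ww su sv.
  have iu := int1Z C (sq _ j su); have iv := int1Z C (sq _ i sv).
  rewrite -(intZ C (sq _ j su)) -(intZ C (sq _ i sv)) -(intD iu iv).
  have bnd : {ae vol, forall x, Omega x -> `|u x 0 j * wpartial Omega j (component i w) x * v x 0 i| <=
      C * (u x 0 j * u x 0 j) + C * (v x 0 i * v x 0 i)}.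
    have [_ /(_ j)] := HC i; apply: (@ae_weaken _ _ R vol) => x + Ox => /(_ Ox).
    rewrite !normrM; move: (wpartial _ _ _ _) (u x 0 j) (v x 0 i) => p a b pC.
    have pa : `|a| * `|p| * `|b| <= C * (`|a| * `|b|).
      by rewrite mulrAC mulrC ler_wpM2r// mulr_ge0.
    apply: le_trans pa _; rewrite -mulrDr ler_wpM2l//.
    have a2 : a * a = `|a| * `|a| by rewrite -!expr2 real_normK ?num_real.
    have b2 : b * b = `|b| * `|b| by rewrite -!expr2 real_normK ?num_real.
    rewrite a2 b2; move: `|a| `|b| (normr_ge0 a) (normr_ge0 b) => y z y0 z0.
    by have := sqr_ge0 (y - z); nra.
  rewrite ler_norml; apply/andP; split.
    rewrite -[X in _ <= X]mul1r -[X in X * _]opprK mulNr lerN2 mulN1r.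
    rewrite -mulN1r -(intZ (-1) iuv).
    apply: ae_le_Rintegral; [exact: int1Z|exact: int1D|].
    apply: (@ae_weaken _ _ R vol) bnd => x bnd Ox; apply: le_trans (bnd Ox).
    by rewrite mulN1r -normrN ler_norm.
  apply: ae_le_Rintegral; [by []|exact: int1D|].
  by apply: (@ae_weaken _ _ R vol) bnd => x bnd Ox; apply: le_trans (bnd Ox); exact: ler_norm.
apply: (@le_trans _ _ (\sum_i \sum_j (C * (\int[vol]_(x in Omega) (u x 0 j * u x 0 j)) +
    C * (\int[vol]_(x in Omega) (v x 0 i * v x 0 i))))).
  apply: le_trans (ler_norm_sum _ _ _) _; apply: ler_sum => i _.
  by apply: le_trans (ler_norm_sum _ _ _) _; apply: ler_sum => j _; exact: term.
have ipE y : fieldL2 y -> ip Omega y y = \sum_i \int[vol]_(x in Omega) (y x 0 i * y x 0 i).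
  by move=> sy; exact: (@field_ipE _ _ _ vol Omega mO 3).
rewrite !ipE//.
have sum3 (a b : 'I_3 -> R) :
    \sum_i \sum_j (C * a j + C * b i) = 3 * C * (\sum_i a i + \sum_i b i).
  by rewrite !big_ord_recl !big_ord0; ring.
by rewrite sum3.
Qed.

Lemma trilin_linl w (a : R) u v y : Wspace Omega w -> fieldL2 u -> fieldL2 v ->
  fieldL2 y -> trilin Omega (a *: u + v) w y = a * trilin Omega u w y + trilin Omega v w y.
Proof.
move=> Ww su sv sy; have suv := semi_inner_lin (semi_inner_fieldL2) a su sv.
rewrite !trilinE; try by move=> i j; exact: trilin_int_W.
rewrite mulr_sumr -big_split /=; apply: eq_bigr => i _.
rewrite mulr_sumr -big_split /=; apply: eq_bigr => j _.
have i1 := trilin_int_W i j Ww su sy; have i2 := trilin_int_W i j Ww sv sy.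
rewrite -(intZ a i1) -(intD (int1Z a i1) i2); congr Rintegral; apply/funext => x.
by rewrite !mxE; ring.
Qed.

Lemma trilin_linr w (a : R) u v y : Wspace Omega w -> fieldL2 u -> fieldL2 v ->
  fieldL2 y -> trilin Omega y w (a *: u + v) = a * trilin Omega y w u + trilin Omega y w v.
Proof.
move=> Ww su sv sy; have suv := semi_inner_lin (semi_inner_fieldL2) a su sv.
rewrite !trilinE; try by move=> i j; exact: trilin_int_W.
rewrite mulr_sumr -big_split /=; apply: eq_bigr => i _.
rewrite mulr_sumr -big_split /=; apply: eq_bigr => j _.
have i1 := trilin_int_W i j Ww sy su; have i2 := trilin_int_W i j Ww sy sv.
rewrite -(intZ a i1) -(intD (int1Z a i1) i2); congr Rintegral; apply/funext => x.
by rewrite !mxE; ring.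
Qed.

(** [Tcyl] prescribes Psi and its derivative at elements of W' only. Since Omega is bounded, u is in
    L1, and the supremum norm contained in [Wnorm] controls the pairing. *)
Lemma H_to_Wdual_Wdual u : Hspace Omega u -> Wdual Omega (H_to_Wdual Omega u).
Proof.
move=> Hu; have su := Hspace_L2 Hu.
have SI := semi_inner_fieldL2.
split.
  move=> a v w Wv Ww; rewrite /H_to_Wdual.
  have sv := Wspace_L2 Wv; have sw := Wspace_L2 Ww.
  by rewrite !(semi_innerC SI u) (semi_inner_linl SI).
pose c := \sum_i \int[vol]_(x in Omega) `|u x 0 i|.
have c0 i : 0 <= \int[vol]_(x in Omega) `|u x 0 i| by apply: Rintegral_ge0.
exists c => w Ww; have sw := Wspace_L2 Ww.
have ipE : ip Omega u w = \sum_i \int[vol]_(x in Omega) (u x 0 i * w x 0 i).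
  exact: (@field_ipE _ _ _ vol Omega mO 3 u w su sw).
rewrite /H_to_Wdual ipE.
apply: le_trans (ler_norm_sum _ _ _) _.
rewrite mulr_suml; apply: ler_sum => i _.
pose n := fine (Linfnorm Omega (component i w)).
have iu : int1 (fun x => `|u x 0 i|) by exact: (@integrable_norm _ _ _ vol Omega _ (L2int (su i))).
have iuw := L2intM (su i) (sw i).
have wn := in_Linf_ae (Ww.2 i).1.
have le1 : `|\int[vol]_(x in Omega) (u x 0 i * w x 0 i)| <= n * \int[vol]_(x in Omega) `|u x 0 i|.
  rewrite -(intZ n iu); apply: le_trans (le_normr_Rintegral _ _) _ => //.
  apply: ae_le_Rintegral.
  - exact: (@integrable_norm _ _ _ vol Omega _ iuw).
  - exact: int1Z.
  - by apply: (@ae_weaken _ _ R vol) wn => x wn Ox; rewrite normrM mulrC ler_wpM2r// wn.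
apply: le_trans le1 _; rewrite mulrC ler_wpM2l//.
rewrite /Wnorm; apply: ler_wpDl; first exact: sqrtr_ge0.
rewrite (bigD1 i)//= -/n -addrA lerDl.
have p0 k : 0 <= fine (Linfnorm Omega (component k w)) +
    \sum_j fine (Linfnorm Omega (wpartial Omega j (component k w))).
  by rewrite addr_ge0 ?Linfnorm_ge0//; apply: sumr_ge0 => j _; exact: Linfnorm_ge0.
by apply: addr_ge0; apply: sumr_ge0 => k _; [exact: Linfnorm_ge0|exact: p0].
Qed.

End FieldSpaces.

(** * Primitives, weak derivatives and the chain rule *)

Section IndefiniteIntegrals.
Context {R : realType}.
Local Notation mu := (@lebesgue_measure R).
Implicit Types (f g h : R -> R).

Definition bounded_measurable f :=
  measurable_fun setT f /\ exists C, forall x, `|f x| <= C.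

Lemma bounded_measurableM f g :
  bounded_measurable f -> bounded_measurable g -> bounded_measurable (fun x => f x * g x).
Proof.
move=> [mf [C fC]] [mg [D gD]]; split; first exact: measurable_funM.
by exists (C * D) => x; rewrite normrM ler_pM.
Qed.

Lemma bounded_measurableD f g :
  bounded_measurable f -> bounded_measurable g -> bounded_measurable (fun x => f x + g x).
Proof.
move=> [mf [C fC]] [mg [D gD]]; split; first exact: measurable_funD.
by exists (C + D) => x; apply: le_trans (ler_normD _ _) _; rewrite lerD.
Qed.

Lemma bounded_measurable_cst (c : R) : bounded_measurable (cst c).
Proof. by split; [exact: measurable_cst|exists `|c|]. Qed.

Lemma bounded_measurable_sum (I : Type) (s : seq I) (F : I -> R -> R) :
  (forall i, bounded_measurable (F i)) -> bounded_measurable (fun x => \sum_(i <- s) F i x).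
Proof.
move=> bF; elim: s => [|i s IH].
  by have := bounded_measurable_cst 0; congr bounded_measurable; apply/funext => x; rewrite big_nil.
have := bounded_measurableD (bF i) IH.
by congr bounded_measurable; apply/funext => x; rewrite big_cons.
Qed.

Lemma segment_integrable f (a b C : R) : measurable_fun `[a, b] f ->
  (forall x, x \in `[a, b] -> `|f x| <= C) -> mu.-integrable `[a, b] (EFin \o f).
Proof.
move=> mf fC.
apply: (@ae_le_integrable _ _ R mu `[a, b]%classic (measurable_itv _) f (cst C) mf).
  apply/integrableP; split; first by apply/measurable_EFinP; exact: measurable_cst.
  rewrite /= integral_cst//= lebesgue_measure_itv/=.
  by case: ifPn => _; rewrite ?mule0// -EFinB -EFinM ltry.
apply: aeW => x xab; apply: le_trans (fC x xab) _; exact: ler_norm.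
Qed.

Lemma bounded_measurable_integrable f (a b : R) : bounded_measurable f ->
  mu.-integrable `[a, b] (EFin \o f).
Proof.
move=> [mf [C fC]]; apply: (@segment_integrable _ _ _ C) => //.
exact: measurable_funTS.
Qed.

Lemma segment_integral_bound f (a b C : R) : a <= b -> measurable_fun `[a, b] f ->
  (forall x, x \in `[a, b] -> `|f x| <= C) ->
  `|\int[mu]_(x in `[a, b]) f x| <= C * (b - a).
Proof.
move=> ab mf fC; have itf := segment_integrable mf fC.
apply: le_trans (le_normr_Rintegral _ itf) _ => //.
have C0 : 0 <= C by apply: le_trans (fC a _); rewrite ?in_itv/= ?lexx.
have -> : C * (b - a) = \int[mu]_(x in `[a, b]) (cst C x).
  have E := @lebesgue_measure_itv R `[a, b].
  rewrite Rintegral_cst// [X in fine X]E /= lte_fin.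
  by move: ab; rewrite le_eqVlt => /orP[/eqP->|ab]; [rewrite ltxx subrr|rewrite ab -EFinB].
apply: le_Rintegral => //; first exact: integrable_norm.
by apply: (@segment_integrable _ _ _ `|C|) => //; exact: measurable_cst.
Qed.

Lemma segment_integral_cat f (a b c : R) : bounded_measurable f -> a <= b -> b <= c ->
  \int[mu]_(x in `[a, c]) f x =
  \int[mu]_(x in `[a, b]) f x + \int[mu]_(x in `[b, c]) f x.
Proof.
move=> bf ab bc.
have := @Rintegral_itvB _ f (BLeft a) (BRight c) b (bounded_measurable_integrable a c bf).
rewrite !bnd_simp => /(_ ab bc)/eqP; rewrite subr_eq addrC => /eqP ->.
congr (_ + _); rewrite Rintegral_itv_obnd_cbnd//.
have := bounded_measurable_integrable b c bf; apply: integrableS => //.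
by apply: subset_itvr; rewrite bnd_simp.
Qed.

Lemma bounded_continuous_measurable f : continuous f ->
  (exists C, forall x, `|f x| <= C) -> bounded_measurable f.
Proof. by move=> cf bf; split=> //; exact: continuous_measurable_fun. Qed.

(** The g_k being only measurable, the y_k need not be differentiable. But the increment of Phi
    minus the integral of the sum of the c_k g_k is the integral of the sum of the (xi_k - c_k) g_k,
    which is o(h) at every point since the c_k are continuous and the g_k bounded; so this
    difference is constant. *)
Lemma primitive_chain_rule m (y g c : 'I_m -> R -> R) (Phi : R -> R) (x1 x2 : R) :
  (forall k, bounded_measurable (g k)) ->
  (forall k, continuous (c k)) -> (forall k, bounded_measurable (c k)) ->
  (forall k a b, a <= b -> y k b - y k a = \int[mu]_(x in `[a, b]) g k x) ->
  (forall x0 e, 0 < e -> exists2 d, 0 < d & forall x, `|x - x0| < d ->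
     exists xi : 'I_m -> R, (forall k, `|xi k - c k x0| <= e) /\
       Phi x - Phi x0 = \sum_k xi k * (y k x - y k x0)) ->
  x1 <= x2 ->
  Phi x2 - Phi x1 = \int[mu]_(x in `[x1, x2]) \sum_k c k x * g k x.
Proof.
move=> bg cc bc yg HPhi x12.
pose h x := \sum_k c k x * g k x.
have bh : bounded_measurable h.
  by apply: bounded_measurable_sum => k; exact: bounded_measurableM.
have [C [C0 gC]] : exists C, 0 < C /\ forall k x, `|g k x| <= C.
  have /choice[D HD] : forall k, exists D, forall x, `|g k x| <= D by move=> k; case: (bg k).
  have D0 k : 0 <= D k by apply: le_trans (HD k 0).
  exists (\sum_k D k + 1); split; first by rewrite ltr_wpDl// sumr_ge0.
  move=> k x; apply: le_trans (HD k x) _; rewrite (bigD1 k)//= -addrA lerDl.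
  by rewrite addr_ge0// sumr_ge0.
have local x0 e : 0 < e -> exists2 d, 0 < d & forall x lo hi, `|x - x0| < d ->
    lo = Num.min x x0 -> hi = Num.max x x0 ->
    `|Phi hi - Phi lo - \int[mu]_(s in `[lo, hi]) h s| <= e * (hi - lo).
  (* There are m terms, each at most 2 e' C: one e' for xi against c at x0, one for the variation of
     c. The + 1 covers m = 0. *)
  move=> e0; pose e' := e / (2 * C * (m%:R + 1)).
  have m0 : 0 < m%:R + 1 :> R by rewrite ltr_wpDl.
  have den : 0 < 2 * C * (m%:R + 1) by rewrite !mulr_gt0.
  have e'0 : 0 < e' by rewrite divr_gt0.
  have [d1 d10 Hd1] := HPhi x0 e' e'0.
  have : \forall s \near x0, forall k, `|c k x0 - c k s| <= e'.
    have Hk k : nbhs x0 [set s | `|c k x0 - c k s| <= e'].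
      by have /cvgrPdist_le/(_ e' e'0) := cc k x0.
    exact: (@filter_forall _ _ (fun k => [set s | `|c k x0 - c k s| <= e']) (nbhs x0) _ Hk).
  move=> /nbhs_ballP[d2 /= d20 Hd2].
  exists (Num.min d1 d2); first by rewrite lt_min d10.
  move=> x lo hi; rewrite lt_min => /andP[xd1 xd2] loE hiE.
  have lohi : lo <= hi by rewrite loE hiE ge_min le_max lexx.
  have [xi [Hxi Exi]] := Hd1 x xd1.
  have E1 : Phi hi - Phi lo = \sum_k xi k * (y k hi - y k lo).
    rewrite loE hiE; case: (leP x x0) => xx0 //.
    rewrite -opprB Exi -sumrN; apply: eq_bigr => k _.
    by rewrite -mulrN opprB.
  have near_s s : s \in `[lo, hi] -> forall k, `|c k x0 - c k s| <= e'.
    move=> slh; apply: Hd2; rewrite /ball /=.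
    apply: le_lt_trans xd2; move: slh; rewrite in_itv /= loE hiE.
    case: (leP x x0) => xx0 /andP[s1 s2]; rewrite ler_norml.
      by rewrite ler0_norm ?subr_le0//; apply/andP; split; lra.
    by rewrite gtr0_norm ?subr_gt0//; apply/andP; split; lra.
  pose F s := \sum_k (xi k - c k s) * g k s.
  have bF : bounded_measurable F.
    apply: bounded_measurable_sum => k; apply: bounded_measurableM => //.
    apply: bounded_measurableD; first exact: bounded_measurable_cst.
    have := bounded_measurableM (bounded_measurable_cst (-1)) (bc k).
    by congr bounded_measurable; apply/funext => s; rewrite /= mulN1r.
  have E2 : Phi hi - Phi lo - \int[mu]_(s in `[lo, hi]) h s = \int[mu]_(s in `[lo, hi]) F s.
    rewrite E1.
    have -> : \sum_k xi k * (y k hi - y k lo) = \int[mu]_(s in `[lo, hi]) (\sum_k xi k * g k s).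
      rewrite Rintegral_sumR//; last first.
        move=> k; apply: bounded_measurable_integrable.
        by apply: bounded_measurableM => //; exact: bounded_measurable_cst.
      apply: eq_bigr => k _; rewrite yg// RintegralZl//.
      exact: bounded_measurable_integrable.
    rewrite -RintegralB//; last 2 first.
    - apply: bounded_measurable_integrable; apply: bounded_measurable_sum => k.
      by apply: bounded_measurableM => //; exact: bounded_measurable_cst.
    - exact: bounded_measurable_integrable.
    congr Rintegral; apply/funext => s; rewrite /F /h -sumrB; apply: eq_bigr => k _.
    by rewrite mulrBl.
  rewrite E2; apply: segment_integral_bound => //.
    by apply: measurable_funTS; case: bF.
  move=> s slh; have ns := near_s s slh.
  apply: (@le_trans _ _ (\sum_(k < m) (2 * e') * C)).
    apply: le_trans (ler_norm_sum _ _ _) _; apply: ler_sum => k _.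
    rewrite normrM ler_pM//.
    rewrite (_ : xi k - c k s = (xi k - c k x0) + (c k x0 - c k s)); last by ring.
    apply: le_trans (ler_normD _ _) _; rewrite mulr_natl mulr2n.
    by rewrite lerD.
  rewrite sumr_const card_ord -[leLHS]mulr_natr.
  have eE : e = 2 * e' * C * (m%:R + 1) by rewrite /e'; field; rewrite !gt_eqF.
  have p0 : 0 <= 2 * e' * C by apply: mulr_ge0; [apply: mulr_ge0; [by []|exact: ltW]|exact: ltW].
  by rewrite [leRHS]eE ler_wpM2l// lerDl.
(* Clamping at x1 keeps the integral in [Z] over a segment starting at x1 for all x; being
   1-Lipschitz, it preserves the o(h) estimate. *)
pose p x := Num.max x x1.
pose Z x := Phi (p x) - \int[mu]_(s in `[x1, p x]) h s.
have dZ (x0 : R) : is_derive x0 (1 : R) Z 0.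
  apply: is_derive_bound => e e0.
  have [d d0 Hd] := local (p x0) e e0.
  exists d => // t td; rewrite mul0r subr0.
  have plip : `|p (t + x0) - p x0| <= `|t|.
    rewrite /p; case: (leP (t + x0) x1) => h1; case: (leP x0 x1) => h2.
    - by rewrite subrr normr0.
    - by rewrite ltr0_norm ?subr_lt0// -normrN; apply: le_trans (ler_norm _); lra.
    - by rewrite gtr0_norm ?subr_gt0//; apply: le_trans (ler_norm _); lra.
    - by rewrite addrK.
  have := Hd (p (t + x0)) _ _ (le_lt_trans plip td) erefl erefl.
  have cut a b : x1 <= a -> a <= b ->
      Phi b - Phi a - \int[mu]_(s in `[a, b]) h s =
      (Phi b - \int[mu]_(s in `[x1, b]) h s) - (Phi a - \int[mu]_(s in `[x1, a]) h s).
    by move=> x1a ab; rewrite (@segment_integral_cat h x1 a b)//; ring.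
  have px1 x : x1 <= p x by rewrite le_max lexx orbT.
  move=> H; apply: (@le_trans _ _ (e * `|p (t + x0) - p x0|)); last first.
    by rewrite ler_wpM2l// ltW.
  move: H; rewrite /Z; case: (leP (p (t + x0)) (p x0)) => pp.
    by rewrite cut// distrC [`|p _ - _|]distrC (ger0_norm (x := p x0 - _)) ?subr_ge0.
  by rewrite cut ?(ltW pp)// (ger0_norm (x := p _ - p x0)) ?subr_ge0 ?(ltW pp).
have := is_derive_0_is_cst x2 x1 dZ.
rewrite /Z /p maxxx (max_idPl x12) => /eqP.
rewrite subr_eq => /eqP ->.
rewrite [X in _ - X + _](_ : _ = 0); first by ring.
rewrite (_ : `[x1, x1]%classic = [set x1]); first exact: Rintegral_set1.
exact: set_itv1.
Qed.

End IndefiniteIntegrals.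

(** With w = y + v, the bound as it stands does not make the cross terms T y v and T v y small. It
    is applied to y / L and L v, with L small depending on v, and then y small depending on L. *)
Lemma bilinear_diag_continuous {R : realType} {X : lmodType R} (S : set X)
    (ip T : X -> X -> R) (K : R) : semi_inner S ip -> 0 <= K ->
  (forall a u v w, S u -> S v -> S w -> T (a *: u + v) w = a * T u w + T v w) ->
  (forall a u v w, S u -> S v -> S w -> T w (a *: u + v) = a * T w u + T w v) ->
  (forall u v, S u -> S v -> `|T u v| <= K * (ip u u + ip v v)) ->
  forall v, S v -> forall e, 0 < e -> exists2 del, 0 < del &
     forall w, S w -> ip (w - v) (w - v) < del -> `|T w w - T v v| < e.
Proof.
move=> SI K0 Tl Tr TK v Sv e e0.
have S0 : S 0 by rewrite -(scale0r v); exact: (semi_innerZ SI).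
have v0 := semi_inner_ge0 SI Sv.
have TZ a u w : S u -> S w -> T (a *: u) w = a * T u w.
  move=> Su Sw; have := Tl a u 0 w Su S0 Sw.
  have := Tl 1 0 0 w S0 S0 Sw; rewrite scale1r mul1r !addr0 => /eqP.
  by rewrite -subr_eq0 opprD addNKr oppr_eq0 => /eqP -> ->; rewrite addr0.
have TZr a u w : S u -> S w -> T w (a *: u) = a * T w u.
  move=> Su Sw; have := Tr a u 0 w Su S0 Sw.
  have := Tr 1 0 0 w S0 S0 Sw; rewrite scale1r mul1r !addr0 => /eqP.
  by rewrite -subr_eq0 opprD addNKr oppr_eq0 => /eqP -> ->; rewrite addr0.
(* This gives K L |v|^2 <= e / 8, and L <= 1 gives L^2 <= L; the radius chosen below gives K |y|^2 /
   L^2 <= e / 8. Each of the three terms is then at most e / 4. *)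
pose L := Num.min 1 (e / (8 * (K + 1) * (ip v v + 1))).
have K1 : 0 < K + 1 by rewrite ltr_wpDl.
have V1 : 0 < ip v v + 1 by rewrite ltr_wpDl.
have L0 : 0 < L by rewrite lt_min ltr01 divr_gt0// !mulr_gt0.
have L1 : L <= 1 by rewrite ge_min lexx.
have Lv : K * (L * ip v v) <= e / 8.
  apply: (@le_trans _ _ ((K + 1) * (L * (ip v v + 1)))).
    by rewrite ler_pM// ?mulr_ge0 ?ler_pM ?lerDl// ltW.
  have : L <= e / (8 * (K + 1) * (ip v v + 1)) by rewrite ge_min lexx orbT.
  rewrite ler_pdivlMr ?mulr_gt0// => h.
  rewrite ler_pdivlMr//; apply: le_trans h; rewrite le_eqVlt; apply/orP; left; apply/eqP; ring.
exists (L ^+ 2 * e / (8 * (K + 1))); first by rewrite divr_gt0// !mulr_gt0// exprn_gt0.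
move=> w Sw; pose y := w - v => Hy.
have Sy : S y by exact: (semi_innerB SI).
have y0 := semi_inner_ge0 SI Sy.
have wE : w = 1 *: y + v by rewrite scale1r subrK.
have KyL : K * (ip y y / L ^+ 2) <= e / 8.
  apply: (@le_trans _ _ ((K + 1) * (ip y y / L ^+ 2))).
    by rewrite ler_wpM2r ?divr_ge0 ?exprn_ge0 ?lerDl// ltW.
  rewrite mulrA ler_pdivrMr ?exprn_gt0//.
  move: Hy; rewrite ltr_pdivlMr ?mulr_gt0// => /ltW h.
  rewrite -(ler_pM2r (_ : 0 < 8))//; apply: (le_trans _ (le_trans h _)).
    by rewrite le_eqVlt; apply/orP; left; apply/eqP; ring.
  by rewrite le_eqVlt; apply/orP; left; apply/eqP; field.
have cross a b : S a -> S b -> ip a a = ip y y / L ^+ 2 -> ip b b = L ^+ 2 * ip v v ->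
    `|T a b| <= e / 4 /\ `|T b a| <= e / 4.
  move=> Sa Sb Ea Eb.
  have h : K * (ip a a + ip b b) <= e / 4.
    rewrite mulrDr Ea Eb.
    have : K * (L ^+ 2 * ip v v) <= K * (L * ip v v).
      by rewrite ler_wpM2l// ler_wpM2r// expr2 ler_piMl// ltW.
    move=> h1; have := le_trans h1 Lv; move: KyL; lra.
  split; first by apply: le_trans (TK _ _ Sa Sb) h.
  by apply: le_trans (TK _ _ Sb Sa) _; rewrite addrC.
pose a := L^-1 *: y; pose b := L *: v.
have Sa : S a by exact: (semi_innerZ SI).
have Sb : S b by exact: (semi_innerZ SI).
have Ea : ip a a = ip y y / L ^+ 2.
  by rewrite (ipZl SI)// (ipZr SI)// expr2 invfM; ring.
have Eb : ip b b = L ^+ 2 * ip v v by rewrite (ipZl SI)// (ipZr SI)//; ring.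
have [h1 h2] := cross a b Sa Sb Ea Eb.
have Ln : L != 0 by rewrite gt_eqF.
have Tab : T a b = T y v by rewrite TZ// TZr// mulrA mulVf// mul1r.
have Tba : T b a = T v y by rewrite TZ// TZr// mulrA mulfV// mul1r.
have Tyy : `|T y y| <= e / 4.
  apply: le_trans (TK _ _ Sy Sy) _.
  have : ip y y <= ip y y / L ^+ 2.
    by rewrite ler_pdivlMr ?exprn_gt0// ler_piMr// exprn_ile1// ltW.
  move=> /(ler_wpM2l K0) h; have := le_trans h KyL; rewrite mulrDr; lra.
have -> : T w w - T v v = T y y + T y v + T v y.
  rewrite wE Tl// ?Tr//; last by rewrite -wE.
  by ring.
rewrite Tab in h1; rewrite Tba in h2.
apply: le_lt_trans (ler_normD _ _) _.
have := ler_normD (T y y) (T y v); lra.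
Qed.

Lemma nbhs_ball_forall {R : realType} {T : pseudoMetricType R} (I : finType) (x : T)
    (P : I -> set T) : (forall i, nbhs x (P i)) ->
  exists2 d : R, 0 < d & forall s, ball x d s -> forall i, P i s.
Proof.
move=> H; have : nbhs x [set s | forall i, P i s].
  exact: (@filter_forall _ _ P (nbhs x) _ H).
by move=> /nbhs_ballP[d d0 Hd]; exists d.
Qed.

(** * Compactly supported C1 functions along continuous curves *)

Section RowComposition.
Context {R : realType} (m : nat) (psi : 'rV[R]_m -> R).
Hypothesis Cpsi : C1c psi.
Local Notation dpsi k := ('D_(delta_mx 0 k) psi).

Lemma C1c_partial_bounded k : exists C, forall z, `|dpsi k z| <= C.
Proof.
have [_ /(_ k)[_ dc] [K [cK psi0]]] := Cpsi.
have cl : closed K by apply: compact_closed => //; exact: norm_hausdorff.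
have d0 z : ~ K z -> dpsi k z = 0.
  move=> nK; rewrite (near_eq_derive (g := cst 0)); first exact: derive_cst.
  have : nbhs z (~` K) by apply: open_nbhs_nbhs; split=> //; exact: closed_openC.
  by apply: filterS => y /psi0.
have : compact [set dpsi k z | z in K].
  by apply: continuous_compact => //; exact: continuous_subspaceT.
move=> /compact_bounded [M [Mr HM]]; exists (`|M| + 1) => z.
have [Kz|nK] := pselect (K z); last by rewrite d0// normr0 addr_ge0.
by apply: (HM (`|M| + 1)); [rewrite (le_lt_trans (ler_norm _))// ltrDl|exists z].
Qed.

Lemma C1c_bounded : exists C, forall z, `|psi z| <= C.
Proof.
have [pc _ [K [cK psi0]]] := Cpsi.
have : compact [set psi z | z in K].
  by apply: continuous_compact => //; exact: continuous_subspaceT.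
move=> /compact_bounded [M [Mr HM]]; exists (`|M| + 1) => z.
have [Kz|nK] := pselect (K z); last by rewrite psi0// normr0 addr_ge0.
by apply: (HM (`|M| + 1)); [rewrite (le_lt_trans (ler_norm _))// ltrDl|exists z].
Qed.

Lemma continuous_row (y : 'I_m -> R -> R) : (forall k, continuous (y k)) ->
  continuous (fun x => \row_k y k x : 'rV[R]_m).
Proof.
move=> yc x; apply/cvg_ballP => e e0.
have H k : nbhs x [set s | `|y k x - y k s| < e].
  by have /cvgrPdist_lt/(_ e e0) := yc k x.
have [d d0 Hd] := nbhs_ball_forall H.
by apply/nbhs_ballP; exists d => // s sd; split=> // i j; rewrite /ball /= !mxE; exact: (Hd _ sd).
Qed.

Lemma C1c_line_mvt k (z : 'rV[R]_m) (a : R) : exists t, `|t| <= `|a| /\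
  psi (z + a *: delta_mx 0 k) - psi z = dpsi k (z + t *: delta_mx 0 k) * a.
Proof.
have [pc /(_ k)[pd dc] _] := Cpsi.
pose phi (t : R) := psi (z + t *: delta_mx 0 k).
have dphi (t : R) : is_derive t (1 : R) phi (dpsi k (z + t *: delta_mx 0 k)).
  apply: (is_derive_transfer (W := 'rV[R]_m) _ (derivableP (pd (z + t *: delta_mx 0 k)))).
  move=> s; rewrite /phi (_ : s *: (1 : R) = s); last exact: mulr1.
  by rewrite scalerDl addrCA.
have cphi : continuous phi.
  by move=> t; apply: differentiable_continuous; apply/derivable1_diffP; case: (dphi t).
have phi0 : phi 0 = psi z by rewrite /phi scale0r addr0.
have [a0|a0] := leP 0 a.
  have [t] := MVT_segment a0 (fun x _ => dphi x) (continuous_subspaceT cphi).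
  rewrite in_itv /= => /andP[t0 ta]; rewrite phi0 subr0 => E.
  by exists t; split; [rewrite !ger0_norm|].
have [t] := MVT_segment (ltW a0) (fun x _ => dphi x) (continuous_subspaceT cphi).
rewrite in_itv /= => /andP[ta t0]; rewrite phi0 => E.
exists t; split; first by rewrite !ler0_norm ?lerN2// ltW.
by rewrite -opprB E sub0r mulrN opprK.
Qed.

(** The coordinates move one at a time, and the mean value theorem in coordinate k produces xi k;
    the intermediate points stay in the cube around the initial row where the partial derivatives
    vary by at most e. *)
Lemma C1c_row_expansion (y : 'I_m -> R -> R) (x0 e : R) :
  (forall k, continuous (y k)) -> 0 < e -> exists2 d, 0 < d & forall x, `|x - x0| < d ->
    exists xi : 'I_m -> R, (forall k, `|xi k - dpsi k (\row_l y l x0)| <= e) /\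
      psi (\row_l y l x) - psi (\row_l y l x0) = \sum_k xi k * (y k x - y k x0).
Proof.
move=> yc e0; pose Y0 : 'rV[R]_m := \row_l y l x0.
have [_ pd _] := Cpsi.
have H k : nbhs Y0 [set z | `|dpsi k Y0 - dpsi k z| <= e].
  by have /cvgrPdist_le/(_ e e0) := (pd k).2 Y0.
have [r r0 Hr] := nbhs_ball_forall H.
have Hy k : nbhs x0 [set s | `|y k x0 - y k s| < r].
  by have /cvgrPdist_lt/(_ r r0) := yc k x0.
have [d d0 Hd] := nbhs_ball_forall Hy; exists d => // x xd.
have {}Hd k : `|y k x0 - y k x| < r by apply: Hd; rewrite /ball /= distrC.
pose z (k : nat) : 'rV[R]_m := \row_l (if (l < k)%N then y l x else y l x0).
have z0 : z 0%N = \row_l y l x0 by apply/rowP => l; rewrite !mxE.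
have zm : z m = \row_l y l x by apply/rowP => l; rewrite !mxE ltn_ord.
have zS (k : 'I_m) : z k.+1 = z k + (y k x - y k x0) *: delta_mx 0 k.
  apply/rowP => l; rewrite !mxE eqxx /= ltnS.
  have [->|lk] := eqVneq l k; first by rewrite leqnn ltnn mulr1 subrKC.
  by rewrite mulr0 addr0 leq_eqVlt (negbTE (lk : val l != val k)).
have step k : exists xi, `|xi - dpsi k Y0| <= e /\
    psi (z k.+1) - psi (z k) = xi * (y k x - y k x0).
  have [t [ta Et]] := C1c_line_mvt k (z k) (y k x - y k x0).
  exists (dpsi k (z k + t *: delta_mx 0 k)); split; last by rewrite zS.
  rewrite distrC; apply: (Hr _ _ k); split=> // i j; rewrite (ord1 i) /ball /= !mxE eqxx /=.
  have [->|jk] := eqVneq j k.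
    rewrite ltnn mulr1 opprD addrA subrr sub0r normrN.
    by apply: le_lt_trans ta _; rewrite distrC.
  rewrite mulr0 addr0; case: ifP => _ //.
  by rewrite subrr normr0.
have [xi Hxi] := choice step.
exists xi; split=> [k|]; first by case: (Hxi k).
rewrite -zm -z0 -(telescope_sumr (fun k => psi (z k)) (leq0n m)) big_mkord.
by apply: eq_bigr => k _; case: (Hxi k).
Qed.

End RowComposition.

(** * Weak derivatives in time *)

Section WeakDerivative.
Context {R : realType}.
Local Notation mu := (@lebesgue_measure R).
Local Notation P := (@smooth_step R).
Implicit Types (s : R) (f : R -> R).

Lemma Rintegral_support d (T : measurableType d) (nu : {measure set T -> \bar R})
    (A B : set T) (f : T -> R) : A `<=` B -> (forall x : T, B x -> ~ A x -> f x = 0) ->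
  \int[nu]_(x in B) f x = \int[nu]_(x in A) f x.
Proof.
move=> AB f0; rewrite Rintegral_mkcond [RHS]Rintegral_mkcond; congr Rintegral.
apply/funext => x; rewrite !patchE; case: ifPn => xB; case: ifPn => xA //.
- by apply: f0; [exact: set_mem|rewrite -notin_setE].
- by move: xB; rewrite notin_setE => /(_ (AB _ (set_mem xA))).
Qed.

Lemma derive1_smooth_step_out (x : R) : ~~ (0 <= x <= 1) -> derive1 P x = 0.
Proof.
rewrite negb_and -!ltNge derive1E => /orP[x0|x1].
  rewrite (near_eq_derive (g := cst 0)); first exact: derive_cst.
  have : \forall y \near x, y < 0 by exact: lt_nbhsl.
  by apply: filterS => y /ltW; exact: smooth_step_le0.
rewrite (near_eq_derive (g := cst (1 : R))); first exact: derive_cst.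
have : \forall y \near x, 1 < y by exact: lt_nbhsr.
by apply: filterS => y /ltW; exact: smooth_step_ge1.
Qed.

Lemma continuous_derive1_smooth_step : continuous (derive1 P).
Proof. exact: (smooth1_continuous (smooth1_derive (@smooth1_step R))). Qed.

Lemma derive1_smooth_step_bounded : exists2 M : R, 0 <= M & forall x, `|derive1 P x| <= M.
Proof.
have : compact [set derive1 P x | x in `[0, 1]].
  apply: continuous_compact; last exact: segment_compact.
  apply: continuous_subspaceT; exact: continuous_derive1_smooth_step.
move=> /compact_bounded [M [Mr HM]]; exists (`|M| + 1) => // x.
have [x01|nx] := boolP (0 <= x <= 1); last by rewrite derive1_smooth_step_out// normr0.
by apply: (HM (`|M| + 1)); [rewrite (le_lt_trans (ler_norm _))// ltrDl|exists x].
Qed.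

(** A smooth Heaviside function at s. Its transition lies to the right of s, so for s >= b it
    vanishes up to time b. *)
Definition scaled_step (n : nat) s x : R := P (n%:R * x + - (n%:R * s)).

Lemma smooth1_scaled_step n s : smooth1 (scaled_step n s).
Proof. exact: (@smooth1_affine R n%:R (- (n%:R * s)) _ (@smooth1_step R)). Qed.

Lemma is_derive_scaled_step n s x :
  is_derive x (1 : R) (scaled_step n s) (n%:R * derive1 P (n%:R * (x - s))).
Proof.
have dP := derivableP (@smooth1_derivable R _ (@smooth1_step R) (n%:R * x + - (n%:R * s))).
have h1 : is_derive x (1 : R) (fun x => n%:R * x + - (n%:R * s)) n%:R.
  by apply: is_derive_eq; rewrite /GRing.scale /= ?scaler0; ring.
apply: (is_derive_eq (@is_derive1_comp R P (fun x => n%:R * x + - (n%:R * s)) x _ _ dP h1)).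
by rewrite derive1E mulrC mulrBr.
Qed.

Lemma scaled_step_le n s x : x <= s -> scaled_step n s x = 0.
Proof.
by move=> xs; rewrite /scaled_step smooth_step_le0// -mulrBr mulr_ge0_le0// subr_le0.
Qed.

Lemma scaled_step_ge n s x : (0 < n)%N -> s + n%:R^-1 <= x -> scaled_step n s x = 1.
Proof.
move=> n0 xs; rewrite /scaled_step smooth_step_ge1// -mulrBr.
have n0' : 0 < n%:R :> R by rewrite ltr0n.
by rewrite mulrC -ler_pdivrMr// mul1r lerBrDl.
Qed.

Lemma scaled_step_ge0 n s x : 0 <= scaled_step n s x.
Proof. exact: smooth_step_ge0. Qed.

Lemma scaled_step_le1 n s x : scaled_step n s x <= 1.
Proof. exact: smooth_step_le1. Qed.

Lemma derive1_scaled_step_out n s x : (0 < n)%N ->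
  x \notin `[s, s + n%:R^-1] -> derive1 (scaled_step n s) x = 0.
Proof.
move=> n0; have n0' : 0 < n%:R :> R by rewrite ltr0n.
rewrite in_itv /= => nx.
have [_ dE] := is_derive_scaled_step n s x.
rewrite derive1E dE derive1_smooth_step_out ?mulr0//.
apply: contra nx => /andP[h1 h2].
have h3 : 0 <= x - s by rewrite -(pmulr_rge0 _ n0').
have h4 : x - s <= n%:R^-1 by rewrite -[n%:R^-1]mul1r ler_pdivlMr// mulrC.
by apply/andP; split; lra.
Qed.

(** The derivative of the step is an approximate identity: its integral is 1 by the fundamental
    theorem of calculus, and it is bounded by n M on an interval of length 1/n, so an oscillation e'
    of f costs at most M e' <= e. *)
Lemma scaled_step_mollifies f s (e : R) : continuous f -> 0 < e ->
  \forall n \near \oo, `|\int[mu]_(x in `[s, s + n%:R^-1])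
      (derive1 (scaled_step n s) x * f x) - f s| <= e.
Proof.
move=> cf e0; have [M M0 HM] := derive1_smooth_step_bounded.
pose e' := e / (M + 1).
have M1 : 0 < M + 1 by rewrite ltr_wpDl.
have e'0 : 0 < e' by rewrite divr_gt0.
have : nbhs s [set x | `|f s - f x| <= e'] by have /cvgrPdist_le/(_ e' e'0) := cf s.
move=> /nbhs_ballP[d /= d0 Hd].
near=> n.
have n0 : (0 < n)%N by near: n; exact: nbhs_infty_gt.
have n0' : 0 < n%:R :> R by rewrite ltr0n.
have nd : n%:R^-1 < d.
  by rewrite invf_plt ?posrE//; near: n; exact: nbhs_infty_gtr.
have sn : s < s + n%:R^-1 by rewrite ltrDl invr_gt0.
set r := derive1 (scaled_step n s).
have cr : continuous r by exact: (smooth1_continuous (smooth1_derive (@smooth1_scaled_step n s))).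
have rE x : r x = n%:R * derive1 P (n%:R * (x - s)).
  by rewrite /r derive1E; case: (is_derive_scaled_step n s x).
have mr : measurable_fun setT r by exact: continuous_measurable_fun.
have mf : measurable_fun setT f by exact: continuous_measurable_fun.
have rb x : `|r x| <= n%:R * M.
  by rewrite rE normrM ger0_norm// ler_wpM2l.
have fb x : x \in `[s, s + n%:R^-1] -> `|f x - f s| <= e'.
  rewrite in_itv /= => /andP[h1 h2]; rewrite distrC; apply: Hd.
  by rewrite /ball /= ltr_distlC; apply/andP; split; lra.
have ir : mu.-integrable `[s, s + n%:R^-1] (EFin \o r).
  exact: (segment_integrable (measurable_funTS mr) (fun x _ => rb x)).
have irf : mu.-integrable `[s, s + n%:R^-1] (EFin \o (fun x => r x * (f x - f s))).
  apply: (@segment_integrable _ _ _ _ (n%:R * M * e')).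
    by apply: measurable_funTS; apply: measurable_funM => //; exact: measurable_funB.
  by move=> x xs; rewrite normrM ler_pM// fb.
have r1 : \int[mu]_(x in `[s, s + n%:R^-1]) r x = 1.
  rewrite /Rintegral (@continuous_FTC2 _ r (scaled_step n s) _ _ sn).
  - by rewrite scaled_step_ge// scaled_step_le// -EFinB subr0.
  - exact: continuous_subspaceT.
  - have cs := smooth1_continuous (@smooth1_scaled_step n s).
    split; [by move=> x _; exact: smooth1_derivable (@smooth1_scaled_step n s) x| |].
      by apply: cvg_at_right_filter; exact: cs.
    by apply: cvg_at_left_filter; exact: cs.
  - by move=> x _.
have ifr : mu.-integrable `[s, s + n%:R^-1] (EFin \o (fun x => f s * r x)).
  exact: (@integrableZl _ _ R mu `[s, s + n%:R^-1]%classic (measurable_itv _) (f s) _ ir).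
have E2 : \int[mu]_(x in `[s, s + n%:R^-1]) (r x * f x) =
    \int[mu]_(x in `[s, s + n%:R^-1]) (r x * (f x - f s)) +
    \int[mu]_(x in `[s, s + n%:R^-1]) (f s * r x).
  by rewrite -RintegralD//; congr Rintegral; apply/funext => x; ring.
rewrite E2 RintegralZl// r1 mulr1 addrK.
apply: le_trans (@segment_integral_bound _ _ _ _ (n%:R * M * e') (ltW sn) _ _) _.
- by apply: measurable_funTS; apply: measurable_funM => //; exact: measurable_funB.
- by move=> x xs; rewrite normrM ler_pM// fb.
have -> : n%:R * M * e' * (s + n%:R^-1 - s) = M * e' by field; rewrite gt_eqF.
by rewrite /e' mulrCA ler_piMr// ?(ltW e0)// ler_pdivrMr// mul1r lerDl.
Unshelve. all: by end_near. Qed.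

(* Test with the difference of two smooth approximations of the Heaviside
   functions at [s] and [t]. *)
Lemma weak_derivative_primitive (y g : R -> R) (b : R) : 0 < b ->
  continuous y -> bounded_measurable g ->
  (forall eta, time_test_function eta -> (forall t, t <= b -> eta t = 0) ->
     - (\int[mu]_(t in `]0, +oo[) (derive1 eta t * y t)) =
     \int[mu]_(t in `]0, +oo[) (eta t * g t)) ->
  forall s t, b <= s -> s < t -> y t - y s = \int[mu]_(x in `[s, t]) g x.
Proof.
move=> b0 cy bg weak s t bs st.
have [mg [C gC]] := bg.
have C0 : 0 <= C by apply: le_trans (gC 0).
apply/eqP; rewrite -subr_eq0 -normr_le0; apply/ler_addgt0Pl => e e0; rewrite addr0.
(* Four errors: the mollifications of y at s and at t, and the contributions of g on the two
   transition layers, of length 1/n. *)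
have e4 : 0 < e / 4 by rewrite divr_gt0.
near \oo => n.
have n0 : (0 < n)%N by near: n; exact: nbhs_infty_gt.
have n0' : 0 < n%:R :> R by rewrite ltr0n.
have n1 : n%:R^-1 <= 1 :> R by rewrite invf_le1// ler1n.
have ni0 : 0 <= n%:R^-1 :> R by rewrite invr_ge0.
have nst : s + n%:R^-1 <= t.
  rewrite -lerBrDl -[leRHS]invrK lef_pV2 ?posrE ?invr_gt0 ?subr_gt0//.
  by near: n; exact: nbhs_infty_ger.
have nC : C * n%:R^-1 <= e / 4.
  rewrite ler_pdivrMr// [leRHS]mulrC -ler_pdivrMr//.
  by near: n; exact: nbhs_infty_ger.
have Ms : `|\int[mu]_(x in `[s, s + n%:R^-1]) (derive1 (scaled_step n s) x * y x) - y s| <= e / 4.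
  by near: n; exact: scaled_step_mollifies.
have Mt : `|\int[mu]_(x in `[t, t + n%:R^-1]) (derive1 (scaled_step n t) x * y x) - y t| <= e / 4.
  by near: n; exact: scaled_step_mollifies.
pose eta x := scaled_step n s x - scaled_step n t x.
have seta : smooth1 eta.
  have := smooth1D (@smooth1_scaled_step n s)
    (smooth1M (@smooth1_cst R (-1)) (@smooth1_scaled_step n t)).
  by congr smooth1; apply/funext => x; rewrite !fctE mulN1r.
have eta_lo x : x <= s -> eta x = 0.
  by move=> xs; rewrite /eta !scaled_step_le ?subrr// (le_trans xs)// ltW.
have eta_hi x : t + n%:R^-1 <= x -> eta x = 0.
  move=> xt; rewrite /eta !scaled_step_ge ?subrr//.
  by apply: le_trans nst _; apply: le_trans xt; rewrite lerDl.
have eta_mid x : s + n%:R^-1 <= x -> x <= t -> eta x = 1.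
  by move=> sx xt; rewrite /eta scaled_step_ge// scaled_step_le// subr0.
have eta_b x : `|eta x| <= 1.
  rewrite /eta; have := scaled_step_ge0 n s x; have := scaled_step_le1 n s x.
  have := scaled_step_ge0 n t x; have := scaled_step_le1 n t x.
  by rewrite ler_norml => *; apply/andP; split; lra.
have eta_b1 x : `|eta x - 1| <= 1.
  have h : scaled_step n t x <= scaled_step n s x.
    have [xt|tx] := leP x t; first by rewrite (scaled_step_le n xt) scaled_step_ge0.
    by rewrite (scaled_step_ge (s := s))// ?scaled_step_le1// (le_trans nst)// ltW.
  rewrite /eta; move: h; have := scaled_step_ge0 n s x; have := scaled_step_le1 n s x.
  have := scaled_step_ge0 n t x; have := scaled_step_le1 n t x.
  by rewrite ler_norml => *; apply/andP; split; lra.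
have teta : time_test_function eta.
  split; first exact: seta.
  (* As 1/n <= 1, this segment contains the support and does not depend on n. *)
  exists `[s, t + 1]%classic; split; first exact: segment_compact.
    by move=> x /=; rewrite !in_itv /= andbT => /andP[sx _]; apply: lt_le_trans b0 (le_trans bs sx).
  move=> x /negP; rewrite /= in_itv /= negb_and -!ltNge => /orP[xs|tx].
    by apply: eta_lo; exact: ltW.
  by apply: eta_hi; apply: le_trans (ltW tx); rewrite lerD2l.
have := weak eta teta (fun x xb => eta_lo x (le_trans xb bs)).
have pos x a c : b <= a -> x \in `[a, c] -> x \in `]0, +oo[.
  by move=> ba; rewrite !in_itv /= andbT => /andP[ax _]; apply: lt_le_trans b0 (le_trans ba ax).
have bt : b <= t by apply: le_trans bs (ltW st).
have deta x : derive1 eta x = derive1 (scaled_step n s) x - derive1 (scaled_step n t) x.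
  rewrite !derive1E; have := deriveB (@smooth1_derivable R _ (@smooth1_scaled_step n s) x)
    (@smooth1_derivable R _ (@smooth1_scaled_step n t) x).
  by [].
have my : measurable_fun setT y by exact: continuous_measurable_fun.
have md a : measurable_fun setT (derive1 (scaled_step n a)).
  apply: continuous_measurable_fun.
  exact: (smooth1_continuous (smooth1_derive (@smooth1_scaled_step n a))).
have ie : bounded_measurable eta.
  split; last by exists 1.
  apply: continuous_measurable_fun; exact: (smooth1_continuous seta).
have idy a : mu.-integrable `[s, t + 1] (EFin \o (fun x => derive1 (scaled_step n a) x * y x)).
  apply: continuous_compact_integrable; first exact: segment_compact.
  apply: continuous_subspaceT => x; apply: cvgM; last exact: cy.
  exact: (smooth1_continuous (smooth1_derive (@smooth1_scaled_step n a))).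
have I a : s <= a -> a <= t -> \int[mu]_(x in `[s, t + 1]) (derive1 (scaled_step n a) x * y x) =
    \int[mu]_(x in `[a, a + n%:R^-1]) (derive1 (scaled_step n a) x * y x).
  move=> sa at_; apply: Rintegral_support.
    move=> x; rewrite /= !in_itv /= => /andP[ax xa].
    by rewrite (le_trans sa ax)/=; apply: le_trans xa _; rewrite lerD.
  by move=> x _ /negP nx; rewrite derive1_scaled_step_out// mul0r.
have subA : `[s, t + 1]%classic `<=` `]0, +oo[%classic by move=> x; exact: pos.
have outA x : ~ `[s, t + 1]%classic x -> x <= s \/ t + n%:R^-1 <= x.
  move=> /negP; rewrite /= in_itv /= negb_and -!ltNge => /orP[xs|tx]; [left|right].
    exact: ltW.
  by apply: le_trans (ltW tx); rewrite lerD2l.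
have L : \int[mu]_(x in `]0, +oo[) (derive1 eta x * y x) =
    \int[mu]_(x in `[s, s + n%:R^-1]) (derive1 (scaled_step n s) x * y x) -
    \int[mu]_(x in `[t, t + n%:R^-1]) (derive1 (scaled_step n t) x * y x).
  rewrite (Rintegral_support mu subA); last first.
    move=> x _ /negP nx; rewrite deta !derive1_scaled_step_out ?subrr ?mul0r//.
      apply: contra nx; rewrite !in_itv /= => /andP[h1 h2].
      by rewrite (le_trans (ltW st) h1)/= (le_trans h2)// lerD2l.
    apply: contra nx; rewrite !in_itv /= => /andP[h1 h2].
    by rewrite h1/= (le_trans h2)// lerD// ltW.
  rewrite -(I s)// ?(ltW st)// -(I t)// ?(ltW st)// -RintegralB//.
  by congr Rintegral; apply/funext => x; rewrite deta mulrBl.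
have beg : bounded_measurable (fun x => eta x * g x) by exact: bounded_measurableM.
have be1g : bounded_measurable (fun x => (eta x + cst (-1) x) * g x).
  apply: bounded_measurableM => //; apply: bounded_measurableD => //.
  exact: bounded_measurable_cst.
have tt1 : t <= t + 1 by rewrite lerDl.
have r1 : `|\int[mu]_(x in `[s, t]) ((eta x + cst (-1) x) * g x)| <= e / 4.
  rewrite (@Rintegral_support _ _ mu `[s, s + n%:R^-1]%classic); last first.
    move=> x; rewrite /= !in_itv /= => /andP[sx xt] /negP.
    rewrite negb_and -!ltNge ltNge sx /= => /ltW h.
    by rewrite eta_mid// subrr mul0r.
    move=> x; rewrite /= !in_itv /= => /andP[-> /= h]; exact: le_trans nst.
  apply: le_trans (@segment_integral_bound _ _ _ _ C _ _ _) _.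
  - by rewrite lerDl.
  - by apply: measurable_funTS; case: be1g.
  - by move=> x _; rewrite normrM -[C]mul1r ler_pM//; exact: eta_b1.
  by rewrite addrAC subrr add0r.
have r2 : `|\int[mu]_(x in `[t, t + 1]) (eta x * g x)| <= e / 4.
  rewrite (@Rintegral_support _ _ mu `[t, t + n%:R^-1]%classic); last first.
    move=> x; rewrite /= !in_itv /= => /andP[tx xt] /negP.
    rewrite negb_and -!ltNge ltNge tx /= => /ltW h.
    by rewrite eta_hi// mul0r.
    by move=> x; rewrite /= !in_itv /= => /andP[-> /= h]; apply: le_trans h _; rewrite lerD2l.
  apply: le_trans (@segment_integral_bound _ _ _ _ C _ _ _) _.
  - by rewrite lerDl.
  - by apply: measurable_funTS; case: beg.
  - by move=> x _; rewrite normrM -[C]mul1r ler_pM.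
  by rewrite addrAC subrr add0r.
rewrite L (Rintegral_support mu subA); last first.
  by move=> x _ /outA[/eta_lo|/eta_hi] ->; rewrite mul0r.
rewrite (segment_integral_cat beg (ltW st) tt1).
have -> : \int[mu]_(x in `[s, t]) (eta x * g x) =
    \int[mu]_(x in `[s, t]) g x + \int[mu]_(x in `[s, t]) ((eta x + cst (-1) x) * g x).
  rewrite -RintegralD//; [|exact: bounded_measurable_integrable..].
  by congr Rintegral; apply/funext => x /=; ring.
move: Ms Mt r1 r2; rewrite !ler_norml.
move: (Rintegral _ _ _) (Rintegral _ _ _) (Rintegral _ _ _) (Rintegral _ _ _) (Rintegral _ _ _).
move: (y s) (y t) => ys yt a1 a2 a3 a4 a5.
clear; move=> /andP[h1 h2] /andP[h3 h4] /andP[h5 h6] /andP[h7 h8] h9.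
by apply/andP; split; lra.
Unshelve. all: by end_near. Qed.

End WeakDerivative.

(* No measurability is required of the integrands: the integral of a
   nonnegative function is a supremum over the simple functions below it. *)
Section NonmeasurableIntegrands.
Context d (T : measurableType d) (R : realType) (mu : {measure set T -> \bar R}).
Context (N : set T) (mN : measurable N) (N0 : mu N = 0%E).
Implicit Types f g : T -> \bar R.
Import HBNNSimple.

(** A simple function below f, set to 0 on N, lies below g and keeps its integral because N is
    null. *)
Lemma ge0_le_integral_off_null f g : (forall x, 0 <= f x)%E -> (forall x, 0 <= g x)%E ->
  (forall x, ~ N x -> f x <= g x)%E -> (\int[mu]_x f x <= \int[mu]_x g x)%E.
Proof.
move=> f0 g0 fg; rewrite ge0_integralTE// [leRHS]ge0_integralTE//.
apply: ge_ereal_sup => _ [h /= hf <-].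
have mNC : measurable (~` N) by exact: measurableC.
apply: (@le_trans _ _ (sintegral mu (proj_nnsfun h mNC))); last first.
  apply: ereal_sup_ubound; exists (proj_nnsfun h mNC) => //= x; rewrite /= /mindic indicE.
  have [Nx|nNx] := pselect (N x).
    by rewrite memNset ?mulr0//; exact/contrapT.
  by rewrite mem_set// mulr1; apply: le_trans (hf x) (fg x nNx).
rewrite -!integralT_nnsfun le_eqVlt; apply/orP; left; apply/eqP.
apply: ae_eq_integral => //.
- exact/measurable_EFinP.
- exact/measurable_EFinP.
exists N; split => // x /= H; apply: contrapT => nNx; apply: H => _.
by rewrite /= /mindic indicE mem_set// mulr1.
Qed.

Lemma le_integral_off_null (D : set T) f g :
  (forall x, D x -> ~ N x -> f x <= g x)%E ->
  (\int[mu]_(x in D) f x <= \int[mu]_(x in D) g x)%E.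
Proof.
move=> fg; rewrite integral_mkcond [leRHS]integral_mkcond.
have fgD x : ~ N x -> ((f \_ D) x <= (g \_ D) x)%E.
  by move=> nNx; rewrite !patchE; case: ifPn => // /set_mem Dx; exact: fg.
rewrite integralE [leRHS]integralE; apply: leeB; apply: ge0_le_integral_off_null => // x nNx.
  by rewrite !funeposE ge_max !le_max fgD//= lexx orbT.
by rewrite !funenegE ge_max !le_max leeN2 fgD//= lexx orbT.
Qed.

Lemma eq_integral_off_null (D : set T) f g :
  (forall x, D x -> ~ N x -> f x = g x) ->
  (\int[mu]_(x in D) f x = \int[mu]_(x in D) g x)%E.
Proof.
move=> fg; apply/eqP; rewrite eq_le; apply/andP.
by split; apply: le_integral_off_null => x Dx nNx; rewrite fg.
Qed.

End NonmeasurableIntegrands.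

(** * Leray-Hopf solutions *)

Lemma time_test_function_ge {R : realType} (eta : R -> R) : time_test_function eta ->
  exists2 T : R, 0 < T & forall t, T <= t -> eta t = 0.
Proof.
move=> [_ [K [cK _ etaK]]]; have [M [_ HM]] := compact_bounded cK.
clear cK; exists (`|M| + 2) => [|t Mt]; first by have := normr_ge0 M; lra.
apply: etaK => Kt; have MM : M < `|M| + 1 by have := ler_norm M; lra.
have := le_trans (ler_norm t) (HM _ MM t Kt).
by move: Mt; clear; lra.
Qed.

Section TimeEvolution.
Context {R : realType} (Omega : set (space3 R)) (nu : R) (f : vfield R -> R).
Hypotheses (oO : open Omega) (bO : bounded_set Omega).
Local Notation mu := (@lebesgue_measure R).
Implicit Types (w : vfield R) (u : R -> vfield R).

Lemma continuous_clamp (F : R -> R) (b : R) : 0 <= b ->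
  {within `[0, +oo[, continuous F} -> continuous (fun t => F (Num.max t b)).
Proof.
move=> b0 /subspace_continuousP cF t.
have mt : `[0, +oo[%classic (Num.max t b) by rewrite /= in_itv /= andbT le_max b0 orbT.
apply/cvgrPdist_lt => e e0.
have /cvgrPdist_lt/(_ e e0) := cF _ mt.
rewrite /= near_withinE => /nbhs_ballP[d /= d0 Hd].
apply/nbhs_ballP; exists d => // s; rewrite /ball /= => sd.
apply: Hd; last by rewrite /= in_itv /= andbT le_max b0 orbT.
rewrite /ball /=; apply: le_lt_trans sd.
case: (leP t b) => h1; case: (leP s b) => h2 //.
- by rewrite subrr normr0.
- by rewrite !ler0_norm ?subr_le0 ?(ltW h2) ?(ltW (le_lt_trans h1 h2))//; lra.
- by rewrite !ger0_norm ?subr_ge0 ?(ltW h1) ?(le_trans h2 (ltW h1))//; lra.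
Qed.

Lemma l2norm_le_sqr (v : vfield R) (rho : R) : Hspace Omega v -> l2norm Omega v <= rho ->
  ip Omega v v <= rho ^+ 2.
Proof.
move=> Hv vr; have v0 := semi_inner_ge0 (semi_inner_Hspace oO bO) Hv.
rewrite -(sqr_sqrtr v0) lerXn2r ?nnegrE ?sqrtr_ge0//.
by apply: le_trans vr; exact: sqrtr_ge0.
Qed.

Lemma ip_bound (v h : vfield R) : fieldL2 Omega v -> fieldL2 Omega h ->
  `|ip Omega v h| <= ip Omega v v + ip Omega h h.
Proof.
move=> sv sh; have SI := semi_inner_fieldL2 oO.
have v0 := semi_inner_ge0 SI sv; have h0 := semi_inner_ge0 SI sh.
have := semi_inner_ge0 SI (semi_innerB SI sv sh); rewrite (ip_sqrB SI)//.
have := semi_inner_ge0 SI (semi_innerD SI sv (semi_innerZ SI 1 sh)); rewrite (ip_sqrD SI)//.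
rewrite ler_norml; move: v0 h0; move: (ip Omega v v) (ip Omega h h) (ip Omega v h).
by move=> a b c a0 b0 h1 h2; apply/andP; split; lra.
Qed.

Lemma FW_bound w (r : R) : Wspace Omega w -> exists C, forall v,
  Hspace Omega v -> ip Omega v v <= r -> `|FW Omega nu f v w| <= C.
Proof.
move=> Ww; have [K K0 HK] := trilin_bound oO Ww.
have sA := Hspace_L2 (stokesH_H Ww).
exists (`|f w| + `|nu| * (r + ip Omega (stokesH Omega w) (stokesH Omega w)) + K * (r + r)).
move=> v Hv vr; have sv := Hspace_L2 Hv; rewrite /FW.
apply: le_trans (ler_normD _ _) _; apply: lerD.
  apply: le_trans (ler_normB _ _) _; rewrite lerD2l normrM ler_wpM2l//.
  by apply: le_trans (ip_bound sv sA) _; rewrite lerD2r.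
by apply: le_trans (HK _ _ sv sv) _; rewrite ler_wpM2l// lerD.
Qed.

Lemma FW_measurable w (u : R -> vfield R) : Wspace Omega w ->
  (forall t, Hspace Omega (u t)) ->
  (forall h, Hspace Omega h -> continuous (fun t => ip Omega (u t) h)) ->
  measurable_fun setT (fun t => FW Omega nu f (u t) w).
Proof.
move=> Ww Hu cu; have HA := stokesH_H Ww.
have SH := semi_inner_Hspace oO bO.
have [K K0 HK] := trilin_bound oO Ww.
have cT v : Hspace Omega v -> forall e : R, 0 < e -> exists2 del : R, 0 < del &
    forall y, Hspace Omega y -> ip Omega (y - v) (y - v) < del ->
      `|trilin Omega y w y - trilin Omega v w v| < e.
  move=> Hv e e0; apply: (bilinear_diag_continuous (T := fun v y => trilin Omega v w y)
    SH K0 _ _ _ Hv e0).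
  - by move=> a v1 v2 y /Hspace_L2 ? /Hspace_L2 ? /Hspace_L2 ?; exact: trilin_linl.
  - by move=> a v1 v2 y /Hspace_L2 ? /Hspace_L2 ? /Hspace_L2 ?; exact: trilin_linr.
  - by move=> v1 v2 /Hspace_L2 ? /Hspace_L2 ?; exact: HK.
have mT := measurable_continuous_comp SH (semi_complete_Hspace oO bO) Hu cu cT.
rewrite /FW; apply: measurable_funD => //; apply: measurable_funB; first exact: measurable_cst.
apply: measurable_funM; first exact: measurable_cst.
by apply: continuous_measurable_fun; exact: cu.
Qed.

Section Trajectory.
Context (u : R -> vfield R) (b r : R).
Hypotheses (LHu : leray_hopf Omega nu f u) (b0 : 0 < b)
  (ur : forall t, b <= t -> ip Omega (u t) (u t) <= r).

(* Freezing [u] before time [b > 0], where it need not lie in the absorbing ball,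
   makes it bounded and weakly continuous on the whole line. *)
Definition late t := u (Num.max t b).

Definition late_ip w t : R := ip Omega (late t) w.

Definition late_FW w t : R := \1_`]b, +oo[%classic t * FW Omega nu f (late t) w.

Lemma late_H t : Hspace Omega (late t).
Proof. by case: LHu => + _ _ _ _; apply; rewrite le_max (ltW b0) orbT. Qed.

Lemma late_le t : ip Omega (late t) (late t) <= r.
Proof. by apply: ur; rewrite le_max lexx orbT. Qed.

Lemma late_eq t : b <= t -> late t = u t.
Proof. by move=> bt; rewrite /late (max_idPl bt). Qed.

Lemma continuous_late_ip h : Hspace Omega h -> continuous (late_ip h).
Proof.
move=> Hh; case: LHu => _ wc _ _ _.
exact: (continuous_clamp (ltW b0) (wc h Hh)).
Qed.

Lemma bounded_measurable_late_FW w : Wspace Omega w -> bounded_measurable (late_FW w).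
Proof.
move=> Ww; apply: bounded_measurableM.
  split; first exact: measurable_indic.
  by exists 1 => t; rewrite indicE; case: (_ \in _); rewrite ?normr1 ?normr0.
split; first by apply: FW_measurable => //; [exact: late_H|exact: continuous_late_ip].
have [C HC] := FW_bound r Ww; exists C => t; apply: HC; [exact: late_H|exact: late_le].
Qed.

Lemma leray_hopf_ae_V (T : R) : 0 < T -> exists N : set R,
  [/\ measurable N, mu N = 0%E & forall t, 0 < t < T -> ~ N t -> Vspace Omega (u t)].
Proof.
move=> T0; case: LHu => _ _ /(_ T T0)[_ [[N [mN N0 NV _]] _]] _ _.
by exists N; split => // t tT nNt; apply: NV; split => //=; rewrite in_itv.
Qed.

(** Test functions vanishing up to b do not see the freezing. The exchange of [FV] for [FW] takes
    place where u(t) is in V, that is off a null set. *)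
Lemma late_weak_equation w (eta : R -> R) : Wspace Omega w -> time_test_function eta ->
  (forall t, t <= b -> eta t = 0) ->
  - (\int[mu]_(t in `]0, +oo[) (derive1 eta t * late_ip w t)) =
  \int[mu]_(t in `]0, +oo[) (eta t * late_FW w t).
Proof.
move=> Ww teta eta0; have [_ _ _ we _] := LHu.
have E1 : \int[mu]_(t in `]0, +oo[) (derive1 eta t * late_ip w t) =
    \int[mu]_(t in `]0, +oo[) (derive1 eta t * ip Omega (u t) w).
  congr Rintegral; apply/funext => t; rewrite /late_ip.
  have [bt|tb] := leP b t; first by rewrite late_eq.
  rewrite derive1E (near_eq_derive (g := cst 0)); first by rewrite derive_cst !mul0r.
  have : \forall s \near t, s < b by exact: lt_nbhsl.
  by apply: filterS => s /ltW; exact: eta0.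
rewrite E1 (we w (Wspace_V Ww) eta teta).
(* Membership in V for almost every time is given on bounded intervals; T lies beyond the support of
   eta. *)
have [T T0 etaT] := time_test_function_ge teta.
have [N [mN N0 NV]] := leray_hopf_ae_V T0.
congr fine; apply: (@eq_integral_off_null _ _ R mu N mN N0) => t /=.
rewrite in_itv /= andbT => t0 nNt; congr EFin.
have [tb|bt] := leP t b; first (rewrite (eta0 t tb) !mul0r; reflexivity).
have [Tt|tT] := leP T t; first (rewrite (etaT t Tt) !mul0r; reflexivity).
rewrite /late_FW indicE mem_set ?mul1r; last by rewrite /= in_itv /= andbT.
have /NV/(_ nNt) Vt : 0 < t < T by rewrite t0 tT.
rewrite (late_eq (ltW bt)) (FV_FW oO bO nu f Vt Ww); reflexivity.
Qed.

Lemma late_ip_primitive w (a c : R) : Wspace Omega w -> a <= c ->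
  late_ip w c - late_ip w a = \int[mu]_(x in `[a, c]) late_FW w x.
Proof.
move=> Ww ac; have bm := bounded_measurable_late_FW Ww.
have Hw : Hspace Omega w := (Wspace_V Ww).1.
have key := weak_derivative_primitive b0 (continuous_late_ip Hw) bm
  (fun eta teta => late_weak_equation Ww teta).
(* Up to b both sides vanish, and [key] covers the times from b on; a segment containing b is cut
   there. *)
have low s t : s <= t -> t <= b ->
    late_ip w t - late_ip w s = \int[mu]_(x in `[s, t]) late_FW w x.
  move=> st tb; rewrite /late_ip /late (max_idPr tb) (max_idPr (le_trans st tb)) subrr.
  rewrite (@Rintegral_support _ _ _ mu set0 `[s, t]) ?Rintegral_set0// => x.
  rewrite /= in_itv /= => /andP[_ xt] _; rewrite /late_FW indicE memNset ?mul0r//=.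
  by rewrite in_itv /= andbT; apply/negP; rewrite -leNgt (le_trans xt).
move: (late_ip w) (late_FW w) bm key low => Y g bm key low {Ww Hw}.
move: ac; rewrite le_eqVlt => /orP[/eqP<-|ac].
  by rewrite subrr set_itv1 Rintegral_set1.
have [ab|/ltW ba] := leP a b; last exact: key ba ac.
have [cb|bc] := leP c b; first exact: low (ltW ac) cb.
rewrite (segment_integral_cat bm ab (ltW bc)) -(low _ _ ab (lexx b)) -(key _ _ (lexx b) bc).
by rewrite [RHS]addrC addrA subrK.
Qed.

Lemma cylinder_primitive m (w : 'I_m -> vfield R) (psi : 'rV[R]_m -> R) (x1 x2 : R) :
  (forall k, Wspace Omega (w k)) -> C1c psi -> x1 <= x2 ->
  psi (\row_k late_ip (w k) x2) - psi (\row_k late_ip (w k) x1) =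
  \int[mu]_(x in `[x1, x2])
    \sum_k 'D_(delta_mx 0 k) psi (\row_l late_ip (w l) x) * late_FW (w k) x.
Proof.
move=> Ww Cpsi x12.
have cy k : continuous (late_ip (w k)).
  by apply: continuous_late_ip; case: (Wspace_V (Ww k)).
have cc k : continuous (fun x => 'D_(delta_mx 0 k) psi (\row_l late_ip (w l) x)).
  have [_ /(_ k)[_ dc] _] := Cpsi => x.
  exact: (cvg_comp _ _ (@continuous_row _ _ _ cy x) (dc _)).
apply: (primitive_chain_rule (y := fun k => late_ip (w k))
  (Phi := fun x => psi (\row_k late_ip (w k) x))) => //.
- by move=> k; exact: bounded_measurable_late_FW.
- move=> k; apply: bounded_continuous_measurable => //.
  by have [C HC] := C1c_partial_bounded Cpsi k; exists C => x.
- by move=> k a c ac; exact: late_ip_primitive.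
- by move=> x0 e e0; exact: C1c_row_expansion.
Qed.

End Trajectory.
End TimeEvolution.

(** * Time averages *)

Section TimeAverages.
Context {R : realType}.
Local Notation mu := (@lebesgue_measure R).

(** A real integral is [fine] of an extended one, which is monotone between finite values; the lower
    bound - M keeps the integral of p away from minus infinity. *)
Lemma le_Rintegral_off_null (N : set R) (p g : R -> R) (a b M : R) :
  measurable N -> mu N = 0%E -> bounded_measurable g ->
  (forall t, a <= t <= b -> - M <= p t) ->
  (forall t, a <= t <= b -> ~ N t -> p t <= g t) ->
  \int[mu]_(t in `[a, b]) p t <= \int[mu]_(t in `[a, b]) g t.
Proof.
move=> mN N0 bg lo hi.
have fn h : bounded_measurable h -> (\int[mu]_(t in `[a, b]) (h t)%:E)%E \is a fin_num.
  by move=> bh; apply: integrable_fin_num => //; exact: bounded_measurable_integrable bh.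
have pg : (\int[mu]_(t in `[a, b]) (p t)%:E <= \int[mu]_(t in `[a, b]) (g t)%:E)%E.
  apply: (@le_integral_off_null _ _ R mu N mN N0) => t /=.
  by rewrite in_itv /= lee_fin; exact: hi.
have lp : (\int[mu]_(t in `[a, b]) (cst (- M) t)%:E <= \int[mu]_(t in `[a, b]) (p t)%:E)%E.
  apply: (@le_integral_off_null _ _ R mu N mN N0) => t /=.
  by rewrite in_itv /= lee_fin => tab _; exact: lo.
apply: fine_le => //; last exact: fn.
rewrite fin_numElt; apply/andP; split.
  by apply: lt_le_trans lp; rewrite ltNye_eq fn//; exact: bounded_measurable_cst.
by apply: (le_lt_trans pg); rewrite ltey_eq fn.
Qed.

Lemma Rintegral_affine (i h : R -> R) (s c T : R) : 0 <= T ->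
  bounded_measurable i -> bounded_measurable h ->
  \int[mu]_(t in `[0, T]) (s + c * i t + -1 * h t) =
  s * T + c * (\int[mu]_(t in `[0, T]) i t) - \int[mu]_(t in `[0, T]) h t.
Proof.
move=> T0 bi bh.
have int g : bounded_measurable g -> mu.-integrable `[0, T] (EFin \o g).
  exact: bounded_measurable_integrable.
have mT : measurable (`[0, T]%classic : set R) by [].
have bc (x : R) := bounded_measurable_cst x.
have bci := bounded_measurableM (bc c) bi.
rewrite (@RintegralD _ _ R mu _ _ _ mT (int _ (bounded_measurableD (bc s) bci))
  (int _ (bounded_measurableM (bc (-1)) bh))).
rewrite (@RintegralD _ _ R mu _ _ _ mT (int _ (bc s)) (int _ bci)).
rewrite (@RintegralZl _ _ R mu _ _ _ mT (int _ bi)) (@RintegralZl _ _ R mu _ _ _ mT (int _ bh)).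
rewrite mulN1r (Rintegral_cst mu mT).
suff -> : fine (mu `[0, T]) = T by [].
rewrite lebesgue_measure_itv /= lte_fin; case: ltP => [_|T0']; first by rewrite oppr0 /= addr0.
by apply/eqP; rewrite eq_le T0.
Qed.

Lemma Rintegral_indic_le (b T : R) : 0 <= b -> 0 <= T ->
  \int[mu]_(t in `[0, T]) \1_`]-oo, b]%classic t <= b :> R.
Proof.
move=> b0 T0; have i1 (t : R) : `|\1_`]-oo, b]%classic t| <= 1 :> R.
  by rewrite indicE; case: (_ \in _); rewrite ?normr1 ?normr0.
have m1 (D : set R) : measurable_fun D (\1_`]-oo, b]%classic : R -> R).
  exact: measurable_indic.
have seg c : 0 <= c -> \int[mu]_(t in `[0, c]) \1_`]-oo, b]%classic t <= c :> R.
  move=> c0; have := segment_integral_bound c0 (m1 _) (fun x _ => i1 x).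
  by rewrite mul1r subr0; apply: le_trans; exact: ler_norm.
have [Tb|/ltW bT] := leP T b; first exact: le_trans (seg T T0) Tb.
rewrite (@Rintegral_support _ _ _ mu `[0, b]) ?seg// => t /=.
  by rewrite !in_itv /= => /andP[-> tb]; exact: le_trans tb bT.
rewrite !in_itv /= => /andP[-> _] /= tb.
by rewrite indicE memNset//= in_itv.
Qed.

(** For T > |D| / e the remainder D / T is below e. *)
Lemma limf_esup_time_average (p : R -> R) (s D : R) :
  (forall T, 0 <= T -> \int[mu]_(t in `[0, T]) p t <= s * T + D) ->
  (limf_esup (fun T : R => (T^-1 * \int[mu]_(t in `[0%R, T]) p t)%:E) (pinfty_nbhs R)
   <= s%:E)%E.
Proof.
move=> pD; apply/lee_addgt0Pr => e e0.
apply: (@le_trans _ _ (ereal_sup [set (T^-1 * \int[mu]_(t in `[0%R, T]) p t)%:E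
    | T in [set T | `|D| / e < T]])).
  apply: ereal_inf_lbound; exists [set T | `|D| / e < T] => //.
  by exists (`|D| / e); split => //; exact: num_real.
apply: ge_ereal_sup => _ [T /= DT <-].
have T0 : 0 < T by apply: le_lt_trans DT; rewrite divr_ge0// ltW.
rewrite -EFinD lee_fin ler_pdivrMl// (le_trans (pD T (ltW T0)))//.
rewrite mulrDr mulrC lerD2l (le_trans (ler_norm D))// -ler_pdivrMr//.
exact: ltW.
Qed.

End TimeAverages.

Section SolutionAverages.
Context {R : realType} (Omega : set (space3 R)) (nu : R) (f : vfield R -> R).
Hypotheses (oO : open Omega) (bO : bounded_set Omega).
Local Notation mu := (@lebesgue_measure R).

Lemma cylinder_time_average (u : R -> vfield R) (phi : vfield R -> R) (b r M s : R)
    m (w : 'I_m -> vfield R) (psi : 'rV[R]_m -> R) :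
  leray_hopf Omega nu f u -> 0 < b ->
  (forall t, b <= t -> ip Omega (u t) (u t) <= r) ->
  (forall k, Wspace Omega (w k)) -> C1c psi ->
  (forall t, 0 <= t -> `|phi (u t)| <= M) ->
  (forall t, b <= t -> Vspace Omega (u t) ->
    phi (u t) + \sum_k 'D_(delta_mx 0 k) psi (\row_l ip Omega (u t) (w l)) *
      FW Omega nu f (u t) (w k) <= s) ->
  exists D, forall T, 0 <= T -> \int[mu]_(t in `[0, T]) phi (u t) <= s * T + D.
Proof.
move=> LHu b0 ur Ww Cpsi phiM phis.
have [C psiC] := C1c_bounded Cpsi.
have cylP := cylinder_primitive oO bO LHu b0 ur Ww Cpsi.
have bh : bounded_measurable (fun x => \sum_k 'D_(delta_mx 0 k) psi
    (\row_l late_ip Omega u b (w l) x) * late_FW Omega nu f u b (w k) x).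
  apply: bounded_measurable_sum => k; apply: bounded_measurableM.
    apply: bounded_continuous_measurable; last first.
      by have [K HK] := C1c_partial_bounded Cpsi k; exists K => x.
    have [_ /(_ k)[_ dc] _] := Cpsi => x.
    refine (cvg_comp _ _ (@continuous_row _ _ _ _ x) (dc _)) => l.
    by apply: (continuous_late_ip LHu b0); exact: (Wspace_V (Ww l)).1.
  exact: (bounded_measurable_late_FW oO bO LHu b0 ur).
set h := (fun x => \sum_k _) in cylP bh.
set i1 : R -> R := \1_`]-oo, b]%classic.
have bi : bounded_measurable i1.
  split; first exact: measurable_indic.
  by exists 1 => t; rewrite /i1 indicE; case: (_ \in _); rewrite ?normr1 ?normr0.
have bs : bounded_measurable (fun t => s + (M + `|s|) * i1 t).
  apply: bounded_measurableD; first exact: bounded_measurable_cst.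
  by apply: bounded_measurableM bi; exact: bounded_measurable_cst.
have bG : bounded_measurable (fun t => s + (M + `|s|) * i1 t + -1 * h t).
  apply: bounded_measurableD bs _.
  by apply: bounded_measurableM bh; exact: bounded_measurable_cst.
have M0 : 0 <= M + `|s| by rewrite addr_ge0// (le_trans _ (phiM b (ltW b0))).
(* Up to time b only phi(u) <= M <= s + (M + |s|) is available, an excess lasting at most b; 2 C
   bounds the variation of psi between the two ends. *)
exists ((M + `|s|) * b + 2 * C) => T T0.
(* The null set is given for an open interval of times, and []0, T + 1[] contains the end T. *)
have T1 : 0 < T + 1 by rewrite ltr_wpDl.
have [N [mN N0 NV]] := leray_hopf_ae_V LHu T1.
have pointwise t : 0 <= t <= T -> ~ N t -> phi (u t) <= s + (M + `|s|) * i1 t + -1 * h t.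
  move=> /andP[t0 tT] nNt; have [tb|bt] := leP t b.
    rewrite /h big1 => [|k _]; last first.
      rewrite /late_FW indicE memNset ?mul0r ?mulr0//= in_itv /= andbT.
      by apply/negP; rewrite -leNgt.
    rewrite /i1 indicE mem_set ?mulr1 ?mulr0 ?addr0; last by rewrite /= in_itv.
    apply: le_trans (ler_norm _) _; apply: le_trans (phiM t t0) _.
    by rewrite addrCA lerDl -lerBlDl sub0r -normrN ler_norm.
  rewrite /i1 indicE memNset; last by rewrite /= in_itv /=; apply/negP; rewrite -ltNge.
  have Vt : Vspace Omega (u t).
    apply: NV => //; rewrite (lt_trans b0 bt) /=.
    by rewrite (le_lt_trans tT)// ltrDl.
  rewrite mulr0 addr0 mulN1r lerBrDr; apply: le_trans (phis t (ltW bt) Vt).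
  have lt : late u b t = u t by apply: late_eq; exact: ltW.
  have rt : \row_l late_ip Omega u b (w l) t = \row_l ip Omega (u t) (w l).
    by apply/rowP => l; rewrite !mxE /late_ip lt.
  have ht : h t = \sum_k 'D_(delta_mx 0 k) psi (\row_l ip Omega (u t) (w l)) *
      FW Omega nu f (u t) (w k).
    apply: eq_bigr => k _.
    rewrite rt /late_FW indicE mem_set; last by rewrite /= in_itv /= andbT.
    by rewrite mul1r lt.
  by rewrite ht.
apply: le_trans (le_Rintegral_off_null (M := M) mN N0 bG _ pointwise) _.
  by move=> t /andP[t0 _]; move: (phiM t t0); rewrite ler_norml => /andP[].
rewrite (Rintegral_affine _ _ T0 bi bh).
rewrite -(cylP 0 T T0).
have := ler_wpM2l M0 (Rintegral_indic_le (ltW b0) T0).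
have := psiC (\row_k late_ip Omega u b (w k) 0).
have := psiC (\row_k late_ip Omega u b (w k) T).
rewrite !ler_norml => /andP[+ _] /andP[_ +].
move: (psi _) (psi _) (_ * Rintegral _ _ _) (_ * b) (s * T) => p1 p2 p3 p4 p5.
by move=> h1 h2 h3; lra.
Qed.

End SolutionAverages.

Theorem theorem6p4 (R : realType) (Omega : set (space3 R)) (nu : R)
    (f : vfield R -> R) (E : set (vfield R)) (rho : R) (phi : vfield R -> R) :
  bounded_smooth_domain Omega ->
  0 < nu ->
  Vdual Omega f ->
  subset_of_H Omega E ->
  positively_invariant Omega nu f E ->
  0 < rho ->
  absorbs_all_solutions Omega nu f (Hball Omega rho) ->
  Cb Omega E phi ->
  (ereal_sup
     [set limf_esup
            (fun T : R =>
               (T^-1 * (\int[@lebesgue_measure R]_(t in `[0%R, T]) phi (u t)))%:E)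
            (pinfty_nbhs R)
     | u in solutions_in Omega nu f E]
   <=
   ereal_inf
     [set ereal_sup
            [set (phi u + FW Omega nu f u (P.2 (H_to_Wdual Omega u)))%:E
            | u in E `&` Hball Omega rho]
     | P in [set P : ((vfield R -> R) -> R) * ((vfield R -> R) -> vfield R)
            | Tcyl Omega P.1 P.2]])%E.
Proof.
move=> [_ oO _ bO _] _ fV _ _ _ absorb [[M phiM] _].
apply: ge_ereal_sup => _ [u [LHu uE] <-]; apply: le_ereal_inf_tmp => _ [P TP <-].
case: P TP => Psi dPsi /= [m [w [psi [Ww Cpsi PsiE]]]].
have [T0 [T00 uB]] := absorb u LHu.
set S := ereal_sup _.
have Sub t : T0 <= t ->
    ((phi (u t) + FW Omega nu f (u t) (dPsi (H_to_Wdual Omega (u t))))%:E <= S)%E.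
  move=> T0t; apply: ereal_sup_ubound; exists (u t) => //.
  by split; [apply: uE; exact: le_trans T0t|exact: uB].
(* The absorption time may be 0, whereas the weak equation holds on the open half-line; freezing
   therefore takes place at the positive time [T0 + 1]. *)
have b0 : 0 < T0 + 1 by rewrite ltr_wpDl.
have T0b : T0 <= T0 + 1 by rewrite lerDl.
(* An infinite supremum can only be plus infinity, where the bound is trivial: at time [T0] the
   solution gives a real value below it. *)
clearbody S; case: S Sub => [s| |] Sub; last 2 first.
- exact: leey.
- by have := Sub T0 (lexx _); rewrite leeNy_eq.
have ur t : T0 + 1 <= t -> ip Omega (u t) (u t) <= rho ^+ 2.
  by move=> /(le_trans T0b)/uB[Hu ur]; apply: l2norm_le_sqr.
have phis t : T0 + 1 <= t -> Vspace Omega (u t) ->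
    phi (u t) + \sum_k 'D_(delta_mx 0 k) psi (\row_l ip Omega (u t) (w l)) *
      FW Omega nu f (u t) (w k) <= s.
  move=> /(le_trans T0b)/Sub + Vt; rewrite lee_fin.
  have [_ ->] := PsiE _ (H_to_Wdual_Wdual oO bO Vt.1).
  by rewrite (FW_sum oO bO nu _ fV Vt Ww).
have [D HD] := cylinder_time_average oO bO LHu b0 ur Ww Cpsi
  (fun t t0 => phiM _ (uE t t0)) phis.
exact: limf_esup_time_average HD.
Qed.
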